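(* Let $n\ge 1$. The following hold. (i) If $1<q<\infty$, then $\|\cdot\|_{H^{1,q}_{\mathrm{fin}}(\mathbb{R}^n)}$ and $\|\cdot\|_{H^1(\mathbb{R}^n)}$ are equivalent norms on $H^{1,q}_{\mathrm{fin}}(\mathbb{R}^n)$. (ii) The two norms $\|\cdot\|_{H^{1,\infty}_{\mathrm{fin}}(\mathbb{R}^n)}$ and $\|\cdot\|_{H^1(\mathbb{R}^n)}$ are equivalent on $H^{1,\infty}_{\mathrm{fin}}(\mathbb{R}^n)\cap C(\mathbb{R}^n)$.
   Context: Let $\mathbb{R}^n$ carry Lebesgue measure $|\cdot|$. For $q\in(1,\infty]$, a $(1,q)$-atom is a function $a\in L^q(\mathbb{R}^n)$ supported in a closed ball $B$, with $\int a\,dx=0$, and such that $\bigl(\frac1{|B|}\int_B|a|^q\,dx\bigr)^{1/q}\le |B|^{-1}$ if $q<\infty$, respectively $\|a\|_\infty\le |B|^{-1}$ if $q=\infty$. $H^{1,q}(\mathbb{R}^n)$ is the space of all $g\in L^1(\mathbb{R}^n)$ that can be written $g=\sum_j\lambda_j a_j$ with $a_j$ $(1,q)$-atoms and $\lambda_j\in\mathbb{C}$, $\sum_j|\lambda_j|<\infty$; its norm $\|g\|_{H^{1,q}}$ is the infimum of $\sum_j|\lambda_j|$ over all such decompositions. It is well known that all the spaces $H^{1,q}(\mathbb{R}^n)$, $q\in(1,\infty]$, coincide with equivalent norms; the common space is denoted $H^1(\mathbb{R}^n)$, with norm $\|\cdot\|_{H^1(\mathbb{R}^n)}$. $H^{1,q}_{\mathrm{fin}}(\mathbb{R}^n)$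 is the vector space of all finite linear combinations of $(1,q)$-atoms (equivalently, all compactly supported functions in $L^q(\mathbb{R}^n)$ with integral $0$), with norm $$\|f\|_{H^{1,q}_{\mathrm{fin}}(\mathbb{R}^n)}=\inf\Bigl\{\sum_{j=1}^N|\lambda_j| : f=\sum_{j=1}^N\lambda_j a_j,\ a_j \text{ a } (1,q)\text{-atom},\ N\in\mathbb{N}\Bigr\}.$$ $C(\mathbb{R}^n)$ denotes the continuous functions on $\mathbb{R}^n$. *)

(* Defs.v *)
From HB Require Import structures.
From mathcomp Require Import all_boot all_order all_algebra complex.
From mathcomp Require Import all_classical all_reals all_analysis.
From mathcomp Require Import measurable_realfun ess_sup_inf.

Set Implicit Arguments.
Unset Strict Implicit.
Unset Printing Implicit Defensive.

Import Order.TTheory GRing.Theory Num.Theory.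
Import numFieldNormedType.Exports.

Local Open Scope classical_set_scope.
Local Open Scope ring_scope.

Definition rV_display : measure_display.
Proof. exact: default_measure_display. Qed.

(* 'rV[R]_n carries its Borel sigma-algebra. *)
Section borel_rV.
Context {R : realType} {n : nat}.

Let borel : set (set 'rV[R]_n) := <<s open >>.

Let borel0 : borel set0.
Proof. exact: sigma_algebra0. Qed.

Let borelC A : borel A -> borel (~` A).
Proof. exact: sigma_algebraC. Qed.

Let borel_bigcup (F : (set 'rV[R]_n)^nat) :
  (forall i, borel (F i)) -> borel (\bigcup_i F i).
Proof. exact: sigma_algebra_bigcup. Qed.

HB.instance Definition _ := @isMeasurable.Build rV_display
  'rV[R]_n borel borel0 borelC borel_bigcup.

End borel_rV.

Lemma pushforward_sigma_finite d1 d2 (T1 : measurableType d1)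
    (T2 : measurableType d2) (R : realType)
    (m : set T1 -> \bar R) (f : T1 -> T2) (g : T2 -> T1) :
  cancel f g -> measurable_fun setT g ->
  sigma_finite setT m -> sigma_finite setT (pushforward m f).
Proof.
move=> fK mg [F FT mF].
exists (fun k => g @^-1` F k); first by rewrite -preimage_bigcup -FT.
move=> k; split.
  by rewrite -[X in measurable X]setTI; apply: mg => //; exact: (mF k).1.
rewrite /pushforward -comp_preimage (_ : g \o f = id) ?preimage_id.
  exact: (mF k).2.
exact/funext.
Qed.

Lemma product_measure_sigma_finite d1 d2 (T1 : measurableType d1)
    (T2 : measurableType d2) (R : realType)
    (m1 : {sigma_finite_measure set T1 -> \bar R})
    (m2 : {sigma_finite_measure set T2 -> \bar R}) :
  sigma_finite setT (m1 \x m2)%E.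
Proof.
have /sigma_finiteP[F [TF ndF Foo]] := sigma_finiteT m1.
have /sigma_finiteP[G [TG ndG Goo]] := sigma_finiteT m2.
exists (fun n => F n `*` G n).
  rewrite -setXTT TF TG predeqE => -[x y]; split.
    move=> [/= [n _ Fnx] [k _ Gky]]; exists (maxn n k) => //; split.
    - by move: x Fnx; exact/subsetPset/ndF/leq_maxl.
    - by move: y Gky; exact/subsetPset/ndG/leq_maxr.
  by move=> [n _ []/= ? ?]; split; exists n.
move=> k; have [? ?] := Foo k; have [? ?] := Goo k.
split; first exact: measurableX.
by rewrite product_measure1E// lte_mul_pinfty// ge0_fin_numE.
Qed.

Section lebesgue_tuple.
Context {R : realType}.
Local Notation mR := (measurableTypeR R).

Definition cons_pair n (p : mR * n.-tuple mR) : n.+1.-tuple mR :=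
  [tuple of p.1 :: p.2].

Definition uncons_tuple n (t : n.+1.-tuple mR) : mR * n.-tuple mR :=
  (thead t, [tuple of behead t]).

Lemma cons_pairK n : cancel (@cons_pair n) (@uncons_tuple n).
Proof.
by case=> x t; rewrite /uncons_tuple /cons_pair theadE; congr pair; exact/val_inj.
Qed.

Lemma measurable_cons_pair n : measurable_fun setT (@cons_pair n).
Proof. exact: measurable_cons. Qed.

Lemma measurable_uncons_tuple n : measurable_fun setT (@uncons_tuple n).
Proof.
apply/measurable_fun_pairP; split; first exact: measurable_tnth.
exact: measurable_behead.
Qed.

Definition tuple_prod n (m : {sigma_finite_measure set (n.-tuple mR) -> \bar R}) :
    set (n.+1.-tuple mR) -> \bar R :=
  pushforward (@lebesgue_measure R \x m)%E (@cons_pair n).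

Section tuple_prod_measure.
Context {n : nat} (m : {sigma_finite_measure set (n.-tuple mR) -> \bar R}).

HB.instance Definition _ := Measure.copy (tuple_prod m)
  (measure_function_pushforward__canonical__measure_function_Measure
     (@lebesgue_measure R \x m)%E (@measurable_cons_pair n)).

HB.instance Definition _ := Measure_isSigmaFinite.Build _ _ _ (tuple_prod m)
  (pushforward_sigma_finite (@cons_pairK n) (@measurable_uncons_tuple n)
     (product_measure_sigma_finite (@lebesgue_measure R) m)).

End tuple_prod_measure.

Fixpoint lebesgue_tuple n : {sigma_finite_measure set (n.-tuple mR) -> \bar R} :=
  match n with
  | 0 => dirac [tuple]
  | k.+1 => tuple_prod (lebesgue_tuple k)
  end.

Lemma lebesgue_tuple_box n (A : 'I_n -> set mR) :
  (forall i, measurable (A i)) ->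
  lebesgue_tuple n [set t | forall i, A i (tnth t i)] =
  (\prod_(i < n) lebesgue_measure (A i))%E.
Proof.
elim: n A => [|n ih] A mA.
  rewrite big_ord0 /= diracE mem_set//; by case.
rewrite big_ord_recl -ih//= /tuple_prod /pushforward -product_measure1E//; last first.
  rewrite (_ : [set _ | _] = \bigcap_(i in setT)
      ((fun t : n.-tuple mR => tnth t i) @^-1` A (lift ord0 i))).
    apply: fin_bigcap_measurable => // i _.
    by rewrite -[X in measurable X]setTI; exact: measurable_tnth.
  by apply/seteqP; split=> [t At i _|t At i]; [exact: At|exact: (At i I)].
congr (_ _); apply/seteqP; split=> -[x t] /=.
  by move=> At; split=> [|i]; [have := At ord0|have := At (lift ord0 i); rewrite tnthS].
move=> [Ax At] i; case: (unliftP ord0 i) => [j ->|-> //]; rewrite tnthS; exact: At.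
Qed.

End lebesgue_tuple.

Section lebesgue_rV.
Context {R : realType} {n : nat}.
Local Notation mR := (measurableTypeR R).

Definition rV_of_tuple (t : n.-tuple mR) : 'rV[R]_n := \row_i tnth t i.

Definition tuple_of_rV (x : 'rV[R]_n) : n.-tuple mR := [tuple x ord0 i | i < n].

Lemma rV_of_tupleK : cancel rV_of_tuple tuple_of_rV.
Proof. by move=> t; apply: eq_from_tnth => i; rewrite tnth_mktuple mxE. Qed.

Lemma measurable_tuple_of_rV : measurable_fun setT tuple_of_rV.
Proof.
apply/measurable_fun_tnthP => i.
rewrite (_ : _ \o _ = fun x : 'rV[R]_n => x ord0 i); last first.
  by apply/funext => x /=; rewrite tnth_mktuple.
apply: (measurability _ (RGenOpens.measurableE R)) => _ [_ [a [b ->]] <-].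
rewrite setTI; apply: sub_sigma_algebra => /=.
by apply: open_comp (interval_open _ _) => // x _; exact: coord_continuous.
Qed.

Lemma measurable_rV_of_tuple : measurable_fun setT rV_of_tuple.
Proof.
apply: (@measurability _ _ _ _ _ _ (@open 'rV[R]_n)) => // _ [U oU <-].
rewrite setTI.
pose box (k : 'rV[rat]_n * nat) : set (n.-tuple mR) :=
  [set t | forall i, `|tnth t i - ratr (k.1 ord0 i)| < k.2.+1%:R^-1].
pose inner (k : 'rV[rat]_n * nat) : Prop := rV_of_tuple @` box k `<=` U.
have mbox k : measurable (box k).
  rewrite (_ : box k = \bigcap_(i in setT)
     ((fun t : n.-tuple mR => tnth t i) @^-1`
       ball (ratr (k.1 ord0 i) : R) k.2.+1%:R^-1)); last first.
    apply/seteqP; split=> [t bt i _|t bt i] /=; first by rewrite /ball /= distrC.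
    by have := bt i I; rewrite /= /ball /= distrC.
  apply: fin_bigcap_measurable => // i _.
  rewrite -[X in measurable X]setTI; apply: measurable_tnth => //.
  exact: measurable_ball.
rewrite (_ : _ @^-1` U = \bigcup_k (if `[<inner k>] then box k else set0)).
  apply: countable_bigcupT_measurable => // k; case: ifP => // _; exact: mbox.
apply/seteqP; split=> [t /= Ut|t [k _]]; last first.
  by case: ifPn => // /asboolP kU bt; apply: kU; exists t.
have /nbhs_ballP[e /= e0 eU] : nbhs (rV_of_tuple t) U by exact: open_nbhs_nbhs.
have [N Ne] : exists N, N.+1%:R^-1 < e / 2.
  by have [N _ /(_ N (leqnn N))] := near_infty_natSinv_lt (PosNum (divr_gt0 e0 (ltr0n R 2))); exists N.
have q_ i : {q : rat | `|tnth t i - ratr q| < N.+1%:R^-1}.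
  apply: cid; have : tnth t i - N.+1%:R^-1 < tnth t i + N.+1%:R^-1.
    by rewrite ltrBlDr -addrA ltrDl addr_gt0.
  by move=> /rat_in_itvoo[q]; rewrite in_itv/= => q1; exists q; rewrite distrC ltr_distl.
exists (\row_i sval (q_ i), N) => //; case: ifPn => [_|/asboolP[]] /=.
  by move=> i; rewrite mxE; exact: svalP (q_ i).
move=> _ [u bu <-]; apply: eU; split=> // i j; rewrite !mxE /ball /=.
have := bu j; rewrite /= mxE => uq; have tq := svalP (q_ j).
rewrite (le_lt_trans (ler_distD (ratr (sval (q_ j))) _ _))//.
rewrite [e]splitr ltrD ?(lt_trans tq)//.
by rewrite distrC (lt_trans uq).
Qed.

Definition lebesgue_rV : set 'rV[R]_n -> \bar R :=
  pushforward (lebesgue_tuple n) rV_of_tuple.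

HB.instance Definition _ := Measure.copy lebesgue_rV
  (measure_function_pushforward__canonical__measure_function_Measure
     (lebesgue_tuple n) measurable_rV_of_tuple).

HB.instance Definition _ := Measure_isSigmaFinite.Build _ _ _ lebesgue_rV
  (pushforward_sigma_finite rV_of_tupleK measurable_tuple_of_rV
     (sigma_finiteT (lebesgue_tuple n))).

Lemma lebesgue_rV_box (A : 'I_n -> set mR) : (forall i, measurable (A i)) ->
  lebesgue_rV [set x | forall i, A i (x ord0 i)] =
  (\prod_(i < n) lebesgue_measure (A i))%E.
Proof.
move=> mA; rewrite -lebesgue_tuple_box// /lebesgue_rV /pushforward.
by congr (_ _); apply/seteqP; split=> t At i; have := At i; rewrite /= mxE.
Qed.

End lebesgue_rV.

Section hardy.
Context {R : realType} {n : nat}.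
Local Notation V := 'rV[R]_n.
Local Notation C := R[i].
Local Notation mu := (@lebesgue_rV R n).
Local Notation Re := (@complex.Re R).
Local Notation Im := (@complex.Im R).
Local Notation normc := (@ComplexField.Normc.normc R).

(* Elements of L^p are represented by Borel functions; equalities between them
   are always meant almost everywhere. *)
Definition cmeasurable (f : V -> C) : Prop :=
  measurable_fun setT (Re \o f) /\ measurable_fun setT (Im \o f).

Definition cLp (p : \bar R) : set (V -> C) :=
  [set f | cmeasurable f /\ ('N[mu]_p[EFin \o (normc \o f)] < +oo)%E].

Definition cintegral (f : V -> C) : C :=
  ((\int[mu]_x Re (f x)) +i* (\int[mu]_x Im (f x)))%C.

(* The norm of the normed space 'rV[R]_n is the sup norm, hence this
   Euclidean ball. *)
Definition eball (c : V) (r : R) : set V :=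
  [set x | Num.sqrt (\sum_i (x ord0 i - c ord0 i) ^+ 2) <= r].

Definition atom_size (q : \bar R) (B : set V) (a : V -> C) : Prop :=
  match q with
  | q'%:E => (((mu B)^-1 * \int[mu]_(x in B) (normc (a x) `^ q')%:E) `^ q'^-1
               <= (mu B)^-1)%E
  | +oo%E => ('N[mu]_+oo[EFin \o (normc \o a)] <= (mu B)^-1)%E
  | -oo%E => False
  end.

Definition is_atom (q : \bar R) (a : V -> C) : Prop :=
  cLp q a /\ cintegral a = 0 /\
  exists c r, [/\ 0 < r, {ae mu, forall x, ~ eball c r x -> a x = 0}
                & atom_size q (eball c r) a].

(* The series converges in L^1; since atoms have L^1 norm at most 1 and
   (lam_j) is summable, convergence almost everywhere is equivalent. *)
Definition atomic_decomposition (q : \bar R) (g : V -> C)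
    (lam : nat -> C) (a : nat -> V -> C) : Prop :=
  [/\ cLp 1%E g, forall j, is_atom q (a j),
      (\sum_(0 <= j <oo) (normc (lam j))%:E < +oo)%E &
      (\int[mu]_x (normc (g x - \sum_(j < N) lam j * a j x))%:E)%E
        @[N --> \oo] --> 0%E].

(* The spaces H^{1,q}, 1 < q <= +oo, are one space H^1 with equivalent norms:
   the norm of H^1 is any of the following ones, and it is finite exactly on
   the functions that admit an atomic decomposition. *)
Definition H1_norm (q : \bar R) (g : V -> C) : \bar R :=
  ereal_inf [set s | exists lam a, atomic_decomposition q g lam a /\
                       s = (\sum_(0 <= j <oo) (normc (lam j))%:E)%E].

Definition finite_atomic_decomposition (q : \bar R) (f : V -> C)
    (N : nat) (lam : 'I_N -> C) (a : 'I_N -> V -> C) : Prop :=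
  (forall j, is_atom q (a j)) /\
  {ae mu, forall x, f x = \sum_(j < N) lam j * a j x}.

Definition H1fin (q : \bar R) : set (V -> C) :=
  [set f | cmeasurable f /\
    exists N (lam : 'I_N -> C) a, finite_atomic_decomposition q f lam a].

Definition H1fin_norm (q : \bar R) (f : V -> C) : \bar R :=
  ereal_inf [set s | exists N (lam : 'I_N -> C) a,
    finite_atomic_decomposition q f lam a /\
    s = (\sum_(j < N) normc (lam j))%:E].

Definition Ccont : set (V -> C) := [set f | continuous (f : V -> C^o)].

Definition is_norm (E : set (V -> C)) (N : (V -> C) -> \bar R) : Prop :=
  [/\ forall f, E f -> (0 <= N f < +oo)%E,
      forall f, E f -> N f = 0%E <-> {ae mu, forall x, f x = 0},
      forall (k : C) f, E f -> N (fun x => k * f x) = ((normc k)%:E * N f)%E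
    & forall f g, E f -> E g -> (N (fun x => f x + g x)%R <= N f + N g)%E].

Definition equivalent_norms (E : set (V -> C)) (N1 N2 : (V -> C) -> \bar R) : Prop :=
  [/\ is_norm E N1, is_norm E N2 &
      exists c1 c2 : R, [/\ 0 < c1, 0 < c2 &
        forall f, E f -> (c1%:E * N2 f <= N1 f)%E /\ (N1 f <= c2%:E * N2 f)%E]].

End hardy.

(* Main.v *)
Require Import Defs.
From mathcomp Require Import all_boot all_order all_algebra complex.
From mathcomp Require Import all_classical all_reals all_analysis.
From mathcomp Require Import measurable_realfun ess_sup_inf.
From mathcomp Require Import ring lra zify.
Import Order.TTheory GRing.Theory Num.Theory.
Import numFieldNormedType.Exports.
Local Open Scope classical_set_scope.
Local Open Scope ring_scope.
Set Implicit Arguments.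
Unset Strict Implicit.
Unset Printing Implicit Defensive.

(** Let E_M f be the following average of f over a dyadic grid: fold R^n onto the cube
    Q = [-L, L)^n by reflections, and replace f on each cell of side 2L/2^M by the folded mass of f
    in it, divided by its volume. A Calderon-Zygmund stopping-time argument on the dyadic tree
    shows that E_M maps every (1,p)-atom, wherever it lives, to a finite combination of
    (1,oo)-atoms whose cost is bounded by a constant K independent of M, of L and of the atom.

    Let f in H^{1,q}_fin be supported in Q, and let f = sum_j lam_j a_j be a series of atoms.
    Then f - E_M f has a small finite norm for M large, because step functions are dense in L^q,
    or because f is uniformly continuous. For this fixed M,
    E_M f = sum_{j<N} lam_j E_M a_j + E_M (tail), where the sum costs at most K sum_j |lam_j|,
    and the tail, small in L^1, is mapped to a step function on a fixed finite grid, whose finite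
    norm is at most C_M times this L^1 norm. Hence the finite norm is at most K times the H^1 norm.
    Conversely, iterating f |-> f - E_M f with M growing fast writes f as a series of
    (1,oo)-atoms of cost at most K times its finite norm. *)

(** * Folding the line onto an interval *)

(** The atoms of a series for [f] need not live near [Q], while a finite decomposition must. Cutting
    an atom at the boundary of [Q] would destroy its cancellation, and wrapping it around
    periodically would send nearby points to opposite faces. Folding keeps the integral and is
    1-Lipschitz, so a small ball lands in a cube of comparable size. A ball of radius r much larger
    than L covers [Q] about (r / L)^n times, but the size condition of the atom compensates this
    power. The supremum of the averages of an unbounded atom may grow as the mesh shrinks; the
    stopping time is what makes the cost independent of M. A weak pointwise Young inequality with a
    free threshold, whose constant term is absorbed, stands in for Holder's inequality. Since
    (1,oo)-atoms are (1,q)-atoms for every q > 1, the exponent of the series and that of the finite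
    decomposition are independent of each other, and the coincidence of the spaces H^{1,q} is not
    presupposed. Complex functions are treated through their real and imaginary parts, the phase of
    each coefficient being moved into its atom. *)

Lemma itv_measure (R : realType) (a b : R) (b0 b1 : bool) : a <= b ->
  lebesgue_measure ([set` Interval (BSide b0 a) (BSide b1 b)] : set R) = (b - a)%:E.
Proof.
rewrite lebesgue_measure_itv/= lte_fin le_eqVlt => /predU1P[->|->//].
by rewrite ltxx subrr.
Qed.

Section fold.
Context {R : realType}.
Variable L : R.
Hypothesis L0 : 0 < L.

Definition period_index (x : R) : int := Num.floor ((x + L) / (4 * L) + 2^-1).

(* The 4L-periodic triangle wave that equals [x + L] on [-L, L]. *)
Definition fold (x : R) : R := `|x + L - 4 * L * (period_index x)%:~R|.

Lemma period_index_itv x :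
  - (2 * L) <= x + L - 4 * L * (period_index x)%:~R < 2 * L.
Proof.
have /andP[] := floor_itv ((x + L) / (4 * L) + 2^-1).
rewrite -/(period_index x) intrD mulr1z.
set y := (x + L) / (4 * L) => h1 h2.
have -> : x + L = 4 * L * y by rewrite /y; field; exact: lt0r_neq0.
move: (_%:~R : R) h1 h2 => k; clearbody y => h1 h2.
have := mulr_ge0 (ltW L0) (_ : 0 <= y + 2^-1 - k); rewrite subr_ge0 => /(_ h1).
have := mulr_gt0 L0 (_ : 0 < k + 1 - (y + 2^-1)); rewrite subr_gt0 => /(_ h2).
by move=> ? ?; apply/andP; split; nra.
Qed.

Lemma fold_ge0 x : 0 <= fold x.
Proof. exact: normr_ge0. Qed.

Lemma fold_le x : fold x <= 2 * L.
Proof.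
by have /andP[? ?] := period_index_itv x; rewrite ler_norml; apply/andP; split => //; exact: ltW.
Qed.

(** Makes [fold x] the distance from [x + L] to the lattice of multiples of [4 * L]. As a distance
    to a set, [fold] is then 1-Lipschitz, although [period_index] jumps. *)
Lemma fold_min x (p : int) : fold x <= `|x + L - 4 * L * p%:~R|.
Proof.
have /andP[h1 h2] := period_index_itv x.
have := fold_le x; rewrite /fold.
set k := period_index x in h1 h2 *.
case: (ltgtP p k) => [pk|pk|->//].
- have : p%:~R + 1 <= k%:~R :> R by rewrite -[1]/(1%:~R) -intrD ler_int; lia.
  move=> pk1 fk; apply: (le_trans fk); apply: le_trans (ler_norm _); nra.
- have : k%:~R + 1 <= p%:~R :> R by rewrite -[1]/(1%:~R) -intrD ler_int; lia.
  move=> pk1 fk; apply: (le_trans fk); rewrite -normrN; apply: le_trans (ler_norm _); nra.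
Qed.

Lemma fold_lip x y : `|fold x - fold y| <= `|x - y|.
Proof.
have fold_lip1 u v : fold u <= fold v + `|u - v|.
  apply: (le_trans (fold_min u (period_index v))).
  rewrite (_ : u + L - _ = (v + L - 4 * L * (period_index v)%:~R) + (u - v)); last by ring.
  exact: ler_normD.
rewrite ler_norml; have := fold_lip1 x y; have := fold_lip1 y x.
rewrite (distrC y x); lra.
Qed.

Lemma fold_id x : - L <= x < L -> fold x = x + L.
Proof.
move=> /andP[h1 h2]; have /andP[h3 h4] := period_index_itv x.
have p0 : period_index x = 0.
  apply/eqP; rewrite floor_eq.
  have -> : (x + L) / (4 * L) + 2^-1 = (x + 3 * L) / (4 * L) by field; exact: lt0r_neq0.
  apply/andP; split; first by rewrite divr_ge0//; lra.
  rewrite ltr_pdivrMr; lra.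
by rewrite /fold p0 mulr0 subr0 ger0_norm//; lra.
Qed.

Definition mesh (M : nat) : R := 2 * L / 2 ^+ M.

Lemma mesh_gt0 M : 0 < mesh M.
Proof. by rewrite divr_gt0 ?mulr_gt0 ?exprn_gt0. Qed.

Lemma mesh_le M : mesh M <= 2 * L.
Proof.
rewrite /mesh ler_pdivrMr ?exprn_gt0//; apply: ler_peMr; first by rewrite mulr_ge0// ltW.
by rewrite -natrX ler1n expn_gt0.
Qed.

Lemma meshS M l : (l <= M)%N -> mesh (M - l) = 2 ^+ l * mesh M.
Proof.
move=> lM; rewrite /mesh -{2}(subnKC lM) exprD; field.
by rewrite !expf_neq0.
Qed.

(* The minimum only matters at the end point [fold x = 2 * L]. *)
Definition index_nat (M : nat) (x : R) : nat :=
  minn (Num.truncn (fold x / mesh M)) (2 ^ M).-1.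

Lemma index_nat_lt M x : (index_nat M x < 2 ^ M)%N.
Proof.
apply: (leq_ltn_trans (geq_minr _ _)).
by rewrite prednK ?expn_gt0.
Qed.

Lemma mesh_expE M : (2 ^ M)%:R * mesh M = 2 * L.
Proof. by rewrite /mesh natrX mulrC divfK// expf_neq0. Qed.

Lemma index_nat_itv M x :
  (index_nat M x)%:R * mesh M <= fold x <= (index_nat M x).+1%:R * mesh M.
Proof.
have h0 := mesh_gt0 M; rewrite -(ler_pdivlMr _ _ h0) -(ler_pdivrMr _ _ h0).
have /truncn_itv/andP[t1 t2] : 0 <= fold x / mesh M by rewrite divr_ge0 ?fold_ge0 ?ltW.
rewrite /index_nat; case: leqP => k.
  by rewrite t1 ltW.
rewrite prednK ?expn_gt0// ler_pdivrMr// mesh_expE fold_le andbT.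
by apply: le_trans t1; rewrite ler_nat ltnW.
Qed.

Lemma index_nat_id M x j : (j < 2 ^ M)%N -> - L <= x < L ->
  index_nat M x = j <-> j%:R * mesh M <= x + L < j.+1%:R * mesh M.
Proof.
move=> jM xL; have h0 := mesh_gt0 M.
have z0 : 0 <= fold x / mesh M by rewrite divr_ge0 ?fold_ge0 ?ltW.
have k : (Num.truncn (fold x / mesh M) < 2 ^ M)%N.
  by rewrite truncn_lt_nat// ltr_pdivrMr// mesh_expE fold_id//; lra.
have -> : index_nat M x = Num.truncn (fold x / mesh M).
  by rewrite /index_nat; apply/minn_idPl; lia.
rewrite -fold_id// -(ler_pdivlMr _ _ h0) -(ltr_pdivrMr _ _ h0).
by split=> [/eqP|h]; [rewrite truncn_eq|apply/eqP; rewrite truncn_eq].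
Qed.

Lemma truncn_divn (a : R) d : 0 <= a -> (0 < d)%N ->
  (Num.truncn a %/ d)%N = Num.truncn (a / d%:R).
Proof.
move=> a0 d0; apply/esym/eqP; rewrite truncn_eq ?divr_ge0//.
have dR : 0 < d%:R :> R by rewrite ltr0n.
rewrite (ler_pdivlMr _ _ dR) (ltr_pdivrMr _ _ dR) -!natrM -truncn_ge_nat// -truncn_lt_nat//.
by rewrite leq_divM/= ltn_ceil.
Qed.

(** The grids are nested, also outside the cube: truncation commutes with division by [2 ^ l], and
    so does the cap, because [(2 ^ M).-1 %/ 2 ^ l = (2 ^ (M - l)).-1]. *)
Lemma index_nat_div M l x : (l <= M)%N ->
  (index_nat M x %/ 2 ^ l)%N = index_nat (M - l) x.
Proof.
move=> lM; have h0 := mesh_gt0 M.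
have z0 : 0 <= fold x / mesh M by rewrite divr_ge0 ?fold_ge0 ?ltW.
have zE : fold x / (2 ^+ l * mesh M) = fold x / mesh M / (2 ^ l)%:R.
  by rewrite natrX; field; rewrite expf_neq0// lt0r_neq0.
rewrite /index_nat meshS// zE -truncn_divn ?expn_gt0//.
have E : ((2 ^ M).-1 %/ 2 ^ l)%N = (2 ^ (M - l)).-1.
  have p0 : (0 < 2 ^ l)%N by rewrite expn_gt0.
  have q0 : (0 < 2 ^ (M - l))%N by rewrite expn_gt0.
  have -> : (2 ^ M).-1 = ((2 ^ (M - l)).-1 * 2 ^ l + (2 ^ l).-1)%N.
    rewrite -{1}(subnKC lM) expnD; nia.
  by rewrite divnMDl// divn_small ?addn0// prednK.
rewrite -E; have := leq_div2r (2 ^ l); set a := Num.truncn _; set b := (2 ^ M).-1.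
move=> mono; case: (leqP a b) => ab.
  by rewrite (minn_idPl (mono _ _ ab)).
by rewrite (minn_idPr (mono _ _ (ltnW ab))).
Qed.

Lemma measurable_fold : measurable_fun setT fold.
Proof.
apply: continuous_measurable_fun => x; apply/cvgrPdist_le => e e0.
near=> y; apply: (le_trans (fold_lip _ _)); near: y.
by have /cvgrPdist_le := @cvg_id _ (nbhs x); apply.
Unshelve. all: end_near. Qed.

Lemma measurable_index_nat M j : measurable [set x : R | index_nat M x = j].
Proof.
have mF A : measurable A -> measurable (fold @^-1` A).
  by move=> mA; rewrite -[X in measurable X]setTI; exact: measurable_fold.
have h0 := mesh_gt0 M.
have z0 x : 0 <= fold x / mesh M by rewrite divr_ge0 ?fold_ge0 ?ltW.
have leE x k : (k <= Num.truncn (fold x / mesh M))%N = (k%:R * mesh M <= fold x).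
  by rewrite truncn_ge_nat// ler_pdivlMr.
have [jM|jM|jM] := ltngtP j (2 ^ M).-1.
- rewrite (_ : [set _ | _] = fold @^-1` `[j%:R * mesh M, j.+1%:R * mesh M[).
    by apply: mF; exact: measurable_itv.
  apply/seteqP; split => x /=; rewrite in_itv/= -leE ltNge -leE /index_nat; lia.
- rewrite (_ : [set _ | _] = set0)//; apply/seteqP; split => x //=.
  rewrite /index_nat; lia.
- rewrite (_ : [set _ | _] = fold @^-1` `[j%:R * mesh M, +oo[).
    by apply: mF; exact: measurable_itv.
  apply/seteqP; split => x /=; rewrite in_itv/= andbT -leE /index_nat; lia.
Qed.

(** A period of length [4 * L] shows the cell twice, once for each orientation, and an interval of
    length [2 * r] meets at most [Num.truncn (2 * r / (4 * L)) + 2] periods. The ratio [r / L] has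
    to be kept, as a ball may be far larger than the cube. *)
Lemma index_nat_measure M j (c r : R) : 0 <= r ->
  (lebesgue_measure ([set x : R | index_nat M x = j] `&` `[(c - r)%R, (c + r)%R]%classic)
    <= (mesh M * (r / L + 4))%:E)%E.
Proof.
move=> r0; have h0 := mesh_gt0 M.
have L40 : 0 < 4 * L by rewrite mulr_gt0.
pose N : nat := (Num.truncn (2 * r / (4 * L))).+2.
pose q (i : nat) : R := (period_index (c - r))%:~R + i%:R.
(* The direct and the reflected copy of the cell in the [i]-th period, counted from that of [c - r].
   Closed ends make the cap in [index_nat] harmless. *)
pose I1 i : set R := `[(- L + 4 * L * q i + j%:R * mesh M)%R,
               (- L + 4 * L * q i + j.+1%:R * mesh M)%R]%classic.
pose I2 i : set R := `[(- L + 4 * L * q i - j.+1%:R * mesh M)%R,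
               (- L + 4 * L * q i - j%:R * mesh M)%R]%classic.
have cover (x : R) : index_nat M x = j -> c - r <= x -> x <= c + r ->
    exists2 i, (i < N)%N & (I1 i `|` I2 i) x.
  move=> xj x1 x2.
  have p1 : period_index (c - r) <= period_index x.
    by apply: le_floor; rewrite lerD2r ler_pM2r ?lerD2r// invr_gt0.
  pose i := `|period_index x - period_index (c - r)|%N.
  have iE : (period_index x)%:~R = q i :> R.
    rewrite /q /i pmulrn gez0_abs ?subr_ge0//.
    by rewrite intrB addrC subrK.
  have iN : (i < N)%N.
    have /andP[a1 a2] := period_index_itv x.
    have /andP[a3 a4] := period_index_itv (c - r).
    rewrite iE /q in a1.
    have : i%:R < 2 * r / (4 * L) + 1 :> R.
      by rewrite -ltrBlDr ltr_pdivlMr//; nra.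
    move=> iL; rewrite -(@ltr_nat R); apply: (lt_trans iL).
    by rewrite /N -[X in _ < X]natr1 ltrD2r; exact: truncnS_gt.
  exists i => //.
  have := index_nat_itv M x; rewrite xj /fold iE.
  case: (ler0P (x + L - 4 * L * q i)) => _ /andP[b1 b2]; [right|left];
    rewrite /I1 /I2 /= in_itv/=; apply/andP; split; lra.
have mI i : measurable (I1 i `|` I2 i) by apply: measurableU; exact: measurable_itv.
have mJ : measurable (\big[setU/set0]_(i < N) (I1 i `|` I2 i)).
  by apply: bigsetU_measurable => i _; exact: mI.
apply: (@le_trans _ _ (lebesgue_measure (\big[setU/set0]_(i < N) (I1 i `|` I2 i)))).
  apply: le_measure; rewrite ?inE//.
    by apply: measurableI; [exact: measurable_index_nat|exact: measurable_itv].
  move=> x [/= xj]; rewrite in_itv/= => /andP[x1 x2].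
  by have [i iN ix] := cover x xj x1 x2; rewrite -(bigcup_mkord N (fun i => I1 i `|` I2 i)); exists i.
apply: (le_trans (Boole_inequality lebesgue_measure (fun i _ => mI i))).
apply: (@le_trans _ _ (\sum_(i < N) (2 * mesh M)%:E)%E).
  apply: lee_sum => i _; apply: (le_trans (measureU2 _ _ _)); try exact: measurable_itv.
  have jj : j.+1%:R * mesh M = j%:R * mesh M + mesh M by rewrite -[in LHS]natr1 mulrDl mul1r.
  rewrite [X in (X + _)%E]itv_measure ?[X in (_ + X)%E]itv_measure -?EFinD ?lee_fin jj; lra.
rewrite sumEFin lee_fin sumr_const card_ord -[leLHS]mulr_natl /N.
have t0 : 0 <= 2 * r / (4 * L) by rewrite divr_ge0 ?mulr_ge0// ltW.
have /andP[t1 _] := truncn_itv t0.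
have NE t : t.+2%:R = t%:R + 2 :> R by rewrite -addn2 natrD.
rewrite (NE (Num.truncn _)) mulrA [leRHS]mulrC ler_pM2r//.
have -> : r / L = 2 * (2 * r / (4 * L)) by field; exact: lt0r_neq0.
lra.
Qed.

End fold.

(** * Boxes and Euclidean balls *)

Section rV_measure.
Context {R : realType} {n : nat}.
Local Notation V := 'rV[R]_n.
Local Notation mu := (@lebesgue_rV R n).

Lemma measurable_coord (i : 'I_n) : measurable_fun setT (fun x : V => x ord0 i).
Proof.
apply: (measurability _ (RGenOpens.measurableE R)) => _ [_ [a [b ->]] <-].
rewrite setTI; apply: sub_sigma_algebra => /=.
by apply: open_comp (interval_open _ _) => // x _; exact: coord_continuous.
Qed.

Lemma measurable_prod_set (A : 'I_n -> set R) : (forall i, measurable (A i)) ->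
  measurable [set x : V | forall i, A i (x ord0 i)].
Proof.
move=> mA; rewrite (_ : [set _ | _] = \bigcap_(i in setT)
  ((fun x : V => x ord0 i) @^-1` A i)).
  apply: fin_bigcap_measurable => // i _.
  by rewrite -[X in measurable X]setTI; exact: measurable_coord.
by apply/seteqP; split=> [t At i _|t At i]; [exact: At|exact: (At i I)].
Qed.

Definition box (c : V) (s : R) : set V :=
  [set x | forall i, `|x ord0 i - c ord0 i| <= s].

Lemma box_prodE c s :
  box c s = [set x | forall i, `[c ord0 i - s, c ord0 i + s]%classic (x ord0 i)].
Proof.
by apply/seteqP; split=> x xB i; have := xB i; rewrite /= in_itv/= ler_distl.
Qed.

Lemma measurable_box c s : measurable (box c s).
Proof.
rewrite box_prodE.
by apply: (@measurable_prod_set (fun i => `[c ord0 i - s, c ord0 i + s]%classic)) => i; exact: measurable_itv.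
Qed.

Lemma measure_prod_set_le (A : 'I_n -> set R) b :
  (forall i, measurable (A i)) -> (forall i, lebesgue_measure (A i) <= b%:E)%E ->
  (mu [set x : V | forall i, A i (x ord0 i)] <= (b ^+ n)%:E)%E.
Proof.
move=> mA Ab; rewrite lebesgue_rV_box//.
apply: (@le_trans _ _ (\prod_(i < n) b%:E)%E).
  have : (0 <= \prod_(i < n) lebesgue_measure (A i) <= \prod_(i < n) b%:E)%E.
    elim/big_rec2: _ => [|i x y _ /andP[y0 yx]]; first by rewrite lexx lee01.
    by rewrite mule_ge0 ?measure_ge0//= lee_pmul ?measure_ge0.
  by case/andP.
by rewrite prodEFin prodr_const card_ord.
Qed.

Lemma measure_box c s : 0 <= s -> mu (box c s) = ((2 * s) ^+ n)%:E.
Proof.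
move=> s0; rewrite box_prodE.
rewrite (@lebesgue_rV_box _ _ (fun i => `[c ord0 i - s, c ord0 i + s]%classic)); last first.
  by move=> i; exact: measurable_itv.
rewrite (eq_bigr (fun=> (2 * s)%:E)); last first.
  by move=> i _; rewrite itv_measure; [congr (_%:E); ring|lra].
by rewrite prodEFin prodr_const card_ord.
Qed.

Lemma eball_sub_box c r : 0 <= r -> eball c r `<=` box c r.
Proof.
move=> r0 x; rewrite /eball /= => xr i.
rewrite -sqrtr_sqr; apply: le_trans xr; rewrite ler_wsqrtr//.
by rewrite (bigD1 i)//= lerDl sumr_ge0// => j _; exact: sqr_ge0.
Qed.

(** The sharp radius is [sqrt n * s]; the larger [n%:R * s] avoids the root and only costs a
    dimensional constant. *)
Lemma box_sub_eball c s : 0 <= s -> box c s `<=` eball c (n%:R * s).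
Proof.
move=> s0 x xs; rewrite /eball /=.
rewrite -(@ger0_norm _ (n%:R * s)) ?mulr_ge0// -sqrtr_sqr ler_wsqrtr//.
apply: (@le_trans _ _ (\sum_(i < n) s ^+ 2)).
  apply: ler_sum => i _; rewrite -[X in X <= _]real_normK ?num_real//.
  by rewrite lerXn2r// nnegrE.
rewrite sumr_const card_ord -[leLHS]mulr_natl exprMn ler_wpM2r ?sqr_ge0//.
rewrite -natrX ler_nat; case: (n) => // k; nia.
Qed.

Lemma box_sub_eball_div c r : 0 <= r -> box c (r / n%:R) `<=` eball c r.
Proof.
move=> r0 x xr.
have [n0|n0] := posnP n.
  rewrite /eball /= big1 ?sqrtr0// => i _.
  by have := ltn_ord i; rewrite [X in (_ < X)%N]n0.
have -> : r = n%:R * (r / n%:R) by rewrite mulrC divfK// pnatr_eq0 -lt0n.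
by apply: box_sub_eball xr; rewrite divr_ge0.
Qed.

Lemma measurable_eball c r : measurable (eball c r : set V).
Proof.
have mf : measurable_fun setT (fun x : V => Num.sqrt (\sum_i (x ord0 i - c ord0 i) ^+ 2)).
  apply: measurableT_comp; first by apply: continuous_measurable_fun; exact: sqrt_continuous.
  apply: measurable_sum => i; apply: measurable_funX.
  by apply: measurable_funB => //; exact: measurable_coord.
rewrite (_ : eball c r = (fun x : V => Num.sqrt (\sum_i (x ord0 i - c ord0 i) ^+ 2)) @^-1` `]-oo, r]).
  by rewrite -[X in measurable X]setTI; apply: mf.
by apply/seteqP; split => x /=; rewrite in_itv.
Qed.

Definition vol (c : V) (r : R) : R := fine (mu (eball c r)).

Lemma mu_eball_le c r : 0 <= r -> (mu (eball c r) <= ((2 * r) ^+ n)%:E)%E.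
Proof.
move=> r0; rewrite -(measure_box c r0); apply: le_measure; rewrite ?inE.
- exact: measurable_eball.
- exact: measurable_box.
- exact: eball_sub_box.
Qed.

Lemma mu_eball c r : 0 <= r -> mu (eball c r) = (vol c r)%:E.
Proof.
move=> r0; rewrite /vol fineK// ge0_fin_numE//.
by apply: le_lt_trans (mu_eball_le c r0) _; rewrite ltry.
Qed.

Lemma vol_le c r : 0 <= r -> vol c r <= (2 * r) ^+ n.
Proof. by move=> r0; rewrite -lee_fin -mu_eball//; exact: mu_eball_le. Qed.

Lemma vol_ge c r : 0 <= r -> (2 * (r / n%:R)) ^+ n <= vol c r.
Proof.
move=> r0; rewrite -lee_fin -mu_eball// -(measure_box c) ?divr_ge0//.
apply: le_measure; rewrite ?inE.
- exact: measurable_box.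
- exact: measurable_eball.
- exact: box_sub_eball_div.
Qed.

Lemma vol_gt0 c r : 0 < r -> 0 < vol c r.
Proof.
move=> r0; apply: lt_le_trans (vol_ge c (ltW r0)).
have [->|n0] := posnP n; first by rewrite expr0.
by rewrite exprn_gt0// mulr_gt0// divr_gt0// ltr0n.
Qed.

End rV_measure.

(** * Atoms *)

Section normc_theory.
Context {R : realType}.
Local Notation normc := (@ComplexField.Normc.normc R).
Local Notation Re := (@complex.Re R).
Local Notation Im := (@complex.Im R).

Lemma normc_ge0 (z : R[i]) : 0 <= normc z.
Proof. by case: z => a b; exact: sqrtr_ge0. Qed.

Lemma normcD (y z : R[i]) : normc (y + z) <= normc y + normc z.
Proof. exact: le_normcD. Qed.

Lemma normcM (y z : R[i]) : normc (y * z) = normc y * normc z.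
Proof. exact: ComplexField.Normc.normcM. Qed.

Lemma normc0 : normc 0 = 0.
Proof. exact: ComplexField.Normc.normc0. Qed.

Lemma normc_gt0 (z : R[i]) : z != 0 -> 0 < normc z.
Proof.
move=> z0; rewrite lt_neqAle normc_ge0 andbT eq_sym; apply: contra_neq z0.
exact: ComplexField.Normc.eq0_normc.
Qed.

Lemma normcB (z : R[i]) : normc (- z) = normc z.
Proof. exact: normcN. Qed.

Lemma normc_real (a : R) : normc (a%:C%C) = `|a|.
Proof. by rewrite /= expr0n/= addr0 sqrtr_sqr. Qed.

Lemma normc_i : normc 'i%C = 1.
Proof. by rewrite /= expr0n/= add0r expr1n sqrtr1. Qed.

Lemma normr_Re_le (z : R[i]) : `|Re z| <= normc z.
Proof. by case: z => a b /=; rewrite -sqrtr_sqr ler_wsqrtr// lerDl sqr_ge0. Qed.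

Lemma normr_Im_le (z : R[i]) : `|Im z| <= normc z.
Proof. by case: z => a b /=; rewrite -sqrtr_sqr ler_wsqrtr// lerDr sqr_ge0. Qed.

Lemma ReM (y z : R[i]) : Re (y * z) = Re y * Re z - Im y * Im z.
Proof. by case: y; case: z. Qed.

Lemma ImM (y z : R[i]) : Im (y * z) = Re y * Im z + Im y * Re z.
Proof. by case: y; case: z. Qed.

Lemma Re_sum (I : Type) (l : seq I) (F : I -> R[i]) :
  Re (\sum_(i <- l) F i) = \sum_(i <- l) Re (F i).
Proof. by elim/big_rec2 : _ => // i x y _ <-; rewrite raddfD. Qed.

(* The phase of z, with the junk value 0 at z = 0. *)
Lemma normc_phase (z : R[i]) : exists2 w, normc w <= 1 & z = (normc z)%:C%C * w.
Proof.
have [->|z0] := eqVneq z 0; first by exists 0; rewrite ?normc0 ?ler01// mulr0.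
have nz0 : normc z != 0 by apply: contra_neq z0; exact: ComplexField.Normc.eq0_normc.
exists ((normc z)^-1%:C%C * z).
  by rewrite normcM normc_real ger0_norm ?invr_ge0 ?normc_ge0// mulVf.
by rewrite mulrA -rmorphM/= divff// mul1r.
Qed.

End normc_theory.

Section powers.
Context {R : realType}.

(* A weak form of Young's inequality. *)
Lemma le_add_powR (p t x : R) : 1 < p -> 0 < t -> 0 <= x -> x <= t + t `^ (1 - p) * x `^ p.
Proof.
move=> p1 t0 x0; have [xt|tx] := leP x t.
  by rewrite (le_trans xt)// lerDl mulr_ge0// powR_ge0.
rewrite ler_wpDl ?(ltW t0)//.
have x0' : 0 < x := lt_trans t0 tx.
rewrite -(mulr_powRB1 x0); last lra.
rewrite mulrCA ler_pMr// -(opprB p) powRN mulrC ler_pdivlMr ?powR_gt0// mul1r.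
by apply: ge0_ler_powR; rewrite ?nnegrE ?(ltW t0) ?(ltW tx)//; lra.
Qed.

Lemma powRD_le (p x y : R) : 0 < p -> 0 <= x -> 0 <= y ->
  (x + y) `^ p <= 2 `^ p * (x `^ p + y `^ p).
Proof.
move=> p0; wlog xy : x y / x <= y => [H x0 y0|x0 y0].
  have [xy|yx] := leP x y; first exact: H.
  by rewrite addrC [X in _ * X]addrC; apply: H => //; exact: ltW.
apply: (@le_trans _ _ ((2 * y) `^ p)).
  by apply: ge0_ler_powR; rewrite ?nnegrE ?addr_ge0 ?mulr_ge0//; lra.
by rewrite powRM// ler_wpM2l ?powR_ge0// lerDr powR_ge0.
Qed.

Lemma le_powR_inv (p x y : R) : 0 < p -> 0 <= x -> 0 <= y ->
  (x `^ p^-1 <= y) = (x <= y `^ p).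
Proof.
move=> p0 x0 y0; apply/idP/idP => h.
- have -> : x = (x `^ p^-1) `^ p by rewrite -powRrM mulVf ?powRr1// lt0r_neq0.
  by apply: ge0_ler_powR; rewrite ?nnegrE ?powR_ge0// ltW.
- have -> : y = (y `^ p) `^ p^-1 by rewrite -powRrM mulfV ?powRr1// lt0r_neq0.
  by apply: ge0_ler_powR; rewrite ?nnegrE ?powR_ge0// invr_ge0 ltW.
Qed.

End powers.

Section atoms.
Context {R : realType} {n : nat}.
Local Notation V := 'rV[R]_n.
Local Notation C := R[i].
Local Notation mu := (@lebesgue_rV R n).
Local Notation normc := (@ComplexField.Normc.normc R).
Local Notation Re := (@complex.Re R).
Local Notation Im := (@complex.Im R).

Lemma measurable_normc (a : V -> C) : cmeasurable a ->
  measurable_fun setT (fun x => normc (a x)).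
Proof.
move=> [mRe mIm].
rewrite (_ : (fun _ => _) = (fun x => Num.sqrt ((Re (a x)) ^+ 2 + (Im (a x)) ^+ 2))); last first.
  by apply/funext => x; case: (a x).
apply: measurableT_comp; first by apply: continuous_measurable_fun; exact: sqrt_continuous.
by apply: measurable_funD; apply: measurable_funX.
Qed.

Lemma cmeasurableD (f g : V -> C) : cmeasurable f -> cmeasurable g ->
  cmeasurable (fun x => f x + g x).
Proof.
move=> [f1 f2] [g1 g2]; split.
  rewrite (_ : _ \o _ = (fun x => Re (f x) + Re (g x))); last by apply/funext => x; rewrite /= raddfD.
  exact: measurable_funD.
rewrite (_ : _ \o _ = (fun x => Im (f x) + Im (g x))); last by apply/funext => x; rewrite /= raddfD.
exact: measurable_funD.
Qed.

Lemma cmeasurableZ (k : C) (f : V -> C) : cmeasurable f -> cmeasurable (fun x => k * f x).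
Proof.
move=> [f1 f2]; split.
  rewrite (_ : _ \o _ = (fun x => Re k * Re (f x) - Im k * Im (f x))); last first.
    by apply/funext => x; rewrite /= ReM.
  by apply: measurable_funB; apply: measurable_funM.
rewrite (_ : _ \o _ = (fun x => Re k * Im (f x) + Im k * Re (f x))); last first.
  by apply/funext => x; rewrite /= ImM.
by apply: measurable_funD; apply: measurable_funM.
Qed.

Lemma cmeasurable_real (f : V -> R) : measurable_fun setT f -> cmeasurable (fun x => (f x)%:C%C).
Proof. by move=> mf; split; [exact: mf|exact: measurable_cst]. Qed.

Lemma cmeasurable0 : cmeasurable (fun _ : V => 0 : C).
Proof. by split; exact: measurable_cst. Qed.

Lemma cmeasurable_sum (I : Type) (l : seq I) (F : I -> V -> C) :
  (forall i, cmeasurable (F i)) -> cmeasurable (fun x => \sum_(i <- l) F i x).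
Proof.
move=> mF; elim: l => [|i l ih].
  by under eq_fun do rewrite big_nil; exact: cmeasurable0.
by under eq_fun do rewrite big_cons; exact: cmeasurableD.
Qed.

(** The norm ['N[mu]_+oo] is an essential supremum only on a space of positive measure. *)
Lemma muT_gt0 : (0 < mu setT)%E.
Proof.
apply: (@lt_le_trans _ _ (mu (eball 0 1))); last first.
  by apply: le_measure; rewrite ?inE//; exact: measurable_eball.
by rewrite mu_eball// lte_fin vol_gt0.
Qed.

(** Raised to the power [q] and multiplied by |B|, the size condition becomes a bound of the
    integral of |a|^q by |B|^(1 - q). In this form the integral runs over the whole space, no
    extended power is left, and membership in L^q is included. *)
Lemma is_atom_finP (q : R) (a : V -> C) : 1 < q ->
  is_atom q%:E a <->
  [/\ cmeasurable a, cintegral a = 0 & exists c (r : R), [/\ 0 < r,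
    {ae mu, forall x, ~ eball c r x -> a x = 0} &
    (\int[mu]_x (normc (a x) `^ q)%:E <= (vol c r `^ (1 - q))%:E)%E]].
Proof.
move=> q1; have q0 : 0 < q by lra.
have intE (c : V) (r : R) : cmeasurable a -> {ae mu, forall x, ~ eball c r x -> a x = 0} ->
    (\int[mu]_(x in eball c r) (normc (a x) `^ q)%:E = \int[mu]_x (normc (a x) `^ q)%:E)%E.
  move=> ma a0; rewrite integral_mkcond; apply: ge0_ae_eq_integral => //.
  - apply/(measurable_restrictT _ _).1 => //; first exact: measurable_eball.
    apply: measurable_funTS; apply/measurable_EFinP.
    apply: (measurableT_comp (measurable_powR q)); exact: measurable_normc.
  - apply/measurable_EFinP.
    apply: (measurableT_comp (measurable_powR q)); exact: measurable_normc.
  - by move=> x _; rewrite /patch; case: ifP => // _; rewrite lee_fin powR_ge0.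
  - by move=> x _; rewrite lee_fin powR_ge0.
  - move: a0; apply: filterS => x xB _; rewrite /patch; case: ifPn => // /negP.
    by rewrite inE => /xB ->; rewrite normc0 powR0// lt0r_neq0.
have sizeE (c : V) (r j : R) : 0 < r -> 0 <= j ->
    (((mu (eball c r : set V))^-1 * j%:E) `^ q^-1 <= (mu (eball c r))^-1)%E =
    (j <= vol c r `^ (1 - q)).
  move=> r0 j0; have v0 := vol_gt0 c r0.
  rewrite (mu_eball _ (ltW r0)) inver gt_eqF// -EFinM poweR_EFin lee_fin.
  rewrite le_powR_inv ?mulr_ge0 ?invr_ge0 ?(ltW v0)//.
  rewrite ler_pdivrMl// -(powR_inv1 (ltW v0)) -powRrM mulN1r powRD ?(lt0r_neq0 v0) ?implybT//.
  by rewrite (powRr1 (ltW v0)).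
split.
  move=> [[ma La] [ia [c [r [r0 a0 sa]]]]]; split=> //.
  exists c, r; split=> //; rewrite -(intE c r)//; move: sa; rewrite /atom_size.
  have : (0 <= \int[mu]_(x in eball c r) (normc (a x) `^ q)%:E)%E.
    by apply: integral_ge0 => x _; rewrite lee_fin powR_ge0.
  case: (\int[mu]_(x in _) _)%E => [j|_|//].
    by rewrite lee_fin => j0; rewrite sizeE.
  (* An infinite integral would make the left-hand side of the size condition infinite. *)
  have v0 := vol_gt0 c r0.
  by rewrite (mu_eball _ (ltW r0)) inver gt_eqF// gt0_muley ?lte_fin ?invr_gt0// poweRyr// invr_neq0// lt0r_neq0.
move=> [ma ia [c [r [r0 a0 sa]]]].
have J0 : (0 <= \int[mu]_x (normc (a x) `^ q)%:E)%E.
  by apply: integral_ge0 => x _; rewrite lee_fin powR_ge0.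
split.
  split=> //; rewrite unlock poweR_lty//.
  under eq_integral do rewrite /= ger0_norm ?normc_ge0//.
  by apply: le_lt_trans sa _; rewrite ltry.
split=> //; exists c, r; split=> //; rewrite /atom_size (intE c r)//.
move: J0 sa; case: (\int[mu]_x _)%E => [j|_|//].
  by rewrite !lee_fin => j0; rewrite sizeE.
by rewrite leye_eq.
Qed.

Lemma is_atom_ooP (a : V -> C) :
  is_atom +oo a <->
  [/\ cmeasurable a, cintegral a = 0 & exists c (r : R), [/\ 0 < r,
    {ae mu, forall x, ~ eball c r x -> a x = 0} &
    {ae mu, forall x, normc (a x) <= (vol c r)^-1}]].
Proof.
have LE : ('N[mu]_+oo[EFin \o (normc \o a)] = ess_sup mu (fun x => (normc (a x))%:E))%E.
  rewrite unlock muT_gt0; congr ess_sup; apply/funext => x /=.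
  by rewrite ger0_norm// normc_ge0.
have vE c (r : R) : 0 < r -> ((mu (eball c r : set V))^-1 = ((vol c r)^-1)%:E)%E.
  by move=> r0; rewrite (mu_eball _ (ltW r0)) inver gt_eqF// vol_gt0.
split.
  move=> [[ma La] [ia [c [r [r0 a0]]]]]; rewrite /atom_size LE vE// => /ess_supP sa.
  by split=> //; exists c, r.
move=> [ma ia [c [r [r0 a0 sa]]]]; have Le : ('N[mu]_+oo[EFin \o (normc \o a)] <= ((vol c r)^-1)%:E)%E.
  by rewrite LE; apply/ess_supP.
split; first by split => //; apply: le_lt_trans Le _; rewrite ltry.
by split=> //; exists c, r; split=> //; rewrite /atom_size vE.
Qed.

End atoms.

(** * Real-valued atoms and the integrated Young inequality *)

Section real_atoms.
Context {R : realType} {n : nat}.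
Local Notation V := 'rV[R]_n.
Local Notation C := R[i].
Local Notation mu := (@lebesgue_rV R n).
Local Notation normc := (@ComplexField.Normc.normc R).
Local Notation Re := (@complex.Re R).
Local Notation Im := (@complex.Im R).

Lemma measurable_normp (D : set V) (f : V -> R) p : measurable_fun setT f ->
  measurable_fun D (fun x => (`|f x| `^ p)%:E).
Proof.
move=> mf; apply: measurable_funTS; apply/measurable_EFinP.
apply: (measurableT_comp (measurable_powR p)).
by apply: measurableT_comp.
Qed.

Lemma measurable_norm (D : set V) (f : V -> R) : measurable_fun setT f ->
  measurable_fun D (fun x => `|f x|%:E).
Proof.
move=> mf; apply: measurable_funTS; apply/measurable_EFinP.
by apply: measurableT_comp.
Qed.

(** [le_add_powR] integrated, the constant term being charged only on [E], off which [f] vanishes.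
    The threshold stays free: it is 1 for integrability, 1 / |B| for an atom, and later a fixed
    fraction of the average to be estimated. *)
Lemma int_norm_young (D E : set V) (f : V -> R) (p t : R) :
  measurable D -> measurable E -> measurable_fun setT f -> 1 < p -> 0 < t ->
  {ae mu, forall x, ~ E x -> f x = 0} ->
  (\int[mu]_(x in D) `|f x|%:E <=
   t%:E * mu (E `&` D) + (t `^ (1 - p))%:E * \int[mu]_(x in D) (`|f x| `^ p)%:E)%E.
Proof.
move=> mD mE mf p1 t0 f0.
have mI : measurable_fun D (fun x => (t * \1_E x)%:E).
  by apply/measurable_EFinP; apply: measurable_funM.
have mP := @measurable_normp D f p mf.
have -> : (t%:E * mu (E `&` D) = \int[mu]_(x in D) (t * \1_E x)%:E)%E.
  under eq_integral do rewrite EFinM.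
  rewrite ge0_integralZl//; last 2 first.
  - by apply/measurable_EFinP; exact: measurable_indic.
  - by rewrite lee_fin ltW.
  by rewrite integral_indic// setIC.
rewrite -ge0_integralZl//; last by rewrite lee_fin powR_ge0.
rewrite -ge0_integralD//; last 3 first.
- by move=> x _; rewrite lee_fin mulr_ge0// ltW.
- by move=> x _; rewrite -EFinM lee_fin mulr_ge0// powR_ge0.
- by apply: emeasurable_funM => //; exact: measurable_cst.
apply: ae_ge0_le_integral => //.
- exact: measurable_norm.
- by move=> x _; rewrite -EFinM -EFinD lee_fin addr_ge0// mulr_ge0// ?powR_ge0// ltW.
- by apply: emeasurable_funD => //; apply: emeasurable_funM => //; exact: measurable_cst.
- move: f0; apply: filterS => x fx _; rewrite -EFinM -EFinD lee_fin indicE.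
  case: (asboolP (E x)) => Ex.
    by rewrite mem_set// mulr1; exact: le_add_powR.
  by rewrite fx// normr0 addr_ge0// mulr_ge0// ?powR_ge0// ltW.
Qed.

Lemma integrable_normP (f : V -> R) : measurable_fun setT f ->
  (\int[mu]_x `|f x|%:E < +oo)%E <-> mu.-integrable setT (EFin \o f).
Proof.
move=> mf; split=> [foo|/integrableP[]//].
by apply/integrableP; split; [exact/measurable_EFinP|exact: foo].
Qed.

Lemma int_normp_ge0 (D : set V) (f : V -> R) p :
  (0 <= \int[mu]_(x in D) (`|f x| `^ p)%:E)%E.
Proof. by apply: integral_ge0 => x _; rewrite lee_fin powR_ge0. Qed.

Lemma integrable_pow (E : set V) (f : V -> R) (p : R) :
  measurable E -> (mu E < +oo)%E -> measurable_fun setT f -> 1 < p ->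
  {ae mu, forall x, ~ E x -> f x = 0} ->
  (\int[mu]_x (`|f x| `^ p)%:E < +oo)%E -> mu.-integrable setT (EFin \o f).
Proof.
move=> mE Eoo mf p1 f0 foo; apply/integrable_normP => //.
apply: (le_lt_trans (int_norm_young measurableT mE mf p1 ltr01 f0)).
by rewrite setIT mul1e powR1 mul1e lte_add_pinfty.
Qed.

Definition ratom (p : R) (a : V -> R) : Prop :=
  [/\ measurable_fun setT a, \int[mu]_x a x = 0 & exists c (r : R), [/\ 0 < r,
    {ae mu, forall x, ~ eball c r x -> a x = 0} &
    (\int[mu]_x (`|a x| `^ p)%:E <= (vol c r `^ (1 - p))%:E)%E]].

(** At the threshold 1 / |B| both terms of Young's inequality are at most 1. Holder's inequality
    would give 1 in place of 2. *)
Lemma int_atom_le2 (p : R) (a : V -> R) c (r : R) : measurable_fun setT a -> 1 < p -> 0 < r ->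
  {ae mu, forall x, ~ eball c r x -> a x = 0} ->
  (\int[mu]_x (`|a x| `^ p)%:E <= (vol c r `^ (1 - p))%:E)%E ->
  (\int[mu]_x `|a x|%:E <= 2%:E)%E.
Proof.
move=> ma p1 r0 a0 ap; have v0 := vol_gt0 c r0.
have vi0 : 0 < (vol c r)^-1 by rewrite invr_gt0.
apply: (le_trans (int_norm_young measurableT (measurable_eball c r) ma p1 vi0 a0)).
rewrite setIT (mu_eball _ (ltW r0)) -EFinM mulVf ?gt_eqF//.
have -> : 2%:E = (1%:E + ((vol c r)^-1 `^ (1 - p))%:E * (vol c r `^ (1 - p))%:E)%E :> \bar R.
  by rewrite -EFinM -powRM ?invr_ge0 ?(ltW v0)// mulVf ?gt_eqF// powR1 -EFinD.
by rewrite leeD2l// lee_wpmul2l// lee_fin powR_ge0.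
Qed.

Lemma ratom_le2 (p : R) a : 1 < p -> ratom p a -> (\int[mu]_x `|a x|%:E <= 2%:E)%E.
Proof. by move=> p1 [ma _ [c [r [r0 a0 ap]]]]; exact: int_atom_le2 ap. Qed.

Lemma ratom_integrable (p : R) a : 1 < p -> ratom p a -> mu.-integrable setT (EFin \o a).
Proof.
move=> p1 ra; apply/integrable_normP; first by case: ra.
by rewrite (le_lt_trans (ratom_le2 p1 ra))// ltry.
Qed.

Lemma cintegral_real (f : V -> R) : cintegral (fun x => (f x)%:C%C) = (\int[mu]_x f x)%:C%C.
Proof.
rewrite /cintegral /=; congr (_ +i* _)%C.
by rewrite -[RHS](@Rintegral_set0 _ _ _ mu (fun _ => 0)) Rintegral_mkcond; apply: eq_Rintegral => x _; rewrite /patch if_same.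
Qed.

Lemma ratom_atom (p : R) a : 1 < p -> ratom p a -> is_atom p%:E (fun x => (a x)%:C%C).
Proof.
move=> p1 [ma ia [c [r [r0 a0 ap]]]]; apply/is_atom_finP => //; split.
- exact: cmeasurable_real.
- by rewrite cintegral_real ia.
exists c, r; split; first exact: r0.
- by move: a0; apply: filterS => x ax /ax ->.
- by under eq_integral do rewrite normc_real.
Qed.

Lemma cmeasurable_integrable (a : V -> C) : cmeasurable a ->
  (\int[mu]_x (normc (a x))%:E < +oo)%E ->
  mu.-integrable setT (EFin \o (Re \o a)) /\ mu.-integrable setT (EFin \o (Im \o a)).
Proof.
move=> ma aoo; have mN : measurable_fun setT (fun x => (normc (a x))%:E).
  by apply/measurable_EFinP; exact: measurable_normc.
split; (apply/integrable_normP; [by case: ma|apply: le_lt_trans aoo]);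
  (apply: ge0_le_integral => //; last by
    move=> x _; rewrite lee_fin ?normr_Re_le ?normr_Im_le).
- by apply: measurable_norm; case: ma.
- by apply: measurable_norm; case: ma.
Qed.

Lemma integral_Re_mul (a : V -> C) (z : C) : cmeasurable a ->
  (\int[mu]_x (normc (a x))%:E < +oo)%E ->
  \int[mu]_x Re (z * a x) = Re (z * cintegral a).
Proof.
move=> ma aoo; have [iRe iIm] := cmeasurable_integrable ma aoo.
have -> : \int[mu]_x Re (z * a x) = \int[mu]_x (Re z * Re (a x) - Im z * Im (a x)).
  by apply: eq_Rintegral => x _; rewrite ReM.
have iZ (k : R) (f : V -> R) : mu.-integrable setT (EFin \o f) ->
    mu.-integrable setT (EFin \o (fun x => k * f x)).
  by move=> fi; have := integrableZl measurableT k fi.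
by rewrite RintegralB ?iZ// !RintegralZl// ReM.
Qed.

Lemma atom_int_le2 (p : R) (a : V -> C) : 1 < p -> is_atom p%:E a ->
  (\int[mu]_x (normc (a x))%:E <= 2%:E)%E.
Proof.
move=> p1 /is_atom_finP -/(_ p1) [ma _ [c [r [r0 a0 ap]]]].
have -> : (\int[mu]_x (normc (a x))%:E = \int[mu]_x `|normc (a x)|%:E)%E.
  by apply: eq_integral => x _; rewrite ger0_norm ?normc_ge0.
apply: (@int_atom_le2 p _ c r _ p1 r0).
- exact: measurable_normc.
- by move: a0; apply: filterS => x ax /ax ->; rewrite normc0.
- by under eq_integral do rewrite ger0_norm ?normc_ge0//.
Qed.

(** Neither a factor of modulus at most 1 nor the real part increases the modulus. The factor [z]
    will hold both the phase of a coefficient and the choice between real and imaginary part. *)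
Lemma atom_Re (p : R) (a : V -> C) z : 1 < p -> is_atom p%:E a -> normc z <= 1 ->
  ratom p (fun x => Re (z * a x)).
Proof.
move=> p1 aa z1; have a2 := atom_int_le2 p1 aa.
move/is_atom_finP: (aa) => -/(_ p1) [ma ia [c [r [r0 a0 ap]]]]; split.
- by case: (cmeasurableZ z ma).
- rewrite integral_Re_mul// ?ia ?mulr0//.
  by apply: le_lt_trans a2 _; rewrite ltry.
exists c, r; split; first exact: r0.
- by move: a0; apply: filterS => x ax /ax ->; rewrite mulr0.
apply: le_trans ap; apply: ge0_le_integral => //.
- by apply: measurable_normp; case: (cmeasurableZ z ma).
- apply/measurable_EFinP; apply: (measurableT_comp (measurable_powR p)); exact: measurable_normc.
- move=> x _; rewrite lee_fin; apply: ge0_ler_powR; rewrite ?nnegrE ?normc_ge0//; first lra.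
  by rewrite (le_trans (normr_Re_le _))// normcM ler_piMl ?normc_ge0.
Qed.

Lemma atom_oo_fin (p : R) (a : V -> C) : 1 < p -> is_atom +oo a -> is_atom p%:E a.
Proof.
move=> p1 /is_atom_ooP [ma ia [c [r [r0 a0 ab]]]]; apply/is_atom_finP => //; split=> //.
exists c, r; split; [exact: r0|exact: a0|]; have v0 := vol_gt0 c r0.
have mE := measurable_eball c r.
apply: (@le_trans _ _ (\int[mu]_x ((vol c r) `^ (- p) * \1_(eball c r) x)%:E)%E).
  apply: ae_ge0_le_integral => //.
  - by move=> x _; rewrite lee_fin powR_ge0.
  - apply/measurable_EFinP; apply: (measurableT_comp (measurable_powR p)); exact: measurable_normc.
  - by move=> x _; rewrite lee_fin mulr_ge0// powR_ge0.
  - apply/measurable_EFinP; apply: measurable_funM; [exact: measurable_cst|exact: measurable_indic].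
  - move: a0 ab; apply: filterS2 => x a0 ab _; rewrite lee_fin indicE.
    case: (asboolP (eball c r x)) => xB.
      rewrite mem_set// mulr1 -mulN1r powRrM (powR_inv1 (ltW v0)).
      by apply: ge0_ler_powR; rewrite ?nnegrE ?normc_ge0 ?invr_ge0 ?(ltW v0)//; lra.
    by rewrite a0// normc0 powR0 ?mulr_ge0 ?powR_ge0//; lra.
under eq_integral do rewrite EFinM.
rewrite ge0_integralZl//; last 2 first.
- by apply/measurable_EFinP; exact: measurable_indic.
- by rewrite lee_fin powR_ge0.
rewrite integral_indic// setIT [X in (_ * X)%E](mu_eball c (ltW r0)) -EFinM lee_fin.
by rewrite powRD ?(lt0r_neq0 v0) ?implybT// (powRr1 (ltW v0)) mulrC.
Qed.

(** Reduces every exponent to a real one; for [q = +oo] any [p > 1] would do. *)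
Lemma atom_exponent (q : \bar R) : (1 < q)%E ->
  exists2 p : R, 1 < p & forall a : V -> C, is_atom q a -> is_atom p%:E a.
Proof.
case: q => [q|_|//]; first by rewrite lte_fin => q1; exists q.
by exists 2; [lra|move=> a; apply: atom_oo_fin; lra].
Qed.

Lemma atom_oo_any (q : \bar R) (a : V -> C) : (1 < q)%E -> is_atom +oo a -> is_atom q a.
Proof. by case: q => [q|//|//]; rewrite lte_fin; exact: atom_oo_fin. Qed.

End real_atoms.

(** * Finite atomic decompositions *)

Section finite_decompositions.
Context {R : realType} {n : nat}.
Local Notation V := 'rV[R]_n.
Local Notation C := R[i].
Local Notation mu := (@lebesgue_rV R n).
Local Notation normc := (@ComplexField.Normc.normc R).
Local Notation Re := (@complex.Re R).
Local Notation Im := (@complex.Im R).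

(** A list with an upper bound on its cost, rather than a family over ['I_N] with its exact cost:
    sums become concatenations, and no infimum has to be attained. *)
Definition findec (q : \bar R) (f : V -> C) (s : R) : Prop :=
  exists l : seq (C * (V -> C)), [/\ forall p, List.In p l -> is_atom q p.2,
    {ae mu, forall x, f x = \sum_(p <- l) p.1 * p.2 x} & \sum_(p <- l) normc p.1 <= s].

Lemma findec_le q f s t : s <= t -> findec q f s -> findec q f t.
Proof. by move=> st [l [la lf ls]]; exists l; split=> //; exact: le_trans st. Qed.

Lemma findec_ae q f g s : {ae mu, forall x, f x = g x} -> findec q f s -> findec q g s.
Proof.
move=> fg [l [la lf ls]]; exists l; split=> //.
by move: fg lf; apply: filterS2 => x <-.
Qed.

Lemma findec0 q f s : 0 <= s -> {ae mu, forall x, f x = 0} -> findec q f s.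
Proof.
move=> s0 f0; exists [::]; split=> //; last by rewrite big_nil.
by move: f0; apply: filterS => x ->; rewrite big_nil.
Qed.

Lemma findec_atom q (k : C) a : is_atom q a -> findec q (fun x => k * a x) (normc k).
Proof.
move=> aa; exists [:: (k, a)]; split; last by rewrite big_seq1.
  by move=> p [<-//|[]].
by apply: aeW => x; rewrite big_seq1.
Qed.

Lemma findecD q f g s t : findec q f s -> findec q g t ->
  findec q (fun x => f x + g x) (s + t).
Proof.
move=> [l [la lf ls]] [m [ma mg mt]]; exists (l ++ m); split.
- by move=> p plm; have [/la|/ma] := List.in_app_or _ _ _ plm.
- by move: lf mg; apply: filterS2 => x -> ->; rewrite big_cat.
- by rewrite big_cat lerD.
Qed.

Lemma findecZ q (k : C) f s : findec q f s -> findec q (fun x => k * f x) (normc k * s).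
Proof.
move=> [l [la lf ls]]; exists [seq (k * p.1, p.2) | p <- l]; split.
- elim: l la {lf ls} => //= p l ih la r [<-/=|]; first by apply: la; left.
  by apply: ih => r' r'l; apply: la; right.
- move: lf; apply: filterS => x ->; rewrite big_map mulr_sumr.
  by apply: eq_bigr => p _; rewrite mulrA.
- rewrite big_map; apply: le_trans (ler_wpM2l (normc_ge0 k) ls).
  by rewrite mulr_sumr ler_sum// => p _; rewrite normcM.
Qed.

Lemma findec_sum q (I : Type) (l : seq I) (P : pred I) (f : I -> V -> C) (s : I -> R) :
  (forall i, P i -> findec q (f i) (s i)) ->
  findec q (fun x => \sum_(i <- l | P i) f i x) (\sum_(i <- l | P i) s i).
Proof.
move=> fs; elim: l => [|i l ih].
  by rewrite big_nil; apply: findec0 => //; apply: aeW => x; rewrite big_nil.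
rewrite big_cons; under eq_fun do rewrite big_cons.
by case: ifPn => // Pi; apply: findecD => //; exact: fs.
Qed.

Lemma findec_oo (q : \bar R) f s : (1 < q)%E -> findec +oo f s -> findec q f s.
Proof.
by move=> q1 [l [la lf ls]]; exists l; split=> // p /la; exact: atom_oo_any.
Qed.

Lemma findec_ge0 q f s : findec q f s -> 0 <= s.
Proof. by move=> [l [_ _]]; apply: le_trans; apply: sumr_ge0 => p _; exact: normc_ge0. Qed.

Lemma finite_findec q f N (lam : 'I_N -> C) a : finite_atomic_decomposition q f lam a ->
  findec q f (\sum_(j < N) normc (lam j)).
Proof.
move=> [aa fE]; exists [seq (lam j, a j) | j <- enum 'I_N]; split.
- by move=> p /List.in_map_iff [j [<- _]]; exact: aa.
- by move: fE; apply: filterS => x ->; rewrite big_map -big_enum.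
- by rewrite big_map -[X in _ <= X]big_enum.
Qed.

Lemma findec_finite q f s : findec q f s ->
  exists N (lam : 'I_N -> C) a, finite_atomic_decomposition q f lam a /\
    \sum_(j < N) normc (lam j) <= s.
Proof.
move=> [l [la lf ls]]; pose d : C * (V -> C) := (0, fun=> 0).
exists (size l), (fun j => (nth d l j).1), (fun j => (nth d l j).2); split; first split.
- move=> j; apply: la; elim: (l) (nat_of_ord j) (ltn_ord j) => // p m ih [|k] km /=; first by left.
  by right; exact: ih.
- by move: lf; apply: filterS => x ->; rewrite (big_nth d) big_mkord.
- by move: ls; rewrite (big_nth d) big_mkord.
Qed.

Lemma findec_H1fin_norm q f s : findec q f s -> (H1fin_norm q f <= s%:E)%E.
Proof.
move=> /findec_finite [N [lam [a [fE ls]]]].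
apply: (@le_trans _ _ (\sum_(j < N) normc (lam j))%:E); last by rewrite lee_fin.
by apply: ereal_inf_lbound; exists N, lam, a.
Qed.

Lemma H1fin_norm_findec q f s : (H1fin_norm q f < s%:E)%E -> findec q f s.
Proof.
move=> /ereal_inf_lt [_ [N [lam [a [fE ->]]]]]; rewrite lte_fin => /ltW ls.
exact: findec_le ls (finite_findec fE).
Qed.

Lemma H1fin_norm_ge0 q (f : V -> C) : (0 <= H1fin_norm q f)%E.
Proof.
apply/ereal_infP => _ [N [lam [a [_ ->]]]]; rewrite lee_fin.
by apply: sumr_ge0 => j _; exact: normc_ge0.
Qed.

Lemma RintegralZ0 (k : R) (f : V -> R) : mu.-integrable setT (EFin \o f) ->
  \int[mu]_x f x = 0 -> \int[mu]_x (k * f x) = 0.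
Proof. by move=> fi f0; rewrite RintegralZl// f0 mulr0. Qed.

(* Volume factor between the cube of half-side [s] and the ball of radius
   [(n + 1) s] around it; [n + 1] in place of [sqrt n] keeps the radius
   positive for every [n]. *)
Definition ball_cst : R := (2 * n.+1%:R) ^+ n.

Lemma ball_cst_gt0 : 0 < ball_cst.
Proof. by rewrite exprn_gt0// mulr_gt0. Qed.

Lemma vol_box_le (c : V) (s : R) : 0 < s -> vol c (n.+1%:R * s) <= ball_cst * s ^+ n.
Proof.
move=> s0; apply: (le_trans (vol_le c _)); first by rewrite mulr_ge0// ltW.
by rewrite mulrA exprMn.
Qed.

Lemma box_sub_eballS (c : V) (s : R) : 0 < s -> box c s `<=` eball c (n.+1%:R * s).
Proof.
move=> s0 x /(box_sub_eball (ltW s0)); rewrite /eball /= => /le_trans; apply.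
by rewrite ler_pM2r// ler_nat.
Qed.

Lemma ae_eballS (f : V -> R) c (s : R) : 0 < s -> {ae mu, forall x, ~ box c s x -> f x = 0} ->
  {ae mu, forall x, ~ eball c (n.+1%:R * s) x -> f x = 0}.
Proof.
move=> s0; apply: filterS => x fx xB; apply: fx => xb; apply: xB; exact: box_sub_eballS.
Qed.

Lemma bounded_integrable (f : V -> R) c (s b : R) : 0 < s -> measurable_fun setT f ->
  {ae mu, forall x, `|f x| <= b} -> {ae mu, forall x, ~ box c s x -> f x = 0} ->
  mu.-integrable setT (EFin \o f).
Proof.
move=> s0 mf fb f0; have b0 : 0 <= `|b| by [].
apply/integrable_normP => //; apply: (@le_lt_trans _ _ (\int[mu]_x (`|b| * \1_(box c s) x)%:E)%E).
  apply: ae_ge0_le_integral => //.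
  - exact: measurable_norm.
  - by apply/measurable_EFinP; apply: measurable_funM => //; apply: measurable_indic; exact: measurable_box.
  - move: fb f0; apply: filterS2 => x fb f0 _; rewrite lee_fin indicE.
    case: (asboolP (box c s x)) => xB.
      by rewrite mem_set// mulr1 (le_trans fb)// ler_norm.
    by rewrite f0// normr0 mulr_ge0.
under eq_integral do rewrite EFinM.
rewrite ge0_integralZl//; last by apply/measurable_EFinP; apply: measurable_indic; exact: measurable_box.
rewrite integral_indic//; last exact: measurable_box.
by rewrite setIT [X in (_ * X)%E](measure_box c (ltW s0)) -EFinM ltry.
Qed.

(** One atom suffices: with B the ball around the box, [f] divided by b |B| has supremum at most 1 /
    |B|. The case [b = 0] is apart because the divisor must not vanish. *)
Lemma findec_bounded (f : V -> R) c (s b : R) : 0 < s -> 0 <= b -> measurable_fun setT f ->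
  {ae mu, forall x, `|f x| <= b} -> {ae mu, forall x, ~ box c s x -> f x = 0} ->
  \int[mu]_x f x = 0 -> findec +oo (fun x => (f x)%:C%C) (b * (ball_cst * s ^+ n)).
Proof.
move=> s0; rewrite le_eqVlt => /predU1P[<- _ fb _ _|b0 mf fb f0 if0].
  rewrite mul0r; apply: findec0 => //; move: fb; apply: filterS => x.
  by rewrite normr_le0 => /eqP ->.
have r0 : 0 < n.+1%:R * s by rewrite mulr_gt0.
have v0 := vol_gt0 c r0.
pose k := b * vol c (n.+1%:R * s).
have k0 : 0 < k by rewrite mulr_gt0.
have fi := bounded_integrable s0 mf fb f0.
have aa : is_atom +oo (fun x => (k^-1 * f x)%:C%C).
  apply/is_atom_ooP; split.
  - by apply: cmeasurable_real; apply: measurable_funM.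
  - by rewrite cintegral_real RintegralZ0.
  exists c, (n.+1%:R * s); split; first exact: r0.
  - by move: (ae_eballS s0 f0); apply: filterS => x fx /fx ->; rewrite mulr0.
  - move: fb; apply: filterS => x fx; rewrite normc_real normrM ger0_norm ?invr_ge0 ?(ltW k0)//.
    by rewrite ler_pdivrMl// /k mulfK// gt_eqF.
apply: (@findec_le _ _ k); first by rewrite ler_pM2l// vol_box_le.
have := findec_atom k%:C%C aa; rewrite normc_real ger0_norm ?(ltW k0)//.
by apply: findec_ae; apply: aeW => x; rewrite -rmorphM/= mulrA divff ?mul1r// gt_eqF.
Qed.

Lemma ratom_scale (q : R) (f : V -> R) c (s e : R) : 1 < q -> 0 < s -> 0 < e -> measurable_fun setT f ->
  {ae mu, forall x, ~ box c s x -> f x = 0} -> \int[mu]_x f x = 0 ->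
  (\int[mu]_x (`|f x| `^ q)%:E <= (e `^ q * (ball_cst * s ^+ n) `^ (1 - q))%:E)%E ->
  ratom q (fun x => e^-1 * f x).
Proof.
move=> q1 s0 e0 mf f0 if0 fq.
have r0 : 0 < n.+1%:R * s by rewrite mulr_gt0.
have v0 := vol_gt0 c r0.
have fe0 := ae_eballS s0 f0.
have fi : mu.-integrable setT (EFin \o f).
  apply: (integrable_pow (measurable_eball c (n.+1%:R * s)) _ mf q1 fe0).
    by rewrite (mu_eball _ (ltW r0)) ltry.
  by apply: le_lt_trans fq _; rewrite ltry.
have Dn0 : 0 < ball_cst * s ^+ n by rewrite mulr_gt0 ?ball_cst_gt0// exprn_gt0.
split.
- exact: measurable_funM.
- exact: RintegralZ0.
exists c, (n.+1%:R * s); split; first exact: r0.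
- by move: fe0; apply: filterS => x fx /fx ->; rewrite mulr0.
apply: (@le_trans _ _ (\int[mu]_x ((e^-1 `^ q)%:E * (`|f x| `^ q)%:E))%E).
  rewrite le_eqVlt; apply/orP; left; apply/eqP; apply: eq_integral => x _.
  by rewrite -EFinM normrM ger0_norm ?invr_ge0 ?(ltW e0)// powRM// invr_ge0 ltW.
rewrite ge0_integralZl//; last 2 first.
- exact: measurable_normp.
- by rewrite lee_fin powR_ge0.
apply: (@le_trans _ _ ((e^-1 `^ q)%:E * (e `^ q * (ball_cst * s ^+ n) `^ (1 - q))%:E)%E).
  by rewrite lee_wpmul2l// lee_fin powR_ge0.
rewrite -EFinM lee_fin mulrA -powRM ?invr_ge0 ?(ltW e0)// mulVf ?gt_eqF// powR1 mul1r.
(* As [1 - q] is negative, the upper bound [ball_cst * s ^+ n] of the volume of the ball turns into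
   a lower bound for the power of that volume. *)
rewrite -opprB !powRN lef_pV2 ?posrE ?powR_gt0//.
by apply: ge0_ler_powR; rewrite ?nnegrE ?(ltW v0) ?(ltW Dn0)//; [lra|exact: vol_box_le].
Qed.

Lemma findec_ratom (q : R) (f : V -> R) (e : R) : 1 < q -> 0 < e -> ratom q (fun x => e^-1 * f x) ->
  findec q%:E (fun x => (f x)%:C%C) e.
Proof.
move=> q1 e0 /(ratom_atom q1) aa; have := findec_atom e%:C%C aa.
rewrite normc_real ger0_norm ?(ltW e0)//.
by apply: findec_ae; apply: aeW => x; rewrite -rmorphM/= mulrA divff ?mul1r// gt_eqF.
Qed.

End finite_decompositions.

(** * Averages over a folded grid *)

Section grid.
Context {R : realType} {n : nat}.
Variables (L : R) (M : nat).
Hypothesis L0 : 0 < L.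
Local Notation V := 'rV[R]_n.
Local Notation mu := (@lebesgue_rV R n).
Local Notation grid := {ffun 'I_n -> 'I_(2 ^ M)}.
Local Notation h := (mesh L M).

Definition grid_index (x : V) : grid := [ffun i => Ordinal (index_nat_lt L M (x ord0 i))].

(* The fibres partition the whole space; each of them meets [cube] in one dyadic cell. *)
Definition fibre (k : grid) : set V := [set x | grid_index x = k].

Definition cube : set V := [set x | forall i, - L <= x ord0 i < L].

Definition step (u : grid -> R) (x : V) : R := u (grid_index x) * \1_cube x.

(* The integral over the whole fibre is divided by the volume of one cell only: in this way
   [step (grid_avg g)] has the same integral as [g]. *)
Definition grid_avg (g : V -> R) (k : grid) : R := (h ^+ n)^-1 * \int[mu]_(x in fibre k) g x.

Lemma meshn_gt0 : 0 < h ^+ n.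
Proof. by rewrite exprn_gt0// mesh_gt0. Qed.

Lemma fibre_prodE k : fibre k = [set x | forall i, [set y : R | index_nat L M y = k i] (x ord0 i)].
Proof.
apply/seteqP; split=> x /=.
  by move=> <- i; rewrite ffunE.
by move=> xk; apply/ffunP => i; apply/val_inj; rewrite ffunE /= xk.
Qed.

Lemma measurable_fibre k : measurable (fibre k).
Proof.
rewrite fibre_prodE; apply: (@measurable_prod_set _ _ (fun i => [set y : R | index_nat L M y = k i])).
by move=> i; exact: measurable_index_nat.
Qed.

Lemma measurable_cube : measurable cube.
Proof.
rewrite (_ : cube = [set x | forall i, `[- L, L[%classic (x ord0 i)]).
  apply: (@measurable_prod_set _ _ (fun i => `[- L, L[%classic)).
  by move=> i; exact: measurable_itv.
by apply/seteqP; split => x xc i; have := xc i; rewrite /= in_itv.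
Qed.

Lemma cube_sub_box : cube `<=` box 0 L.
Proof.
by move=> x xc i; have /andP[? ?] := xc i; rewrite mxE subr0 ler_norml; apply/andP; split => //; exact: ltW.
Qed.

Lemma mu_cell k : mu (cube `&` fibre k) = (h ^+ n)%:E.
Proof.
have h0 := mesh_gt0 L0 M.
rewrite (_ : cube `&` fibre k = [set x | forall i,
    `[((k i)%:R * h - L), ((k i).+1%:R * h - L)[%classic (x ord0 i)]).
  rewrite (@lebesgue_rV_box _ _ (fun i => `[((k i)%:R * h - L), ((k i).+1%:R * h - L)[%classic)); last first.
    by move=> i; exact: measurable_itv.
  rewrite (eq_bigr (fun=> h%:E)); first by rewrite prodEFin prodr_const card_ord.
  move=> i _; have kS : (k i).+1%:R * h = (k i)%:R * h + h by rewrite -[in LHS]natr1 mulrDl mul1r.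
  by rewrite itv_measure kS; [congr (_%:E); ring|lra].
rewrite fibre_prodE; apply/seteqP; split => x /=.
  move=> [xc xk] i; have := xk i; rewrite /= in_itv/= (index_nat_id L0 (ltn_ord (k i)) (xc i)).
  lra.
move=> xi.
have xc : cube x.
  move=> i; have := xi i; rewrite /= in_itv/= => /andP[x1 x2]; apply/andP; split.
    by apply: le_trans x1; rewrite lerBrDr addNr mulr_ge0// ltW.
  have : (k i).+1%:R * h <= 2 * L by rewrite -(mesh_expE L M) ler_wpM2r ?(ltW h0)// ler_nat.
  lra.
split=> // i; rewrite (index_nat_id L0 (ltn_ord (k i)) (xc i)).
by have := xi i; rewrite /= in_itv/=; lra.
Qed.

Lemma mu_fibre_box k c (r : R) : 0 <= r ->
  (mu (box c r `&` fibre k) <= ((h * (r / L + 4)) ^+ n)%:E)%E.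
Proof.
move=> r0.
rewrite (_ : box c r `&` fibre k = [set x | forall i, ([set y : R | index_nat L M y = k i] `&`
     `[c ord0 i - r, c ord0 i + r]%classic) (x ord0 i)]).
  apply: (@measure_prod_set_le _ _ (fun i => [set y : R | index_nat L M y = k i] `&`
     `[c ord0 i - r, c ord0 i + r]%classic)).
    by move=> i; apply: measurableI; [exact: measurable_index_nat|exact: measurable_itv].
  by move=> i; exact: index_nat_measure.
rewrite box_prodE fibre_prodE.
apply/seteqP; split => x /=; first by move=> [x1 x2] i; split; [exact: x2|exact: x1].
by move=> xi; split => i; have [] := xi i.
Qed.

Lemma fibres_cover : \big[setU/set0]_(k <- enum {: grid}) fibre k = setT.
Proof.
rewrite -bigcup_seq; apply/seteqP; split => x //= _.
by exists (grid_index x) => //=; rewrite mem_enum.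
Qed.

Lemma fibres_trivIset (s : set grid) : trivIset s fibre.
Proof. by move=> k l _ _ [x [<- <-]]. Qed.

Lemma integral_fibres (g : V -> R) : measurable_fun setT g ->
  (\int[mu]_x (g x)%:E = \sum_k \int[mu]_(x in fibre k) (g x)%:E)%E.
Proof.
move=> mg; rewrite -[in LHS]fibres_cover integral_bigsetU_EFin.
- by rewrite big_enum.
- exact: measurable_fibre.
- exact: enum_uniq.
- exact: fibres_trivIset.
- by rewrite fibres_cover; exact/measurable_EFinP.
Qed.

Lemma measurable_step u : measurable_fun setT (step u).
Proof.
rewrite (_ : step u = fun x => \sum_(k <- enum {: grid}) u k * \1_(cube `&` fibre k) x).
  apply: measurable_sum => k; apply: measurable_funM => //.
  by apply: measurable_indic; apply: measurableI; [exact: measurable_cube|exact: measurable_fibre].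
apply/funext => x; rewrite big_enum/= (bigD1 (grid_index x))//= big1.
  rewrite addr0 /step !indicE; congr (_ * (_ : bool)%:R).
  by have [xc|xc] := pselect (cube x); [rewrite !mem_set|rewrite !memNset// => -[]].
move=> k kx; rewrite indicE memNset ?mulr0// => -[_ /= xk].
by rewrite xk eqxx in kx.
Qed.

(** [F 0 = 0] confines the integrand to the single cell of the fibre that lies in the cube. The
    instances needed are the identity, the modulus and its [q]-th power. *)
Lemma integral_step_fibre (F : R -> R) u k : F 0 = 0 ->
  (\int[mu]_(x in fibre k) (F (step u x))%:E = (h ^+ n * F (u k))%:E)%E.
Proof.
move=> F0; have mc := measurable_cube; have mf := measurable_fibre k.
have -> : (\int[mu]_(x in fibre k) (F (step u x))%:E =
    \int[mu]_(x in fibre k) ((F (u k))%:E * (\1_cube x)%:E))%E.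
  apply: eq_integral => x; rewrite inE => xk; rewrite -EFinM; congr (_%:E).
  by rewrite /step xk indicE; case: (x \in cube); rewrite ?mulr1// !mulr0.
rewrite integralZl//; last first.
  apply/integrableP; split; first by apply/measurable_EFinP; exact: measurable_indic.
  have -> : (\int[mu]_(x in fibre k) `|(\1_cube x)%:E| = \int[mu]_(x in fibre k) (\1_cube x)%:E)%E.
    by apply: eq_integral => x _; rewrite gee0_abs// lee_fin.
  by rewrite integral_indic// [X in (X < _)%E](mu_cell k) ltry.
by rewrite integral_indic// [X in (_ * X)%E](mu_cell k) -EFinM mulrC.
Qed.

Lemma integral_step (F : R -> R) u : F 0 = 0 -> measurable_fun setT F ->
  (\int[mu]_x (F (step u x))%:E = (h ^+ n * \sum_k F (u k))%:E)%E.
Proof.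
move=> F0 mF; rewrite (@integral_fibres (F \o step u)); last first.
  by apply: measurableT_comp => //; exact: measurable_step.
by rewrite (eq_bigr _ (fun k _ => integral_step_fibre u k F0)) sumEFin mulr_sumr.
Qed.

Lemma Rintegral_step u : \int[mu]_x (step u x) = h ^+ n * \sum_k u k.
Proof. by rewrite /Rintegral (@integral_step id)//; exact: measurable_id. Qed.

Lemma grid_avg_step u k : grid_avg (step u) k = u k.
Proof.
by rewrite /grid_avg /Rintegral (@integral_step_fibre id)// mulrA mulVf ?mul1r// gt_eqF// meshn_gt0.
Qed.

Lemma step_out u x : ~ cube x -> step u x = 0.
Proof. by move=> xc; rewrite /step indicE memNset// mulr0. Qed.

Lemma step_in u x : cube x -> step u x = u (grid_index x).
Proof. by move=> xc; rewrite /step indicE mem_set// mulr1. Qed.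

Lemma stepD u v x : step u x + step v x = step (fun k => u k + v k) x.
Proof. by rewrite /step mulrDl. Qed.

Section integrable_functions.
Variable g : V -> R.
Hypothesis gi : mu.-integrable setT (EFin \o g).

Let mg : measurable_fun setT g.
Proof. by apply/measurable_EFinP; case/integrableP: gi. Qed.

Lemma integrable_fibre k : mu.-integrable (fibre k) (EFin \o g).
Proof. by apply: integrableS gi => //; exact: measurable_fibre. Qed.

Lemma sum_grid_avg : h ^+ n * \sum_k grid_avg g k = \int[mu]_x g x.
Proof.
rewrite /grid_avg -mulr_sumr mulrA divff ?gt_eqF ?meshn_gt0// mul1r.
apply: EFin_inj; rewrite -sumEFin /Rintegral [RHS]fineK; last exact: integrable_fin_num gi.
rewrite (integral_fibres mg); apply: eq_bigr => k _.
apply: fineK; apply: integrable_fin_num; first exact: measurable_fibre.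
exact: integrable_fibre.
Qed.

Lemma grid_avg_norm k :
  ((h ^+ n * `|grid_avg g k|)%:E <= \int[mu]_(x in fibre k) `|g x|%:E)%E.
Proof.
rewrite /grid_avg normrM ger0_norm ?invr_ge0 ?(ltW meshn_gt0)// mulrA divff ?gt_eqF ?meshn_gt0// mul1r.
rewrite EFin_normr_Rintegral; [|exact: measurable_fibre|exact: integrable_fibre].
apply: le_abse_integral; first exact: measurable_fibre.
exact: measurable_funTS ((measurable_EFinP _ _).2 mg).
Qed.

(** Averaging is a contraction of L^1, in spite of the folding: the fibres partition the space, and
    inside a fibre the copies of the cell can only cancel. *)
Lemma sum_grid_avg_norm :
  ((h ^+ n * \sum_k `|grid_avg g k|)%:E <= \int[mu]_x `|g x|%:E)%E.
Proof.
rewrite (@integral_fibres (fun x => `|g x|)); last by apply: measurableT_comp.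
rewrite mulr_sumr -sumEFin; apply: lee_sum => k _; exact: grid_avg_norm.
Qed.

(** Young's inequality on one fibre. The fibre meets the box in measure at most
    [h ^+ n * (r / L + 4) ^+ n]; after division by the volume of one cell, the overlap factor of the
    folding remains. *)
Lemma grid_avg_young E c (r p t : R) : 0 <= r -> 1 < p -> 0 < t -> measurable E ->
  E `<=` box c r -> {ae mu, forall x, ~ E x -> g x = 0} ->
  (\int[mu]_x (`|g x| `^ p)%:E < +oo)%E -> forall k,
  `|grid_avg g k| <= t * (r / L + 4) ^+ n +
    t `^ (1 - p) * grid_avg (fun x => `|g x| `^ p) k.
Proof.
move=> r0 p1 t0 mE Eb g0 goo k; have mf := measurable_fibre k.
have hn0 := meshn_gt0.
have fin : (\int[mu]_(x in fibre k) (`|g x| `^ p)%:E)%E \is a fin_num.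
  rewrite ge0_fin_numE; last exact: int_normp_ge0.
  apply: le_lt_trans goo; apply: ge0_subset_integral => //.
  exact: measurable_normp.
rewrite -(ler_pM2l hn0) -lee_fin; apply: (le_trans (grid_avg_norm k)).
apply: (le_trans (int_norm_young mf mE mg p1 t0 g0)).
rewrite mulrDr EFinD; apply: leeD.
  rewrite mulrCA EFinM lee_wpmul2l ?lee_fin ?(ltW t0)// -exprMn.
  apply: le_trans (mu_fibre_box k c r0); apply: le_measure; rewrite ?inE.
  - exact: measurableI.
  - by apply: measurableI => //; exact: measurable_box.
  - exact: setSI.
rewrite -[X in (_ * X <= _)%E](fineK fin) -EFinM lee_fin mulrCA ler_wpM2l ?powR_ge0//.
by rewrite /grid_avg mulrA divff ?gt_eqF// mul1r.
Qed.

End integrable_functions.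

Lemma grid_avgD f g : mu.-integrable setT (EFin \o f) -> mu.-integrable setT (EFin \o g) ->
  forall k, grid_avg (fun x => f x + g x) k = grid_avg f k + grid_avg g k.
Proof.
move=> fi gi k; rewrite /grid_avg RintegralD; first by rewrite mulrDr.
- exact: measurable_fibre.
- exact: integrable_fibre.
- exact: integrable_fibre.
Qed.

Lemma grid_avgZ (a : R) f : mu.-integrable setT (EFin \o f) ->
  forall k, grid_avg (fun x => a * f x) k = a * grid_avg f k.
Proof.
move=> fi k; rewrite /grid_avg RintegralZl; first by rewrite mulrCA.
  exact: measurable_fibre.
exact: integrable_fibre.
Qed.

Lemma integrable_step u : mu.-integrable setT (EFin \o step u).
Proof.
apply/integrable_normP; first exact: measurable_step.
by rewrite (@integral_step (fun x => `|x|)) ?normr0 ?ltry.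
Qed.

End grid.

(** * Calderon-Zygmund decomposition on a grid *)

Section blocks.
Context {n M : nat}.
Local Notation grid := {ffun 'I_n -> 'I_(2 ^ M)}.

Lemma block_subproof l (j : 'I_(2 ^ M)) : (j %/ 2 ^ l < 2 ^ M)%N.
Proof. exact: leq_ltn_trans (leq_div _ _) (ltn_ord j). Qed.

(* The position, among the cells of side [2 ^ l * h], of the one that contains the cell [k]
   of side [h]. *)
Definition block l (k : grid) : grid := [ffun i => Ordinal (block_subproof l (k i))].

Lemma block0 k : block 0 k = k.
Proof. by apply/ffunP => i; apply/val_inj; rewrite ffunE /= expn0 divn1. Qed.

Lemma blockS l k : block l.+1 k = block 1 (block l k).
Proof.
by apply/ffunP => i; apply/val_inj; rewrite !ffunE /= expn1 expnSr divnMA.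
Qed.

Lemma card_divn_eq l (a : 'I_(2 ^ M)) : (l <= M)%N ->
  #|[pred j : 'I_(2 ^ M) | (j %/ 2 ^ l == a %/ 2 ^ l)%N]| = (2 ^ l)%N.
Proof.
move=> lM; have p0 : (0 < 2 ^ l)%N by rewrite expn_gt0.
have alt (i : 'I_(2 ^ l)) : ((a %/ 2 ^ l) * 2 ^ l + i < 2 ^ M)%N.
  have : (a %/ 2 ^ l < 2 ^ (M - l))%N.
    by rewrite ltn_divLR// -expnD subnK.
  have E : (2 ^ M = 2 ^ (M - l) * 2 ^ l)%N by rewrite -expnD subnK.
  by have := ltn_ord i; move: (a %/ _)%N => b; rewrite E; nia.
pose f i := Ordinal (alt i).
have fI : injective f by move=> i j /(congr1 val)/= /addnI /val_inj.
rewrite -[RHS]card_ord -(fintype.card_image fI); apply: eq_card => j; rewrite !inE.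
apply/eqP/fintype.imageP => [ja|[i _ ->]]; last first.
  by rewrite /= divnMDl// (divn_small (ltn_ord i)) addn0.
exists (Ordinal (ltn_pmod j p0)) => //; apply/val_inj => /=.
by rewrite -ja -divn_eq.
Qed.

Lemma card_block l (k : grid) : (l <= M)%N ->
  #|[pred k' : grid | block l k' == block l k]| = ((2 ^ l) ^ n)%N.
Proof.
move=> lM.
have -> : #|[pred k' : grid | block l k' == block l k]| =
    #|family (fun i => [pred j : 'I_(2 ^ M) | (j %/ 2 ^ l == k i %/ 2 ^ l)%N])|.
  apply: eq_card => k'; rewrite !inE; apply/eqP/familyP => [kk i|kk].
    by rewrite inE; have /ffunP/(_ i)/(congr1 val) := kk; rewrite !ffunE /= => ->.
  by apply/ffunP => i; apply/val_inj; have := kk i; rewrite inE !ffunE /= => /eqP.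
rewrite card_family /image_mem (eq_map (g := fun=> (2 ^ l)%N)); last first.
  by move=> i; rewrite card_divn_eq.
rewrite -[in RHS](card_ord n) cardE.
by elim: (enum _) => //= _ s ->; rewrite expnS.
Qed.

End blocks.

Section block_steps.
Context {R : realType} {n : nat}.
Variables (L : R) (M : nat).
Hypothesis L0 : 0 < L.
Local Notation V := 'rV[R]_n.
Local Notation grid := {ffun 'I_n -> 'I_(2 ^ M)}.
Local Notation h := (mesh L M).
Local Notation cstep v := (fun x : V => (step L v x)%:C%C).

Lemma block_index l (x : V) i : (l <= M)%N ->
  block l (grid_index L M x) i = index_nat L (M - l) (x ord0 i) :> nat.
Proof. by move=> lM; rewrite ffunE /= ffunE /= index_nat_div. Qed.

Lemma block_dist l (x y : V) i : (l <= M)%N -> cube L x -> cube L y ->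
  block l (grid_index L M x) = block l (grid_index L M y) ->
  `|x ord0 i - y ord0 i| <= 2 ^+ l * h.
Proof.
move=> lM xc yc xy; rewrite -meshS//.
have := index_nat_itv L0 (M - l) (x ord0 i); have := index_nat_itv L0 (M - l) (y ord0 i).
rewrite -!block_index// xy !fold_id//.
set j := (nat_of_ord _); rewrite -[(j.+1)%:R]natr1 mulrDl mul1r ler_norml.
move: (j%:R * _) => a; lra.
Qed.

Lemma findec_step (v : grid -> R) (c : V) (s b : R) : 0 < s -> 0 <= b ->
  (forall k, `|v k| <= b) -> (forall x, cube L x -> v (grid_index L M x) != 0 -> box c s x) ->
  \sum_k v k = 0 -> findec +oo (cstep v) (b * (ball_cst (R:=R) (n:=n) * s ^+ n)).
Proof.
move=> s0 b0 vb vs v0; apply: (@findec_bounded _ _ _ c) => //.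
- exact: measurable_step.
- apply: aeW => x; have [xc|xc] := pselect (cube L x); first by rewrite step_in.
  by rewrite step_out// normr0.
- apply: aeW => x xs; have [xc|xc] := pselect (cube L x); last by rewrite step_out.
  by rewrite step_in//; apply/eqP/negPn/negP => /(vs _ xc).
- by rewrite Rintegral_step// v0 mulr0.
Qed.

Lemma findec_block l d (v : grid -> R) (b : R) : (l <= M)%N -> 0 <= b ->
  (forall k, block l k != d -> v k = 0) -> (forall k, `|v k| <= b) -> \sum_k v k = 0 ->
  findec +oo (cstep v) (b * (ball_cst (R:=R) (n:=n) * (2 ^+ l * h) ^+ n)).
Proof.
move=> lM b0 vd vb v0.
have s0 : 0 < 2 ^+ l * h by rewrite mulr_gt0 ?exprn_gt0// mesh_gt0.
have [[x0 [x0c x0d]]|no] := pselect (exists x0, cube L x0 /\ block l (grid_index L M x0) = d).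
  apply: (@findec_step _ x0) => // x xc vx i; apply: block_dist => //.
  by rewrite x0d; apply/eqP/negPn; apply: contra vx => /vd ->.
apply: findec0; first by rewrite !mulr_ge0 ?exprn_ge0 ?(ltW s0)// ltW// ball_cst_gt0.
apply: aeW => x; have [xc|xc] := pselect (cube L x); last by rewrite step_out.
by rewrite step_in// vd//; apply/eqP => xd; apply: no; exists x.
Qed.

End block_steps.

Section calderon_zygmund.
Context {R : realType} {n : nat}.
Variables (L : R) (M : nat).
Hypothesis L0 : 0 < L.
Local Notation V := 'rV[R]_n.
Local Notation grid := {ffun 'I_n -> 'I_(2 ^ M)}.
Local Notation h := (mesh L M).
Local Notation cstep v := (fun x : V => (step L v x)%:C%C).
Variables (p m : R) (u W : grid -> R).
Hypotheses (p1 : 1 < p) (m0 : 0 < m) (W0 : forall k, 0 <= W k).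
(* [uW] is Young's inequality for the averages [u] of an atom [a] and [W] of [|a| ^ p]; it
   replaces Holder's inequality. *)
Hypothesis uW : forall t k, 0 < t -> `|u k| <= t * m + t `^ (1 - p) * W k.

Local Notation bsize l := (((2 ^ l) ^ n)%:R : R).

Definition block_avg l (f : grid -> R) (d : grid) : R :=
  (\sum_(k | block l k == d) f k) / bsize l.

Local Notation bavg l d := (block_avg l (fun k => `|u k|) d).

Lemma bsizeS l : bsize l.+1 = 2 ^+ n * bsize l.
Proof. by rewrite expnS expnMn natrM natrX. Qed.

Lemma bsize_gt0 l : 0 < bsize l.
Proof. by rewrite ltr0n !expn_gt0. Qed.

(* The factor by which an average must grow from one selected cube to the
   next one; it is chosen so that [stop_cst `^ (1 - p) = 1 / 2]. *)
Definition stop_cst : R := 2 `^ (p - 1)^-1.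

Lemma stop_cst_ge1 : 1 <= stop_cst.
Proof.
rewrite -(powRr0 2) /stop_cst; apply: ler_powR; first lra.
by rewrite invr_ge0 subr_ge0 ltW.
Qed.

Lemma stop_cst_pow : stop_cst `^ (1 - p) = 2^-1.
Proof.
rewrite /stop_cst -powRrM -(opprB p) mulrN mulVf; last by rewrite subr_eq0 gt_eqF.
by rewrite powR_inv1.
Qed.

Definition jensen_cst : R := 2 * (2 * m) `^ (p - 1).

Lemma jensen_cst_gt0 : 0 < jensen_cst.
Proof. by rewrite mulr_gt0// powR_gt0// mulr_gt0. Qed.

(** Only an inequality, since [d] ranges over the whole type [grid] and may be the position of no
    block of level [l]. *)
Lemma card_block_le l d : (l <= M)%N -> (#|[pred k : grid | block l k == d]|%:R <= bsize l).
Proof.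
move=> lM; rewrite ler_nat.
have [k /eqP kd|no] := pickP [pred k : grid | block l k == d].
  by rewrite -(card_block k lM); apply: eq_leq; apply: eq_card => k'; rewrite !inE kd.
by rewrite eq_card0.
Qed.

(** At the threshold [t / (2 * m)] the first terms of Young's inequality add up to at most half of
    the left-hand side and are absorbed; this gives the factor 2 and the power of [2 * m] in
    [jensen_cst]. Up to this constant it is Jensen's inequality: [t ^ p] is bounded by the average
    of [W] on the block. *)
Lemma block_jensen l d : (l <= M)%N -> 0 < bavg l d ->
  \sum_(k | block l k == d) `|u k| <=
  jensen_cst * \sum_(k | block l k == d) (bavg l d) `^ (1 - p) * W k.
Proof.
move=> lM; set t := bavg l d => t0; set S := (X in X <= _).
have tS : bsize l * t = S by rewrite /t /block_avg mulrC divfK// gt_eqF// bsize_gt0.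
have m20 : 0 < 2 * m by rewrite mulr_gt0.
have step1 : S <= \sum_(k | block l k == d) (t / 2 + (t / (2 * m)) `^ (1 - p) * W k).
  apply: ler_sum => k _; have := @uW (t / (2 * m)) k (divr_gt0 t0 m20).
  by rewrite (_ : t / (2 * m) * m = t / 2)//; field; rewrite gt_eqF.
have step2 : \sum_(k | block l k == d) (t / 2) <= S / 2.
  rewrite sumr_const -tS -[X in X <= _]mulr_natl mulrA ler_wpM2r ?ler_wpM2r ?(ltW t0)//.
  exact: card_block_le.
rewrite big_split/= in step1.
have E : jensen_cst * \sum_(k | block l k == d) t `^ (1 - p) * W k =
    2 * \sum_(k | block l k == d) (t / (2 * m)) `^ (1 - p) * W k.
  rewrite /jensen_cst -mulrA mulr_sumr; congr (2 * _); apply: eq_bigr => k _.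
  rewrite mulrA [in RHS]powRM ?invr_ge0 ?(ltW t0) ?(ltW m20)//; congr (_ * _).
  rewrite mulrC; congr (_ * _).
  by rewrite -(powR_inv1 (ltW m20)) -powRrM; congr (_ `^ _); ring.
rewrite E; move: step1 step2; lra.
Qed.

Lemma sum_block (f : grid -> R) l d :
  \sum_(k | block l.+1 k == d) f k =
  \sum_(e | block 1 e == d) \sum_(k | block l k == e) f k.
Proof.
rewrite (partition_big (block l) (fun e => block 1 e == d)); last first.
  by move=> k; rewrite blockS.
apply: eq_bigr => e /eqP ed; apply: eq_bigl => k; rewrite blockS.
by case: (block l k =P e) => [->|_]; rewrite ?ed ?eqxx// andbF.
Qed.

(** A parent block has [2 ^ n] times the size of its child; this is the origin of the factor
    [2 ^+ n] in the bound on the good part. *)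
Lemma block_avg_parent l d : bavg l d <= 2 ^+ n * bavg l.+1 (block 1 d).
Proof.
rewrite /block_avg.
rewrite [X in _ <= X](_ : _ = (\sum_(k | block l.+1 k == block 1 d) `|u k|) / bsize l); last first.
  by rewrite bsizeS; field; rewrite gt_eqF ?bsize_gt0// expf_neq0.
rewrite ler_wpM2r ?invr_ge0 ?(ltW (bsize_gt0 l))//.
rewrite [leRHS](bigID (fun k => block l k == d))/= -[leLHS]addr0; apply: lerD.
  rewrite le_eqVlt; apply/orP; left; apply/eqP; apply: eq_bigl => k; rewrite blockS.
  by case: (block l k =P d) => [->|_]; rewrite ?eqxx// andbF.
by apply: sumr_ge0.
Qed.

Lemma norm_block_avg_le l d : `|block_avg l u d| <= bavg l d.
Proof.
rewrite /block_avg normrM [X in _ * X]ger0_norm ?invr_ge0 ?(ltW (bsize_gt0 l))//.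
by rewrite ler_wpM2r ?invr_ge0 ?(ltW (bsize_gt0 l))// ler_norm_sum.
Qed.

Lemma sum_block_avg (f : grid -> R) l d : (l <= M)%N ->
  \sum_(k | block l k == d) block_avg l f d = \sum_(k | block l k == d) f k.
Proof.
move=> lM; have [k0 /eqP kd|no] := pickP [pred k : grid | block l k == d].
  rewrite sumr_const (_ : #|_| = ((2 ^ l) ^ n)%N); last first.
    by rewrite -(card_block k0 lM); apply: eq_card => k'; rewrite !inE kd.
  by rewrite /block_avg -[LHS]mulr_natr divfK// gt_eqF// bsize_gt0.
by rewrite !big_pred0.
Qed.

(** On a selected cube, [2 ^+ n * stop_cst] bounds the good part and 1 the subtracted average, both
    in units of the average of |u|. [ball_cst] passes from cubes to balls, and [jensen_cst] from
    averages of |u| to [W]. *)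
Definition cz_cst : R := (2 ^+ n * stop_cst + 1) * ball_cst (R:=R) (n:=n) * jensen_cst.

Lemma cz_cst_ge0 : 0 <= cz_cst.
Proof.
have := stop_cst_ge1; have := jensen_cst_gt0; have := ball_cst_gt0 (R:=R) (n:=n).
move=> b0 j0 s1; rewrite /cz_cst !mulr_ge0 ?(ltW j0) ?(ltW b0) ?powR_ge0 ?(ltW m0)//.
by rewrite addr_ge0// mulr_ge0 ?exprn_ge0//; lra.
Qed.

(* Here [t d] is the average over the last selected cube above the block [d]. A block is
   selected when its average exceeds [stop_cst * t d]; on it [g] is replaced by the average. Since
   [stop_cst `^ (1 - p) = 1 / 2], the costs of nested selected cubes form a geometric series. *)
Lemma calderon_zygmund l : (l <= M)%N -> forall t : grid -> R, (forall d, 0 < t d) ->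
  (forall d, bavg l d <= stop_cst * t d) ->
  exists g : grid -> R,
  [/\ forall d, \sum_(k | block l k == d) g k = \sum_(k | block l k == d) u k,
      forall k, `|g k| <= 2 ^+ n * stop_cst * t (block l k),
      forall d, (forall k, block l k = d -> u k = 0) -> forall k, block l k = d -> g k = 0 &
      findec +oo (cstep (fun k => u k - g k))
        (cz_cst * h ^+ n * \sum_k t (block l k) `^ (1 - p) * W k)].
Proof.
have A1 := stop_cst_ge1; have h0 := mesh_gt0 L0 M.
have D1 : 1 <= 2 ^+ n :> R by rewrite exprn_ege1// ler1n.
have C0 := cz_cst_ge0.
elim: l => [_ t t0 ta|l ih lM t t0 ta].
  exists u; split => //.
  - move=> k; have := ta (block 0 k); rewrite /block_avg (bigD1 k)//= big1; last first.
      by move=> j; rewrite !block0 => /andP[/eqP ->]; rewrite eqxx.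
    rewrite addr0 expn0 exp1n divr1 => /le_trans; apply.
    by rewrite -mulrA ler_peMl// mulr_ge0 ?(ltW (t0 _))//; lra.
  - apply: findec0; last first.
      by apply: aeW => x; rewrite /step subrr mul0r.
    apply: mulr_ge0; first by rewrite mulr_ge0 ?exprn_ge0 ?(ltW h0).
    by apply: sumr_ge0 => k _; rewrite mulr_ge0 ?powR_ge0.
pose stop d := stop_cst * t (block 1 d) < bavg l d.
(* The induction climbs from fine to coarse blocks, but the reference values descend: an unselected
   block inherits the value of its parent, a selected one starts anew from its own average. *)
pose t' d := if stop d then bavg l d else t (block 1 d).
have t'0 d : 0 < t' d.
  rewrite /t'; case: ifPn => // sd; apply: le_lt_trans sd.
  by rewrite mulr_ge0 ?(ltW (t0 _))//; lra.
have t'a d : bavg l d <= stop_cst * t' d.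
  rewrite /t'; case: ifPn => [sd|]; last by rewrite /stop -leNgt.
  rewrite ler_peMl//; apply: le_trans (ltW sd).
  by rewrite mulr_ge0 ?(ltW (t0 _))//; lra.
have [g' [g's g'b g'z g'f]] := ih (ltnW lM) t' t'0 t'a.
pose g k := if stop (block l k) then block_avg l u (block l k) else g' k.
exists g.
have gs d : \sum_(k | block l k == d) g k = \sum_(k | block l k == d) u k.
  case sd : (stop d).
    rewrite -(sum_block_avg u d (ltnW lM)); apply: eq_bigr => k /eqP kd.
    by rewrite /g kd sd.
  by rewrite -g's; apply: eq_bigr => k /eqP kd; rewrite /g kd sd.
(* The correction on a selected block [d]. Its sum is zero because [g'] and [u] have the same sum
   there, so it is a multiple of one atom carried by that block. *)
pose v d k := if block l k == d then g' k - block_avg l u d else 0.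
have ugE k : u k - g k = (u k - g' k) + \sum_(d | stop d) v d k.
  rewrite /g; case: ifPn => sk.
    rewrite (bigD1 (block l k))//= big1 /v ?eqxx; last first.
      by move=> d /andP[_]; rewrite eq_sym; case: eqP.
    by ring.
  rewrite big1 ?addr0// => d sd; rewrite /v; case: eqP => // kd.
  by rewrite kd sd in sk.
split.
- by move=> d; rewrite (sum_block g l) (sum_block u l); apply: eq_bigr => e _.
- move=> k; rewrite blockS /g; case: ifPn => sk.
    apply: (le_trans (norm_block_avg_le _ _)); apply: (le_trans (block_avg_parent _ _)).
    by rewrite -mulrA ler_wpM2l// ?exprn_ge0.
  by have := g'b k; rewrite /t' (negbTE sk).
- move=> d ud k kd; have uk e : e = block l k -> forall k', block l k' = e -> u k' = 0.
    by move=> -> k' kk'; apply: ud; rewrite blockS kk' -blockS.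
  rewrite /g; case: ifPn => _; last exact: (g'z (block l k) (uk _ erefl)).
  by rewrite /block_avg big1 ?mul0r// => k' /eqP kk'; exact: (uk _ erefl).
have vf d : stop d -> findec +oo (cstep (v d))
    (cz_cst * h ^+ n * \sum_(k | block l k == d) t' (block l k) `^ (1 - p) * W k).
  move=> sd; have bd0 : 0 < bavg l d.
    by have := t'0 d; rewrite /t' sd.
  pose b := (2 ^+ n * stop_cst + 1) * bavg l d.
  have b0 : 0 <= b by rewrite mulr_ge0 ?(ltW bd0)// addr_ge0// mulr_ge0//; lra.
  have := @findec_block _ _ L M L0 l d (v d) b (ltnW lM) b0.
  have vd k : block l k != d -> v d k = 0 by rewrite /v => /negbTE ->.
  have vb k : `|v d k| <= b.
    rewrite /v; case: eqP => [kd|_]; last by rewrite normr0.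
    apply: (le_trans (ler_normB _ _)); rewrite /b mulrDl mul1r; apply: lerD.
      by have := g'b k; rewrite kd /t' sd.
    exact: norm_block_avg_le.
  have vs : \sum_k v d k = 0.
    rewrite (bigID (fun k => block l k == d))/= [X in _ + X]big1 ?addr0; last exact: vd.
    under eq_bigr => k kd do rewrite /v kd.
    rewrite sumrB sum_block_avg ?(ltnW lM)// g's; exact: subrr.
  move=> /(_ vd vb vs); apply: findec_le.
  have -> : b * (ball_cst (R:=R) (n:=n) * (2 ^+ l * h) ^+ n) =
      (2 ^+ n * stop_cst + 1) * ball_cst (R:=R) (n:=n) * h ^+ n *
      \sum_(k | block l k == d) `|u k|.
    have -> : \sum_(k | block l k == d) `|u k| = bavg l d * bsize l.
      by rewrite /block_avg divfK// gt_eqF// bsize_gt0.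
    by rewrite /b exprMn !natrX; ring.
  have -> : \sum_(k | block l k == d) t' (block l k) `^ (1 - p) * W k =
            \sum_(k | block l k == d) (bavg l d) `^ (1 - p) * W k.
    by apply: eq_bigr => k /eqP ->; rewrite /t' sd.
  have := block_jensen (ltnW lM) bd0.
  set S := \sum_(k | _) `|u k|; set T := \sum_(k | _) _ => ST.
  rewrite /cz_cst.
  rewrite (_ : _ * jensen_cst * h ^+ n * T =
    (2 ^+ n * stop_cst + 1) * ball_cst (R:=R) (n:=n) * h ^+ n * (jensen_cst * T)); last by ring.
  apply: ler_wpM2l ST; rewrite !mulr_ge0 ?exprn_ge0 ?(ltW h0) ?(ltW (ball_cst_gt0 _ _))//.
  by rewrite addr_ge0// mulr_ge0 ?exprn_ge0//; lra.
have tot := findecD g'f (findec_sum (index_enum _) vf).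
apply: findec_ae; last apply: findec_le tot.
  by apply: aeW => x; rewrite [in RHS]/step ugE mulrDl mulr_suml rmorphD rmorph_sum.
rewrite -mulr_sumr -mulrDr; apply: ler_wpM2l; first by rewrite mulr_ge0 ?exprn_ge0 ?(ltW h0).
have -> : \sum_(d | stop d) \sum_(k | block l k == d) t' (block l k) `^ (1 - p) * W k =
          \sum_k (if stop (block l k) then t' (block l k) `^ (1 - p) * W k else 0).
  rewrite -big_mkcond/= [RHS](partition_big (block l) stop)//=.
  apply: eq_bigr => d sd; apply: eq_bigl => k.
  by case: (block l k =P d) => [->|_]; rewrite ?sd// andbF.
rewrite -big_split/=; apply: ler_sum => k _; rewrite blockS /t'.
(* On a selected block the weight occurs twice, from the induction and from the new atom. The jump
   of the average by the factor [stop_cst] halves each of them, so that together they cost no more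
   than the weight of the parent. *)
case: ifPn => sk; last by rewrite addr0.
rewrite -mulrDl ler_wpM2r// -mulr2n.
have At0 : 0 < stop_cst * t (block 1 (block l k)) by rewrite mulr_gt0//; lra.
have : bavg l (block l k) `^ (1 - p) <= (stop_cst * t (block 1 (block l k))) `^ (1 - p).
  rewrite -(opprB p) !powRN lef_pV2 ?posrE ?powR_gt0//; last exact: lt_trans sk.
  have p10 : 0 <= p - 1 by rewrite subr_ge0 ltW.
  apply: (ge0_ler_powR p10); rewrite ?nnegrE ?(ltW At0)//; last exact: ltW sk.
  exact: ltW (lt_trans At0 sk).
rewrite powRM ?(ltW (t0 _))//; last lra.
rewrite stop_cst_pow -[X in _ -> X <= _]mulr_natl; lra.
Qed.

End calderon_zygmund.

(** * Averages of atoms *)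

Section grid_avg_atoms.
Context {R : realType} {n : nat}.
Local Notation V := 'rV[R]_n.
Local Notation mu := (@lebesgue_rV R n).

(** The two escape clauses stand for a ball too large for the whole grid ([l = M]) and one smaller
    than a cell ([l = 0]). Otherwise [2 ^+ l * h] lies between [r] and [2 * r]. *)
Lemma dyadic_level (h r : R) M : 0 < h -> 0 < r -> exists2 l, (l <= M)%N &
  (l = M \/ r <= 2 ^+ l * h) /\ (l = 0%N \/ 2 ^+ l * h <= 2 * r).
Proof.
move=> h0 r0; elim: M => [|M [l lM [l1 l2]]]; first by exists 0%N => //; split; left.
have [rl|rl] := leP r (2 ^+ l * h); first by exists l; [exact: leqW|split => //; right].
case: l1 => [lME|]; last by rewrite leNgt rl.
exists M.+1 => //; split; [by left|right].
by rewrite exprS -mulrA ler_wpM2l// -lME ltW.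
Qed.

Lemma grid_avg_support (L : R) M (a : V -> R) (E : set V) k : 0 < L ->
  mu.-integrable setT (EFin \o a) -> {ae mu, forall x, ~ E x -> a x = 0} ->
  grid_avg (M := M) L a k != 0 -> exists2 x, fibre L k x & E x.
Proof.
move=> L0 ai aE; apply: contra_neqP => no.
have ma : measurable_fun setT a by apply/measurable_EFinP; case/integrableP: ai.
have := grid_avg_norm L0 ai k.
have -> : (\int[mu]_(x in fibre L k) `|a x|%:E = 0)%E.
  rewrite (@ae_eq_integral _ _ _ _ _ (cst 0%E)) ?integral0//.
  - exact: measurable_fibre.
  - exact: measurable_norm.
  - move: aE; apply: filterS => x ax xk; rewrite ax ?normr0// => xE; apply: no.
    by exists x.
have hn := @meshn_gt0 R n L M L0.
by rewrite lee_fin pmulr_rle0// normr_le0 => /eqP.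
Qed.

(** Since [fold] is 1-Lipschitz, it sends the ball to within [r] of the image of [c], and moving
    inside a block of level [l] adds one side length. For [l = M] the box contains the whole cube,
    however large [r] is. *)
Lemma grid_avg_near (L : R) M (a : V -> R) c (r : R) l k y : 0 < L -> 0 < r -> (l <= M)%N ->
  (l = M \/ r <= 2 ^+ l * mesh L M) ->
  mu.-integrable setT (EFin \o a) -> {ae mu, forall x, ~ eball c r x -> a x = 0} ->
  grid_avg (M := M) L a k != 0 -> cube L y -> block l (grid_index L M y) = block l k ->
  box (\row_i (fold L (c ord0 i) - L)) (2 * (2 ^+ l * mesh L M)) y.
Proof.
move=> L0 r0 lM lr ai ac /(grid_avg_support L0 ai ac) [x <- xc] yc yx i.
rewrite mxE; have yE := fold_id L0 (yc i).
rewrite -meshS//.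
have -> : y ord0 i - (fold L (c ord0 i) - L) = fold L (y ord0 i) - fold L (c ord0 i).
  by rewrite yE; ring.
have s0 := mesh_gt0 L0 (M - l).
have [lME|rs] := lr.
  have -> : mesh L (M - l) = 2 * L by rewrite lME subnn /mesh expr0 divr1.
  have := fold_ge0 L (y ord0 i); have := fold_le L0 (y ord0 i).
  have := fold_ge0 L (c ord0 i); have := fold_le L0 (c ord0 i).
  move: (fold L (y ord0 i)) (fold L (c ord0 i)) => A B; rewrite ler_norml; lra.
have h1 : `|fold L (y ord0 i) - fold L (x ord0 i)| <= mesh L (M - l).
  have := index_nat_itv L0 (M - l) (x ord0 i); have := index_nat_itv L0 (M - l) (y ord0 i).
  rewrite -!block_index// yx.
  set j := (nat_of_ord _); rewrite -[(j.+1)%:R]natr1 mulrDl mul1r.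
  move: (j%:R * _) (fold L (y ord0 i)) (fold L (x ord0 i)) => b A B.
  rewrite ler_norml; lra.
have h2 : `|fold L (x ord0 i) - fold L (c ord0 i)| <= mesh L (M - l).
  apply: (le_trans (fold_lip L0 _ _)); rewrite meshS//; apply: le_trans rs.
  exact: (eball_sub_box (ltW r0) xc).
apply: (le_trans (ler_distD (fold L (x ord0 i)) _ _)); rewrite mulr2n mulrDl mul1r.
exact: lerD.
Qed.

Lemma vol_ge10 c (r : R) : 0 < r -> (10 * r) ^+ n <= (5 * n%:R) ^+ n * vol (c : V) r.
Proof.
move=> r0; apply: le_trans (ler_wpM2l _ (vol_ge c (ltW r0))).
  have [->|n0] := posnP n; first by rewrite !expr0 mulr1.
  rewrite -exprMn le_eqVlt; apply/orP; left; apply/eqP; congr (_ ^+ _).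
  by field; rewrite pnatr_eq0 -lt0n.
by rewrite exprn_ge0// mulr_ge0.
Qed.

(** [s <= 2 * L] gives [r / L * s <= 2 * r], and [s <= 2 * r] gives [4 * s <= 8 * r]. This is where
    the dependence on [r / L] disappears. *)
Lemma overlap_bound (r L s : R) : 0 < L -> 0 < r -> s <= 2 * L -> s <= 2 * r ->
  (r / L + 4) * s <= 10 * r.
Proof.
move=> L0 r0 sL sr; have : r / L * s <= 2 * r.
  by rewrite mulrAC ler_pdivrMr// -mulrA mulrCA ler_pM2l.
rewrite (mulrDl (r / L)); move: (r / L * s) => z; lra.
Qed.

(** The first summand pays for the case [l = 0], where no stopping time is run; the second for the
    selected cubes; the third for the good part, which is a multiple of a single atom. *)
Definition grid_cst (p : R) : R :=
  2 * ball_cst (R:=R) (n:=n) * 2 ^+ n +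
  ((2 ^+ n * stop_cst p + 1) * ball_cst (R:=R) (n:=n) * 2 * ((5 * n%:R) ^+ n) `^ (p - 1) +
   2 ^+ n * stop_cst p * 2 * ball_cst (R:=R) (n:=n) * 2 ^+ n).

Lemma grid_cst_ge0 p : 1 < p -> 0 <= grid_cst p.
Proof.
move=> p1; have := ball_cst_gt0 (R:=R) (n:=n); have := stop_cst_ge1 p1 => s1 b0.
have s0 : 0 <= stop_cst p by apply: le_trans s1.
by rewrite /grid_cst !addr_ge0// !mulr_ge0 ?addr_ge0 ?mulr_ge0 ?powR_ge0 ?exprn_ge0 ?(ltW b0).
Qed.

(* The stopping-time argument is run up to the dyadic scale comparable with the radius of [a]:
   as [fold] is 1-Lipschitz, the averages of [a] live in boundedly many blocks of that scale. *)
Lemma findec_grid_avg (p L : R) M (a : V -> R) : 1 < p -> 0 < L -> ratom p a ->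
  findec +oo (fun x => (step L (grid_avg (M := M) L a) x)%:C%C) (grid_cst p).
Proof.
move=> p1 L0 ra; have ai := ratom_integrable p1 ra; have a2 := ratom_le2 p1 ra.
case: ra => ma ia [c [r [r0 ac ap]]].
set h := mesh L M; have h0 : 0 < h := mesh_gt0 L0 M.
have hn0 : 0 < h ^+ n by rewrite exprn_gt0.
have [l lM [l1 l2]] := dyadic_level M h0 r0.
pose s := 2 ^+ l * h; have s0 : 0 < s by rewrite mulr_gt0// exprn_gt0.
have sn0 : 0 < s ^+ n by rewrite exprn_gt0.
have b0 := ball_cst_gt0 (R:=R) (n:=n).
have A1 := stop_cst_ge1 p1.
have A0 : 0 <= stop_cst p by apply: le_trans A1.
pose u := grid_avg (M := M) L a.
have u0 : \sum_k u k = 0.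
  by apply/eqP; rewrite -(mulrI_eq0 _ (mulfI (lt0r_neq0 hn0))) sum_grid_avg ?ia.
have u2 : h ^+ n * \sum_k `|u k| <= 2.
  by have u2 := @sum_grid_avg_norm R n L M L0 a ai; rewrite -lee_fin; exact: le_trans u2 a2.
have near k y : u k != 0 -> cube L y -> block l (grid_index L M y) = block l k ->
    box (\row_i (fold L (c ord0 i) - L)) (2 * s) y.
  by move=> uk yc yk; apply: (grid_avg_near L0 r0 lM l1 ai ac uk).
have s20 : 0 < 2 * s by rewrite mulr_gt0.
(* A function of size [X * 2 / s ^+ n] on a box of half-side [2 * s] has a cost that does not depend
   on the scale. *)
have costE X : X * 2 / s ^+ n * (ball_cst (R:=R) (n:=n) * (2 * s) ^+ n) =
    X * 2 * ball_cst (R:=R) (n:=n) * 2 ^+ n.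
  rewrite [(2 * s) ^+ n]exprMn; move: sn0; move: (s ^+ n) (ball_cst) => S B S0.
  by field; rewrite gt_eqF.
(* For [l = 0] blocks are cells, and the L^1 bound 2 limits each average to [2 / h ^+ n]: the step
   function is a multiple of one atom. *)
case: (posnP l) => [l00|lpos].
  have sE : s = h by rewrite /s l00 expr0 mul1r.
  have := @findec_step _ _ L M L0 u _ _ (1 * 2 / s ^+ n) s20.
  rewrite costE => uf; apply: findec_le (uf _ _ _ _ u0).
  - rewrite mul1r /grid_cst lerDl !addr_ge0// !mulr_ge0 ?addr_ge0 ?mulr_ge0 ?powR_ge0 ?exprn_ge0 ?(ltW b0)//.
  - by rewrite divr_ge0 ?mulr_ge0// ltW.
  - move=> k; rewrite mul1r ler_pdivlMr// mulrC sE; apply: le_trans u2.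
    by rewrite ler_pM2l// (bigD1 k)//= lerDl sumr_ge0.
  - by move=> x xc ux; apply: near ux xc _.
case: l2 => [l00|s2]; first by rewrite l00 in lpos.
pose m := (r / L + 4) ^+ n; have rL0 : 0 < r / L + 4 by rewrite addr_gt0// divr_gt0.
have m0 : 0 < m by rewrite exprn_gt0.
pose W := grid_avg (M := M) L (fun x => `|a x| `^ p).
have W0 k : 0 <= W k.
  by rewrite mulr_ge0 ?invr_ge0 ?(ltW hn0)//; apply: Rintegral_ge0 => x _; rewrite powR_ge0.
have apoo : (\int[mu]_x (`|a x| `^ p)%:E < +oo)%E by apply: le_lt_trans ap _; rewrite ltry.
have uW t k : 0 < t -> `|u k| <= t * m + t `^ (1 - p) * W k.
  move=> t0; exact: (grid_avg_young L0 ai (ltW r0) p1 t0 (measurable_eball c r)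
    (eball_sub_box (ltW r0)) ac apoo).
(* The total mass of |u| is at most 2 and a block has volume [s ^+ n], so every average at the top
   level is at most [t]; as [stop_cst p >= 1], the stopping time may start from this constant. *)
pose t := 2 / s ^+ n; have t0 : 0 < t by rewrite divr_gt0.
have bst d : block_avg l (fun k => `|u k|) d <= stop_cst p * t.
  apply: (@le_trans _ _ t); last by rewrite ler_peMl// ltW.
  rewrite /block_avg /t /s exprMn invfM mulrCA mulrC.
  have -> : (2 ^+ l) ^+ n = ((2 ^ l) ^ n)%:R :> R by rewrite !natrX.
  rewrite ler_wpM2l ?invr_ge0//.
  rewrite ler_pdivlMr// mulrC; apply: le_trans u2; rewrite ler_pM2l//.
  by rewrite [leRHS](bigID (fun k => block l k == d))/= lerDl sumr_ge0.
have [g [gs gb gz gf]] := calderon_zygmund L0 p1 m0 W0 uW lM (fun=> t0) bst.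
have g0 : \sum_k g k = 0.
  have E (f : _ -> R) : \sum_k f k = \sum_d \sum_(k | block l k == d) f k.
    exact: (partition_big (block l) predT).
  by rewrite E (eq_bigr _ (fun d _ => gs d)) -E.
have gf2 : findec +oo (fun x => (step L g x)%:C%C)
    (2 ^+ n * stop_cst p * 2 * ball_cst (R:=R) (n:=n) * 2 ^+ n).
  rewrite -costE; apply: (@findec_step _ _ L M L0 g _ _ _ s20) => //.
  - by rewrite !mulr_ge0 ?exprn_ge0 ?invr_ge0 ?(ltW sn0).
  - by move=> k; have := gb k; rewrite /t mulrA.
  - move=> x xc; apply: contra_neqP => xB.
    apply: (gz (block l (grid_index L M x)) _ _ erefl) => k kx.
    by apply/eqP/negPn/negP => uk; apply: xB; exact: near uk xc (esym kx).
have tot := findecD gf gf2.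
apply: findec_ae; last apply: findec_le tot.
  by apply: aeW => x; rewrite -rmorphD /= /step -mulrDl subrK.
rewrite /grid_cst [leRHS]addrC -[leLHS]addr0; apply: lerD; last first.
  by rewrite !mulr_ge0 ?exprn_ge0 ?(ltW b0).
rewrite lerD2r /cz_cst /jensen_cst.
have SW : h ^+ n * \sum_k W k <= vol c r `^ (1 - p).
  have api : mu.-integrable setT (EFin \o (fun x => `|a x| `^ p)).
    apply/integrable_normP.
      by apply: (measurableT_comp (measurable_powR p)); apply: measurableT_comp.
    rewrite (_ : (fun x => _) = (fun x => (`|a x| `^ p)%:E))//.
    by apply/funext => x; rewrite ger0_norm ?powR_ge0.
  rewrite sum_grid_avg// -lee_fin /Rintegral fineK//.
  by rewrite ge0_fin_numE ?int_normp_ge0.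
have v0 := vol_gt0 c r0.
(* Overlap factor times volume of a block is at most [(10 * r) ^+ n], which is comparable with the
   volume of the ball: hence a constant free of [L], [M] and [r]. *)
have mv : m * s ^+ n / vol c r <= (5 * n%:R) ^+ n.
  rewrite ler_pdivrMr//; apply: le_trans (vol_ge10 c r0).
  rewrite /m -exprMn; apply: lerXn2r.
  - by rewrite nnegrE mulr_ge0 ?(ltW rL0) ?(ltW s0).
  - by rewrite nnegrE mulr_ge0 ?(ltW r0).
  have sL : s <= 2 * L by rewrite /s -meshS// mesh_le.
  exact: overlap_bound.
(* All factors of the cost of the selected cubes that depend on the scale; the 2 in [t] cancels the
   2 in [2 * m]. *)
have E : (2 * m) `^ (p - 1) * (t `^ (1 - p) * vol c r `^ (1 - p)) =
    (m * s ^+ n / vol c r) `^ (p - 1).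
  have tv0 : 0 <= t * vol c r by rewrite mulr_ge0 ?(ltW t0) ?(ltW v0).
  have E1 : 1 - p = -1 * (p - 1) by ring.
  rewrite -powRM ?(ltW t0) ?(ltW v0)// E1 powRrM (powR_inv1 tv0) -powRM ?invr_ge0 ?mulr_ge0 ?invr_ge0 ?(ltW m0) ?(ltW sn0) ?(ltW v0)//.
  by congr (_ `^ _); rewrite /t; field; rewrite !gt_eqF.
rewrite -mulr_sumr.
have p10 : 0 <= p - 1 by rewrite subr_ge0 ltW.
have KK : (m * s ^+ n / vol c r) `^ (p - 1) <= ((5 * n%:R) ^+ n) `^ (p - 1).
  apply: ge0_ler_powR => //; rewrite nnegrE ?exprn_ge0 ?mulr_ge0 ?invr_ge0 ?(ltW v0) ?(ltW m0) ?(ltW sn0)//.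
apply: (@le_trans _ _ ((2 ^+ n * stop_cst p + 1) * ball_cst (R:=R) (n:=n) * 2 *
   ((2 * m) `^ (p - 1) * (t `^ (1 - p) * (h ^+ n * \sum_k W k))))).
  by rewrite le_eqVlt; apply/orP; left; apply/eqP; ring.
apply: ler_wpM2l; first by rewrite !mulr_ge0 ?addr_ge0 ?mulr_ge0 ?exprn_ge0 ?(ltW b0).
apply: le_trans KK; rewrite -E; apply: ler_wpM2l; first by rewrite powR_ge0.
by apply: ler_wpM2l; first by rewrite powR_ge0.
Qed.

End grid_avg_atoms.

(** * Density of step functions *)

Section dyadic_density.
Import HBNNSimple.
Context {R : realType} {n : nat}.
Variable L : R.
Hypothesis L0 : 0 < L.
Local Notation V := 'rV[R]_n.
Local Notation mu := (@lebesgue_rV R n).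
Local Notation grid M := {ffun 'I_n -> 'I_(2 ^ M)}.

(** The remainder only provides the bound required by the type: for [M <= M'] the quotient is
    already smaller than [2 ^ M]. *)
Definition coarsen M M' (k : grid M') : grid M :=
  [ffun i => Ordinal (ltn_pmod (k i %/ 2 ^ (M' - M)) (expn_gt0 2 M))].

Lemma coarsen_index M M' (x : V) : (M <= M')%N ->
  coarsen M (grid_index L M' x) = grid_index L M x.
Proof.
move=> MM; apply/ffunP => i; apply/val_inj; rewrite !ffunE /=.
by rewrite index_nat_div// ?leq_subr// subKn// modn_small// index_nat_lt.
Qed.

Definition dyadic M (P : pred (grid M)) : set V := [set x | P (grid_index L M x)].

Lemma measurable_dyadic M (P : pred (grid M)) : measurable (dyadic P).
Proof.
rewrite (_ : dyadic P = \bigcup_(k in [set k | P k]) fibre L k).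
  by apply: fin_bigcup_measurable => // k _; exact: measurable_fibre.
by apply/seteqP; split=> [x Px|x [k Pk xk]]; [exists (grid_index L M x)|rewrite /dyadic /= xk].
Qed.

Lemma dyadic_refine M M' (P : pred (grid M)) : (M <= M')%N ->
  dyadic P = dyadic (fun k : grid M' => P (coarsen M k)).
Proof. by move=> MM; apply/seteqP; split => x; rewrite /dyadic /= coarsen_index. Qed.

Definition dyadic_approx (A : set V) : Prop := measurable A /\
  forall e : R, 0 < e -> exists M (P : pred (grid M)), (mu (cube L `&` (A `+` dyadic P)) <= e%:E)%E.

Lemma mu_cube_fin : (mu (cube L) < +oo)%E.
Proof.
apply: (@le_lt_trans _ _ (mu (box 0 L))); last by rewrite measure_box ?ltry// ltW.
by apply: le_measure; rewrite ?inE; [exact: measurable_cube|exact: measurable_box|exact: cube_sub_box].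
Qed.

Lemma mu_cubeI_le (A B : set V) : measurable A -> measurable B -> A `<=` B ->
  (mu (cube L `&` A) <= mu (cube L `&` B))%E.
Proof.
move=> mA mB AB; apply: le_measure; rewrite ?inE; last exact: setIS.
- by apply: measurableI => //; exact: measurable_cube.
- by apply: measurableI => //; exact: measurable_cube.
Qed.

Lemma mu_cubeIU_le (A B C : set V) : measurable A -> measurable B -> measurable C ->
  A `<=` B `|` C -> (mu (cube L `&` A) <= mu (cube L `&` B) + mu (cube L `&` C))%E.
Proof.
move=> mA mB mC ABC; have mc := @measurable_cube R n L.
apply: (le_trans (mu_cubeI_le mA (measurableU _ _ mB mC) ABC)).
by rewrite setIUr; apply: measureU2; apply: measurableI.
Qed.

Lemma measurable_symdiff (A B : set V) : measurable A -> measurable B -> measurable (A `+` B).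
Proof. by move=> mA mB; rewrite setY_def; apply: measurableU; apply: measurableD. Qed.

Lemma dyadic_approx_dyadic M (P : pred (grid M)) : dyadic_approx (dyadic P).
Proof.
split; first exact: measurable_dyadic.
by move=> e e0; exists M, P; rewrite setYK setI0 measure0 lee_fin ltW.
Qed.

Lemma dyadic_approxC A : dyadic_approx A -> dyadic_approx (~` A).
Proof.
move=> [mA aA]; split; first exact: measurableC.
move=> e /aA [M [P AP]]; exists M, (fun k => ~~ P k).
rewrite (_ : _ `+` _ = A `+` dyadic P)// !setY_def.
have -> : dyadic (fun k => ~~ P k) = ~` dyadic P.
  by apply/seteqP; split => x /negP.
by rewrite !setDE !setCK setUC [X in X `|` _]setIC [X in _ `|` X]setIC.
Qed.

Lemma dyadic_approxU A B : dyadic_approx A -> dyadic_approx B -> dyadic_approx (A `|` B).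
Proof.
move=> [mA aA] [mB aB]; split; first exact: measurableU.
move=> e e0; have e20 : 0 < e / 2 by rewrite divr_gt0.
have [M1 [P1 AP]] := aA _ e20; have [M2 [P2 BP]] := aB _ e20.
pose M := maxn M1 M2.
exists M, (fun k => P1 (coarsen M1 k) || P2 (coarsen M2 k)).
have -> : dyadic (fun k : grid M => P1 (coarsen M1 k) || P2 (coarsen M2 k)) = dyadic P1 `|` dyadic P2.
  rewrite (dyadic_refine P1 (leq_maxl M1 M2)) (dyadic_refine P2 (leq_maxr M1 M2)).
  by apply/seteqP; split => x /=; rewrite /dyadic /= => /orP.
apply: (@le_trans _ _ (mu (cube L `&` (A `+` dyadic P1)) + mu (cube L `&` (B `+` dyadic P2)))%E).
  have m1 := measurable_dyadic P1; have m2 := measurable_dyadic P2.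
  apply: mu_cubeIU_le; try (apply: measurable_symdiff => //; exact: measurableU).
  rewrite !setY_def => x /=; tauto.
by rewrite [e]splitr EFinD; exact: leeD.
Qed.

(** Continuity from below of the measure, finite on the cube: some [A N] fills the union up to
    [e / 2], and an approximation of [A N] serves for the union. *)
Lemma dyadic_approx_lim (A : (set V)^nat) : {homo A : i j / (i <= j)%N >-> (i <= j)%O} ->
  (forall i, dyadic_approx (A i)) -> dyadic_approx (\bigcup_i A i).
Proof.
move=> Ah aA; have mA i : measurable (A i) by case: (aA i).
have mc := @measurable_cube R n L.
have mU : measurable (\bigcup_i A i) by exact: bigcup_measurable.
split=> // e e0; have e20 : 0 < e / 2 by rewrite divr_gt0.
have lim : (mu \o (fun i => cube L `&` A i)) i @[i --> \oo] --> mu (cube L `&` \bigcup_i A i).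
  rewrite setI_bigcupr; apply: nondecreasing_cvg_mu.
  - by move=> i; exact: measurableI.
  - by apply: bigcup_measurable => i _; exact: measurableI.
  - by move=> i j ij; apply/subsetPset; apply: setIS; apply/subsetPset; exact: Ah.
have fin B : measurable B -> mu (cube L `&` B) \is a fin_num.
  move=> mB; rewrite ge0_fin_numE ?measure_ge0//; apply: le_lt_trans mu_cube_fin.
  by apply: le_measure; rewrite ?inE//; exact: measurableI.
have [N NE] : exists N, (mu (cube L `&` (\bigcup_i A i `\` A N)) <= (e / 2)%:E)%E.
  move: lim; rewrite -(fineK (fin _ mU)) => /fine_cvgP[_ /cvgrPdist_le /(_ _ e20)] [N _ /(_ N (leqnn N))] /= NE.
  exists N.
  have -> : cube L `&` (\bigcup_i A i `\` A N) = (cube L `&` \bigcup_i A i) `\` (cube L `&` A N).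
    by apply/seteqP; split => x /=; tauto.
  have mI1 : measurable (cube L `&` \bigcup_i A i) by exact: measurableI.
  have mI2 : measurable (cube L `&` A N) by exact: measurableI.
  rewrite measureD//; last by rewrite -ge0_fin_numE ?fin// measure_ge0.
  rewrite (_ : (cube L `&` \bigcup_i A i) `&` (cube L `&` A N) = cube L `&` A N); last first.
    apply/seteqP; split => x /=; first tauto.
    by move=> [xc xA]; do !split => //; exists N.
  rewrite -[X in (X - _ <= _)%E](fineK (fin _ mU)) -[X in (_ - X <= _)%E](fineK (fin _ (mA N))) -EFinB lee_fin.
  exact: le_trans (ler_norm _) NE.
have [M [P NP]] := (aA N).2 _ e20.
have mP := measurable_dyadic P.
exists M, P; apply: (@le_trans _ _ (mu (cube L `&` (\bigcup_i A i `\` A N)) +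
    mu (cube L `&` (A N `+` dyadic P)))%E).
  apply: mu_cubeIU_le; try exact: measurable_symdiff.
    exact: measurableD.
  rewrite !setY_def => x /= [[xA xP]|[xP xA]].
    by have [xN|xN] := pselect (A N x); [right; left|left].
  by right; right; split => // xN; apply: xA; exists N.
by rewrite [e]splitr EFinD; exact: leeD.
Qed.

Lemma dyadic_approx_ext (A B : set V) : measurable B -> cube L `&` A = cube L `&` B ->
  dyadic_approx A -> dyadic_approx B.
Proof.
move=> mB AB [mA aA]; split=> // e /aA [M [P AP]]; exists M, P.
rewrite (_ : cube L `&` (B `+` dyadic P) = cube L `&` (A `+` dyadic P))//.
rewrite !setY_def; apply/seteqP; split => x [xc xAP]; split=> //;
  have : (cube L `&` A) x <-> (cube L `&` B) x by rewrite AB.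
- by move: xAP; rewrite /=; tauto.
- by move: xAP; rewrite /=; tauto.
Qed.

Lemma dyadic_approx_open (U : set V) : open U -> dyadic_approx U.
Proof.
move=> oU.
(* A cell is accepted when its part in the cube lies in [U]. The rest of its fibre may leave [U], so
   the union of the accepted fibres agrees with [U] only in the cube, which is what
   [dyadic_approx_ext] asks for. *)
pose P M (k : grid M) := `[< forall y, cube L y -> grid_index L M y = k -> U y >].
have mU : measurable U by exact: sub_sigma_algebra.
apply: (@dyadic_approx_ext (\bigcup_M (dyadic (@P M)))) => //.
  apply/seteqP; split => [x [xc [M _ /asboolP Px]]|x [xc Ux]].
    by split => //; exact: Px.
  split=> //.
  have /nbhs_ballP[e /= e0 eU] : nbhs x U by exact: open_nbhs_nbhs.
  have [N Ne] : exists N, mesh L N < e.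
    have [N NE] : exists N : nat, 2 * L / e < N%:R.
      by exists (Num.truncn (2 * L / e)).+1; exact: truncnS_gt.
    exists N; rewrite /mesh ltr_pdivrMr ?exprn_gt0// [ltRHS]mulrC -ltr_pdivrMr//.
    by apply: (lt_le_trans NE); rewrite -natrX ler_nat ltnW// ltn_expl.
  exists N => //; apply/asboolP => y yc yx; apply: eU; split=> // i j.
  rewrite (ord1 i) /ball /=; apply: le_lt_trans Ne.
  rewrite -[leRHS]mul1r -(expr0 2); apply: (block_dist L0 _ _ xc yc) => //.
  by rewrite yx.
apply: dyadic_approx_lim => [|M]; last exact: dyadic_approx_dyadic.
apply/nondecreasing_seqP => M; apply/subsetPset => x /asboolP Px.
apply/asboolP => y yc yx; apply: Px => //.
by rewrite -!(coarsen_index _ (leqnSn M)) yx.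
Qed.

Lemma dyadic_approx_measurable (A : set V) : measurable A -> dyadic_approx A.
Proof.
apply: smallest_sub A; last by move=> U; exact: dyadic_approx_open.
have a0 : dyadic_approx set0.
  split=> // e e0; exists 0%N, pred0.
  by rewrite (_ : dyadic _ = set0) ?setYK ?setI0 ?measure0 ?lee_fin ?ltW//; apply/seteqP; split.
split=> //.
- by move=> A; rewrite setTD; exact: dyadic_approxC.
(* A countable union is the increasing limit of finite unions, so closure under these two operations
   is enough for a sigma-algebra. *)
- move=> A aA; rewrite (_ : \bigcup_k A k = \bigcup_k \big[setU/set0]_(i < k) A i).
    apply: dyadic_approx_lim.
      apply/nondecreasing_seqP => N; apply/subsetPset; rewrite big_ord_recr /=; exact: subsetUl.
    elim => [|N ih]; first by rewrite big_ord0.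
    by rewrite big_ord_recr; exact: dyadic_approxU.
  apply/seteqP; split => x [k _ xk].
    by exists k.+1 => //; rewrite big_ord_recr; right.
  by move: xk; rewrite -bigcup_mkord => -[i _ xi]; exists i.
Qed.

(** * Density of step functions in L^q of the cube *)

Variable q : R.
Hypothesis q1 : 1 < q.

Let q0 : 0 < q. Proof. by apply: lt_trans q1. Qed.

Definition step_approx (f : V -> R) : Prop := measurable_fun setT f /\
  forall e : R, 0 < e -> exists M (u : grid M -> R),
    (\int[mu]_x (`|f x * \1_(cube L) x - step L u x| `^ q)%:E <= e%:E)%E.

(** A quasi-triangle inequality with constant [2 ^ q], enough for density arguments in place of
    Minkowski's inequality. *)
Lemma int_normpD_le (f g : V -> R) : measurable_fun setT f -> measurable_fun setT g ->
  (\int[mu]_x (`|f x + g x| `^ q)%:E <= (2 `^ q)%:E *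
     (\int[mu]_x (`|f x| `^ q)%:E + \int[mu]_x (`|g x| `^ q)%:E))%E.
Proof.
move=> mf mg; rewrite -ge0_integralD//; try exact: measurable_normp.
rewrite -ge0_integralZl//; last 2 first.
- by apply: emeasurable_funD; exact: measurable_normp.
- by move=> x _; rewrite -EFinD lee_fin addr_ge0 ?powR_ge0.
apply: ge0_le_integral => //.
- by apply: measurable_normp; exact: measurable_funD.
- by apply: emeasurable_funM => //; apply: emeasurable_funD; exact: measurable_normp.
- move=> x _; rewrite -EFinD -EFinM lee_fin.
  apply: le_trans (powRD_le q0 (normr_ge0 _) (normr_ge0 _)).
  by apply: ge0_ler_powR; rewrite ?nnegrE ?addr_ge0 ?(ltW q0)// ler_normD.
Qed.

Lemma int_normpZ (k : R) (f : V -> R) : measurable_fun setT f ->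
  (\int[mu]_x (`|k * f x| `^ q)%:E = (`|k| `^ q)%:E * \int[mu]_x (`|f x| `^ q)%:E)%E.
Proof.
move=> mf; under eq_integral do rewrite normrM powRM// EFinM.
by rewrite ge0_integralZl//; (exact: measurable_normp || rewrite lee_fin powR_ge0).
Qed.

Lemma step_refine M M' (u : grid M -> R) (x : V) : (M <= M')%N ->
  step L u x = step L (fun k : grid M' => u (coarsen M k)) x.
Proof. by move=> MM; rewrite /step coarsen_index. Qed.

Lemma step_approx_indic (A : set V) : measurable A -> step_approx \1_A.
Proof.
move=> mA; split; first exact: measurable_indic.
move=> e e0; have [_ /(_ e e0) [M [P PA]]] := dyadic_approx_measurable mA.
exists M, (fun k => (P k)%:R); apply: le_trans PA.
have mP := measurable_dyadic P; have mS := measurable_symdiff mA mP.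
have mc := @measurable_cube R n L.
have mI : measurable (cube L `&` (A `+` dyadic P)) by exact: measurableI.
have -> : (mu (cube L `&` (A `+` dyadic P)) =
    \int[mu]_x (\1_(cube L `&` (A `+` dyadic P)) x)%:E)%E by rewrite integral_indic ?setIT.
rewrite le_eqVlt; apply/orP; left; apply/eqP; apply: eq_integral => x _.
congr (_%:E); rewrite /step !indicE; have [xc|xc] := pselect (cube L x); last first.
  rewrite !(memNset xc) !mulr0 subr0 normr0 powR0 ?gt_eqF// memNset//; by case.
rewrite !(mem_set xc) !mulr1.
have -> : (x \in cube L `&` (A `+` dyadic P)) = ((x \in A) != P (grid_index L M x)).
  rewrite setY_def; case: (pselect (A x)) => xA; case/boolP : (P _) => xP;
    rewrite ?(mem_set xA) ?(memNset xA) /=.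
  - by apply: memNset => -[_ [[_ /(_ xP)]|[_ /(_ xA)]]].
  - by apply: mem_set; split=> //; left; split=> //; exact/negP.
  - by apply: mem_set; split=> //; right.
  - by apply: memNset => -[_ [[/xA]|[/(negP xP)]]].
case: (x \in A); case: (P _) => /=; rewrite ?subrr ?subr0 ?sub0r ?normrN ?normr0 ?normr1 ?powR0 ?powR1 ?gt_eqF//.
Qed.

Lemma step_approxD f g : step_approx f -> step_approx g -> step_approx (fun x => f x + g x).
Proof.
move=> [mf af] [mg ag]; split; first exact: measurable_funD.
move=> e e0; pose d := e / (2 `^ q * 2).
have d0 : 0 < d by rewrite divr_gt0// mulr_gt0// powR_gt0.
have [M1 [u1 fu]] := af _ d0; have [M2 [u2 gu]] := ag _ d0.
exists (maxn M1 M2), (fun k => u1 (coarsen M1 k) + u2 (coarsen M2 k)).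
have mc := @measurable_cube R n L.
have mi (F : V -> R) M (u : grid M -> R) : measurable_fun setT F ->
    measurable_fun setT (fun x => F x * \1_(cube L) x - step L u x).
  move=> mF; apply: measurable_funB; last exact: measurable_step.
  by apply: measurable_funM => //; exact: measurable_indic.
have -> : (fun x => (`|(f x + g x) * \1_(cube L) x - step L (fun k : grid (maxn M1 M2) =>
    u1 (coarsen M1 k) + u2 (coarsen M2 k)) x| `^ q)%:E) =
    (fun x => (`|(f x * \1_(cube L) x - step L u1 x) + (g x * \1_(cube L) x - step L u2 x)| `^ q)%:E).
  apply/funext => x; rewrite -stepD -!step_refine ?leq_maxl ?leq_maxr//.
  by congr ((`|_| `^ _)%:E); ring.
apply: (le_trans (int_normpD_le (mi _ _ u1 mf) (mi _ _ u2 mg))).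
apply: (@le_trans _ _ ((2 `^ q)%:E * (d%:E + d%:E))%E).
  by apply: lee_wpmul2l; [rewrite lee_fin powR_ge0|exact: leeD fu gu].
rewrite -EFinD -EFinM lee_fin /d le_eqVlt; apply/orP; left; apply/eqP.
by field; rewrite gt_eqF ?powR_gt0.
Qed.

Lemma step_approxZ (k : R) f : step_approx f -> step_approx (fun x => k * f x).
Proof.
move=> [mf af]; split; first exact: measurable_funM.
move=> e e0; pose d := e / (`|k| `^ q + 1).
have k0 : 0 < `|k| `^ q + 1 by rewrite ltr_wpDl ?powR_ge0.
have d0 : 0 < d by rewrite divr_gt0.
have [M [u fu]] := af _ d0; exists M, (fun j => k * u j).
have mc := @measurable_cube R n L.
have -> : (fun x => (`|k * f x * \1_(cube L) x - step L (fun j => k * u j) x| `^ q)%:E) =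
    (fun x => (`|k * (f x * \1_(cube L) x - step L u x)| `^ q)%:E).
  by apply/funext => x; congr ((`|_| `^ _)%:E); rewrite /step; ring.
rewrite int_normpZ; last first.
  apply: measurable_funB; last exact: measurable_step.
  by apply: measurable_funM => //; exact: measurable_indic.
apply: (@le_trans _ _ ((`|k| `^ q)%:E * d%:E)%E).
  by rewrite lee_wpmul2l ?lee_fin ?powR_ge0.
rewrite -EFinM lee_fin /d mulrCA ler_piMr ?(ltW e0)//.
by rewrite ler_pdivrMr// mul1r lerDl.
Qed.

Lemma step_approx0 : step_approx (fun=> 0).
Proof.
have := step_approxZ 0 (step_approx_indic measurableT).
by under eq_fun do rewrite mul0r.
Qed.

Lemma step_approx_nnsfun (f : {nnsfun V >-> R}) : step_approx f.
Proof.
rewrite (_ : (f : V -> R) = fun x => \sum_(y <- finmap.enum_fset (fset_set (range f)))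
    y * \1_(f @^-1` [set y]) x); last first.
  by apply/funext => x; rewrite fimfunE fsbig_finite.
elim: (finmap.enum_fset _) => [|y s ih].
  by under eq_fun do rewrite big_nil; exact: step_approx0.
under eq_fun do rewrite big_cons; apply: step_approxD; last exact: ih.
by apply: step_approxZ; apply: step_approx_indic.
Qed.

Lemma step_approx_lim (f : V -> R) (g : (V -> R)^nat) : measurable_fun setT f ->
  (forall k, step_approx (g k)) ->
  (forall e : R, 0 < e -> exists k, (\int[mu]_x (`|f x - g k x| `^ q)%:E <= e%:E)%E) ->
  step_approx f.
Proof.
move=> mf ag fg; split=> // e e0; pose d := e / (2 `^ q * 2).
have d0 : 0 < d by rewrite divr_gt0// mulr_gt0// powR_gt0.
have [k fk] := fg _ d0; have [mg /(_ _ d0) [M [u gu]]] := ag k.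
have mc := @measurable_cube R n L.
exists M, u.
have mi : measurable_fun setT (fun x => g k x * \1_(cube L) x - step L u x).
  apply: measurable_funB; last exact: measurable_step.
  by apply: measurable_funM => //; exact: measurable_indic.
have mfg : measurable_fun setT (fun x => (f x - g k x) * \1_(cube L) x).
  by apply: measurable_funM; [exact: measurable_funB|exact: measurable_indic].
have -> : (fun x => (`|f x * \1_(cube L) x - step L u x| `^ q)%:E) =
    (fun x => (`|(f x - g k x) * \1_(cube L) x + (g k x * \1_(cube L) x - step L u x)| `^ q)%:E).
  by apply/funext => x; congr ((`|_| `^ _)%:E); ring.
apply: (le_trans (int_normpD_le mfg mi)).
apply: (@le_trans _ _ ((2 `^ q)%:E * (d%:E + d%:E))%E).
  apply: lee_wpmul2l; first by rewrite lee_fin powR_ge0.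
  apply: leeD; last exact: gu.
  apply: le_trans fk.
  apply: ge0_le_integral => //; try apply: measurable_normp => //.
    exact: measurable_funB.
  move=> x _; rewrite lee_fin; apply: ge0_ler_powR; rewrite ?nnegrE ?(ltW q0)//.
  rewrite normrM ler_piMr// indicE; case: (_ \in _); by rewrite ?normr1 ?normr0.
rewrite -EFinD -EFinM lee_fin /d le_eqVlt; apply/orP; left; apply/eqP.
by field; rewrite gt_eqF ?powR_gt0.
Qed.

(** Simple functions increase to [f], and |f|^q dominates the [q]-th powers of the errors. *)
Lemma step_approx_ge0 (f : V -> R) : measurable_fun setT f -> (forall x, 0 <= f x) ->
  (\int[mu]_x (`|f x| `^ q)%:E < +oo)%E -> step_approx f.
Proof.
move=> mf f0 foo.
have mfE : measurable_fun setT (EFin \o f) by exact/measurable_EFinP.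
pose g k := nnsfun_approx measurableT mfE k.
apply: (step_approx_lim (g := fun k => g k)) => // [k|e e0]; first exact: step_approx_nnsfun.
have gf x : (EFin \o (g^~ x)) k @[k --> \oo] --> (f x)%:E.
  by apply: cvg_nnsfun_approx => // y _; rewrite lee_fin.
have gf' x : g k x @[k --> \oo] --> f x by exact: (fine_cvg (gf x)).
have gle k x : g k x <= f x.
  have nd : {homo (fun j => g j x) : i j / (i <= j)%N >-> i <= j}.
    by move=> i j ij; have /lefP := nd_nnsfun_approx measurableT mfE ij; apply.
  rewrite -(cvg_lim _ (gf' x))//; apply: nondecreasing_cvgn_le => //.
  by apply: cvgP (gf' x).
have mi k : measurable_fun setT (fun x => f x - g k x) by exact: measurable_funB.
have h x : `|f x - g k x| `^ q @[k --> \oo] --> (0 : R).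
  apply/cvgrPdist_le => d d0.
  have dq0 : 0 < d `^ q^-1 by rewrite powR_gt0.
  have /cvgrPdist_le/(_ _ dq0) := gf' x; apply: filterS => k fk.
  rewrite sub0r normrN ger0_norm ?powR_ge0// -[leRHS](powRr1 (ltW d0)) -[X in d `^ X](mulVf (lt0r_neq0 q0)) powRrM.
  by apply: ge0_ler_powR; rewrite ?nnegrE ?powR_ge0 ?(ltW q0).
have [|||_ + _] := @dominated_convergence _ _ _ mu setT measurableT
  (fun k x => (`|f x - g k x| `^ q)%:E) (cst 0%E) (fun x => (`|f x| `^ q)%:E)
  (fun k => @measurable_normp R n setT _ q (mi k)) (measurable_cst _).
- by apply: aeW => x _; apply: cvg_EFin; [exact: nearW|exact: h].
- apply/integrableP; split; first exact: measurable_normp.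
  by under eq_integral do rewrite gee0_abs ?lee_fin ?powR_ge0//.
- apply: aeW => x k _; rewrite gee0_abs ?lee_fin ?powR_ge0//.
  apply: ge0_ler_powR; rewrite ?nnegrE ?(ltW q0)//.
  by rewrite !ger0_norm ?subr_ge0// lerBlDr lerDl.
move=> /fine_cvgP[fn /cvgrPdist_le/(_ _ e0) ce].
near \oo => k; exists k.
have -> : (\int[mu]_x (`|f x - g k x| `^ q)%:E =
  \int[mu]_x `|(`|f x - g k x| `^ q)%:E - cst 0%E x|)%E.
  by apply: eq_integral => x _; rewrite /cst sube0 gee0_abs// lee_fin powR_ge0.
have kfin : (\int[mu]_x `|(`|f x - g k x| `^ q)%:E - cst 0%E x|)%E \is a fin_num by near: k.
rewrite -(fineK kfin) lee_fin; apply: (le_trans (ler_norm _)).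
by rewrite -normrN -sub0r; near: k.
Unshelve. all: end_near. Qed.

Lemma step_approx_Lq (f : V -> R) : measurable_fun setT f ->
  (\int[mu]_x (`|f x| `^ q)%:E < +oo)%E -> step_approx f.
Proof.
move=> mf foo.
have part (s : R -> R) : measurable_fun setT s -> (forall y, 0 <= s y <= `|y|) ->
    step_approx (fun x => s (f x)).
  move=> ms sy; apply: step_approx_ge0; first exact: measurableT_comp.
    by move=> x; case/andP: (sy (f x)).
  apply: le_lt_trans foo; apply: ge0_le_integral => //; try exact: measurable_normp.
    by apply: measurable_normp; exact: measurableT_comp.
  move=> x _; have /andP[s0 s1] := sy (f x).
  by rewrite lee_fin ger0_norm//; apply: ge0_ler_powR; rewrite ?nnegrE ?(ltW q0).
have pp : step_approx (fun x => Num.max (f x) 0).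
  apply: (part (fun y => Num.max y 0)) => [|y].
    by apply: measurable_maxr => //; exact: measurable_cst.
  by rewrite le_max lexx orbT ge_max ler_norm normr_ge0.
have nn : step_approx (fun x => Num.max (- f x) 0).
  apply: (part (fun y => Num.max (- y) 0)) => [|y].
    apply: measurable_maxr; last exact: measurable_cst.
    by apply: continuous_measurable_fun; exact: opp_continuous.
  by rewrite le_max lexx orbT ge_max normr_ge0 -normrN ler_norm.
have := step_approxD pp (step_approxZ (- 1) nn).
rewrite (_ : (fun x => _) = f)//; apply/funext => x.
case: (ler0P (f x)) => fx.
  by rewrite (max_l (_ : 0 <= - f x)) ?oppr_ge0//; ring.
by rewrite (max_r (_ : - f x <= 0)) ?oppr_le0 ?(ltW fx)//; ring.
Qed.

(** Boundedness of averaging on L^q, uniform in the grid. The constant comes from the weak Young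
    inequality and from a crude overlap count; only its independence of [M] matters. *)
Lemma grid_avg_contract (g : V -> R) M : measurable_fun setT g ->
  {ae mu, forall x, ~ cube L x -> g x = 0} -> (\int[mu]_x (`|g x| `^ q)%:E < +oo)%E ->
  (\int[mu]_x (`|step L (grid_avg (M := M) L g) x| `^ q)%:E <=
    ((2 * 5 ^+ n) `^ q)%:E * \int[mu]_x (`|g x| `^ q)%:E)%E.
Proof.
move=> mg g0 goo; have mc := @measurable_cube R n L.
have gi := integrable_pow mc mu_cube_fin mg q1 g0 goo.
have hn0 := @meshn_gt0 R n L M L0.
pose W := grid_avg (M := M) L (fun x => `|g x| `^ q).
have uW k : `|grid_avg (M := M) L g k| `^ q <= (2 * 5 ^+ n) `^ q * W k.
  set u := `|grid_avg _ _ _|; have u0 : 0 <= u by exact: normr_ge0.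
  have W0 : 0 <= W k.
    by rewrite mulr_ge0 ?invr_ge0 ?(ltW hn0)//; apply: Rintegral_ge0 => x _; rewrite powR_ge0.
  move: u0; rewrite le_eqVlt => /predU1P[<-|u0].
    by rewrite powR0 ?gt_eqF// mulr_ge0// powR_ge0.
  have c0 : 0 < 2 * 5 ^+ n :> R by rewrite mulr_gt0// exprn_gt0.
  (* For radius [L] the overlap factor is [(1 + 4) ^+ n], so this threshold makes the first term of
     Young's inequality equal to [u / 2], which is absorbed. *)
  pose t := u / (2 * 5 ^+ n); have t0 : 0 < t by rewrite divr_gt0.
  have := grid_avg_young L0 gi (ltW L0) q1 t0 mc (@cube_sub_box R n L) g0 goo k.
  rewrite -/u -/W divff ?gt_eqF//.
  have -> : t * (1 + 4) ^+ n = u / 2.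
    rewrite (_ : 1 + 4 = 5); last by ring.
    by rewrite /t; field; rewrite expf_neq0.
  move=> uu.
  have uu' : u / 2 <= t `^ (1 - q) * W k by lra.
  have -> : u `^ q = t `^ q * (2 * 5 ^+ n) `^ q.
    by rewrite -powRM ?(ltW t0) ?(ltW c0)// /t divfK// gt_eqF.
  rewrite mulrC ler_pM2l ?powR_gt0// -(mulr_powRB1 (ltW t0) q0).
  apply: (@le_trans _ _ (u / 2 * t `^ (q - 1))).
    rewrite ler_wpM2r ?powR_ge0// /t ler_wpM2l ?(ltW u0)// lef_pV2 ?posrE//.
    by rewrite ler_peMr// exprn_ege1// ler1n.
  apply: (le_trans (ler_wpM2r (powR_ge0 _ _) uu')).
  rewrite mulrAC -powRD ?(lt0r_neq0 t0) ?implybT//.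
  by rewrite (_ : 1 - q + (q - 1) = 0) ?powRr0 ?mul1r//; ring.
rewrite (@integral_step _ _ _ _ L0 (fun y => `|y| `^ q)); last 2 first.
- by rewrite normr0 powR0// gt_eqF.
- exact: (measurableT_comp (measurable_powR q)).
have gqi : mu.-integrable setT (EFin \o (fun x => `|g x| `^ q)).
  apply/integrable_normP.
    by apply: (measurableT_comp (measurable_powR q)); apply: measurableT_comp.
  rewrite (_ : (fun x => _) = (fun x => (`|g x| `^ q)%:E))//.
  by apply/funext => x; rewrite ger0_norm ?powR_ge0.
have -> : (\int[mu]_x (`|g x| `^ q)%:E = (\int[mu]_x (`|g x| `^ q))%:E)%E.
  by rewrite /Rintegral fineK// ge0_fin_numE ?int_normp_ge0.
rewrite -(@sum_grid_avg _ _ L M L0)// -EFinM lee_fin mulrCA ler_pM2l// mulr_sumr.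
by apply: ler_sum => k _; exact: uW.
Qed.

(** Averaging fixes the step functions of its own grid. If [g] is the error of a good step function,
    the residual of [f] is therefore that of [g], and both terms of the latter are small in L^q. *)
Lemma grid_avg_density (f : V -> R) (e : R) : measurable_fun setT f ->
  {ae mu, forall x, ~ cube L x -> f x = 0} -> (\int[mu]_x (`|f x| `^ q)%:E < +oo)%E ->
  0 < e -> exists M, (\int[mu]_x (`|f x - step L (grid_avg (M := M) L f) x| `^ q)%:E <= e%:E)%E.
Proof.
move=> mf f0 foo e0; have [_ af] := step_approx_Lq mf foo.
have mc := @measurable_cube R n L.
have fi := integrable_pow mc mu_cube_fin mf q1 f0 foo.
pose K := 2 `^ q * (1 + (2 * 5 ^+ n) `^ q) : R.
have K0 : 0 < K by rewrite mulr_gt0 ?powR_gt0// ltr_pwDl// powR_ge0.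
have d0 : 0 < e / K by rewrite divr_gt0.
have [M [u fu]] := af _ d0; exists M.
pose g x := f x - step L u x.
have mg : measurable_fun setT g by apply: measurable_funB => //; exact: measurable_step.
have fE : {ae mu, forall x, f x * \1_(cube L) x = f x}.
  move: f0; apply: filterS => x fx; rewrite indicE; case: (asboolP (cube L x)) => xc.
    by rewrite mem_set// mulr1.
  by rewrite fx ?mul0r.
have gu : (\int[mu]_x (`|g x| `^ q)%:E <= (e / K)%:E)%E.
  apply: le_trans fu; rewrite le_eqVlt; apply/orP; left; apply/eqP.
  apply: ge0_ae_eq_integral => //; try exact: measurable_normp.
  - apply: measurable_normp; apply: measurable_funB; last exact: measurable_step.
    by apply: measurable_funM => //; exact: measurable_indic.
  by move: fE; apply: filterS => x -> _.
have g0 : {ae mu, forall x, ~ cube L x -> g x = 0}.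
  by move: f0; apply: filterS => x fx xc; rewrite /g fx// step_out// subrr.
have goo : (\int[mu]_x (`|g x| `^ q)%:E < +oo)%E by apply: le_lt_trans gu _; rewrite ltry.
have avgE k : grid_avg (M := M) L f k = grid_avg L g k + u k.
  rewrite -[u k](grid_avg_step L0) -grid_avgD//.
  - by congr (grid_avg L _ k); apply/funext => x; rewrite /g subrK.
  - exact: integrable_pow mc mu_cube_fin mg q1 g0 goo.
  - exact: integrable_step.
have -> : (fun x => (`|f x - step L (grid_avg (M := M) L f) x| `^ q)%:E) =
    (fun x => (`|g x + (- 1) * step L (grid_avg (M := M) L g) x| `^ q)%:E).
  apply/funext => x; congr ((`|_| `^ _)%:E).
  rewrite (_ : grid_avg L f = fun k => grid_avg L g k + u k); last exact/funext.
  by rewrite -stepD /g; ring.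
have ms := measurable_step L0 (grid_avg (M := M) L g).
apply: (le_trans (int_normpD_le mg (measurable_funM (measurable_cst _) ms))).
rewrite int_normpZ// normrN normr1 powR1 mul1e.
apply: (@le_trans _ _ ((2 `^ q)%:E * ((e / K)%:E + ((2 * 5 ^+ n) `^ q)%:E * (e / K)%:E))%E).
  apply: lee_wpmul2l; first by rewrite lee_fin powR_ge0.
  apply: leeD; first exact: gu.
  apply: le_trans (grid_avg_contract M mg g0 goo) _.
  by apply: lee_wpmul2l; first by rewrite lee_fin powR_ge0.
rewrite -[X in (X <= _)%E]/((2 `^ q * (e / K + (2 * 5 ^+ n) `^ q * (e / K)))%:E) lee_fin.
rewrite (_ : 2 `^ q * _ = K * (e / K)); last by rewrite /K; ring.
by rewrite mulrC divfK// gt_eqF.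
Qed.

End dyadic_density.

(** * Uniform approximation of continuous functions *)

Section continuous_density.
Context {R : realType} {n : nat}.
Local Notation V := 'rV[R]_n.
Local Notation mu := (@lebesgue_rV R n).

Lemma compact_box (L : R) : compact (box (0 : V) L).
Proof.
rewrite box_prodE; apply: (@rV_compact _ _ (fun i => `[(0 : V) ord0 i - L, (0 : V) ord0 i + L]%classic)).
by move=> i; exact: segment_compact.
Qed.

Lemma box_unif_cont (f : V -> R) (L e : R) : continuous f -> 0 < e ->
  exists2 d : R, 0 < d & forall x y, box 0 L x -> ball x d y -> `|f x - f y| <= e.
Proof.
move=> cf e0; have e20 : 0 < e / 2 by rewrite divr_gt0.
have /compact_near_coveringP/(_ R (0 : R)^'+ (fun d x => forall y, ball x d y -> `|f x - f y| <= e)) := @compact_box L.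
case.
  move=> x _; have /cvgrPdist_lt/(_ _ e20)/nbhs_ballP[r /= r0 rf] := cf x.
  have r20 : 0 < r / 2 by rewrite divr_gt0.
  exists (ball x (r / 2), [set d | d < r / 2]) => /=.
    split; first exact: nbhsx_ballx.
    exact: nbhs_right_lt.
  move=> [x' d] /= [xx' dr] y x'y.
  have xy : ball x r y.
    by rewrite [r]splitr; apply: ball_triangle xx' _; exact: le_ball (ltW dr) _ x'y.
  have xx : ball x r x'.
    by apply: le_ball xx'; rewrite ler_pdivrMr// ler_peMr ?ler1n// ltW.
  rewrite (splitr e); apply: (le_trans (ler_distD (f x) _ _)); apply: lerD; last exact: ltW (rf _ xy).
  by rewrite distrC; exact: ltW (rf _ xx).
move=> d /= d0 df; exists (d / 2); first by rewrite divr_gt0.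
move=> x y xb xy; apply: (df (d / 2)) xb _ xy => /=; last by rewrite divr_gt0.
by rewrite sub0r normrN ger0_norm ?divr_ge0 ?(ltW d0)// ltr_pdivrMr// ltr_pMr// ltr1n.
Qed.

Lemma mesh_lt (L e : R) : 0 < L -> 0 < e -> exists M, mesh L M < e.
Proof.
move=> L0 e0.
have [N NE] : exists N : nat, 2 * L / e < N%:R.
  by exists (Num.truncn (2 * L / e)).+1; exact: truncnS_gt.
exists N; rewrite /mesh ltr_pdivrMr ?exprn_gt0// [ltRHS]mulrC -ltr_pdivrMr//.
by apply: (lt_le_trans NE); rewrite -natrX ler_nat ltnW// ltn_expl.
Qed.

(** Takes the place of L^q density, which has no analogue in the supremum norm: once the mesh is
    below the modulus of continuity, the average on a cell is within [e] of each value of [f] in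
    it. *)
Lemma grid_avg_unif (f : V -> R) (L e : R) : 0 < L -> 0 < e -> continuous f ->
  mu.-integrable setT (EFin \o f) -> {ae mu, forall x, ~ cube L x -> f x = 0} ->
  exists M, {ae mu, forall x, `|f x - step L (grid_avg (M := M) L f) x| <= e}.
Proof.
move=> L0 e0 cf fi f0; have [d d0 fd] := @box_unif_cont f L e cf e0.
have [M Md] := mesh_lt L0 d0; exists M.
have mf : measurable_fun setT f by apply/measurable_EFinP; case/integrableP: fi.
have hn0 := @meshn_gt0 R n L M L0.
move: (f0); apply: filterS => x fx0.
have [xc|xc] := pselect (cube L x); last first.
  by rewrite fx0// step_out// subrr normr0 ltW.
rewrite step_in//; set k := grid_index L M x.
(* Subtracting the value [f x] in the cube only keeps [g] null off the cube, so that the folded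
   copies of the cell contribute nothing. *)
pose g (y : V) : R := f y + (- 1) * step (M := M) L (fun=> f x) y.
have gi : mu.-integrable setT (EFin \o g).
  have := integrableD measurableT fi (integrableZl measurableT (- 1) (integrable_step L0 (fun _ : {ffun 'I_n -> 'I_(2 ^ M)} => f x))).
  by apply: eq_integrable => // y _.
have avgE : grid_avg L g k = grid_avg L f k - f x.
  rewrite grid_avgD//; last first.
    by have := integrableZl measurableT (- 1) (integrable_step L0 (fun _ : {ffun 'I_n -> 'I_(2 ^ M)} => f x)).
  rewrite grid_avgZ//; last exact: integrable_step.
  by rewrite grid_avg_step// mulN1r.
rewrite -normrN opprB -avgE -(ler_pM2l hn0) -lee_fin.
apply: (le_trans (grid_avg_norm L0 gi k)).
have mg : measurable_fun setT g by apply/measurable_EFinP; case/integrableP: gi.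
have -> : ((mesh L M ^+ n * e)%:E = \int[mu]_(y in fibre L k) (step (M := M) L (fun=> e) y)%:E)%E.
  by rewrite (integral_step_fibre L0 (F := id)).
have se0 (y : V) : 0 <= step (M := M) L (fun=> e) y.
  by rewrite /step mulr_ge0 ?(ltW e0).
apply: ae_ge0_le_integral => //.
- exact: measurable_fibre.
- exact: measurable_norm.
- by move=> y _; rewrite lee_fin.
- by apply: measurable_funTS; apply/measurable_EFinP; exact: measurable_step.
move: f0; apply: filterS => y fy0 yk; rewrite lee_fin /g.
have [yc|yc] := pselect (cube L y); last first.
  by rewrite fy0// !step_out// mulr0 addr0 normr0.
rewrite !step_in// mulN1r distrC; apply: fd; first exact: cube_sub_box.
split=> // i j; rewrite (ord1 i) /ball /=; apply: le_lt_trans Md.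
rewrite -[leRHS]mul1r -(expr0 2); apply: (block_dist L0 _ _ xc yc) => //.
by rewrite yk.
Qed.

End continuous_density.

(** * The L^1 norm of complex functions *)

Section H1_norm_theory.
Context {R : realType} {n : nat}.
Local Notation V := 'rV[R]_n.
Local Notation C := R[i].
Local Notation mu := (@lebesgue_rV R n).
Local Notation normc := (@ComplexField.Normc.normc R).

Definition L1norm (g : V -> C) : \bar R := (\int[mu]_x (normc (g x))%:E)%E.

Lemma L1norm_ge0 g : (0 <= L1norm g)%E.
Proof. by apply: integral_ge0 => x _; rewrite lee_fin normc_ge0. Qed.

Lemma measurable_normcE (g : V -> C) : cmeasurable g ->
  measurable_fun setT (fun x => (normc (g x))%:E).
Proof. by move=> mg; apply/measurable_EFinP; exact: measurable_normc. Qed.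

Lemma cL1P (g : V -> C) : cLp 1%E g <-> cmeasurable g /\ (L1norm g < +oo)%E.
Proof.
rewrite /cLp /= Lnorm1 /L1norm.
suff -> : (\int[mu]_x `|(normc (g x))%:E| = \int[mu]_x (normc (g x))%:E)%E by [].
by apply: eq_integral => x _; rewrite gee0_abs// lee_fin normc_ge0.
Qed.

Lemma L1norm_le (f g : V -> C) : cmeasurable f -> cmeasurable g ->
  {ae mu, forall x, normc (f x) <= normc (g x)} -> (L1norm f <= L1norm g)%E.
Proof.
move=> mf mg fg; apply: ae_ge0_le_integral => //; try exact: measurable_normcE.
- by move=> x _; rewrite lee_fin normc_ge0.
- by move=> x _; rewrite lee_fin normc_ge0.
- by move: fg; apply: filterS => x xfg _; rewrite lee_fin.
Qed.

Lemma L1norm_ae (f g : V -> C) : cmeasurable f -> cmeasurable g ->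
  {ae mu, forall x, f x = g x} -> L1norm f = L1norm g.
Proof.
move=> mf mg fg; apply/eqP; rewrite eq_le; apply/andP; split; apply: L1norm_le => //;
  by move: fg; apply: filterS => x ->.
Qed.

Lemma L1normD (f g : V -> C) : cmeasurable f -> cmeasurable g ->
  (L1norm (fun x => (f x + g x)%R) <= L1norm f + L1norm g)%E.
Proof.
move=> mf mg; rewrite /L1norm -ge0_integralD//; try exact: measurable_normcE; last 2 first.
- by move=> x _; rewrite lee_fin normc_ge0.
- by move=> x _; rewrite lee_fin normc_ge0.
apply: ge0_le_integral => //.
- by move=> x _; rewrite lee_fin normc_ge0.
- by apply: measurable_normcE; exact: cmeasurableD.
- by apply: emeasurable_funD; exact: measurable_normcE.
- by move=> x _; rewrite -EFinD lee_fin normcD.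
Qed.

Lemma L1normZ (k : C) (f : V -> C) : cmeasurable f ->
  L1norm (fun x => (k * f x)%R) = ((normc k)%:E * L1norm f)%E.
Proof.
move=> mf; rewrite /L1norm; under eq_integral do rewrite normcM EFinM.
rewrite ge0_integralZl//; first exact: measurable_normcE.
- by move=> x _; rewrite lee_fin normc_ge0.
- by rewrite lee_fin normc_ge0.
Qed.

Lemma L1norm_eq0 (f : V -> C) : cmeasurable f -> L1norm f = 0%E -> {ae mu, forall x, f x = 0}.
Proof.
move=> mf f0; have := (ae_eq_integral_abs mu measurableT (measurable_normcE mf)).1.
have -> : (\int[mu]_x `|(normc (f x))%:E| = L1norm f)%E.
  by apply: eq_integral => x _; rewrite gee0_abs// lee_fin normc_ge0.
move=> /(_ f0); apply: filterS => x /(_ Logic.I) /eqP; rewrite eqe => /eqP.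
exact: ComplexField.Normc.eq0_normc.
Qed.

Lemma atom_cmeasurable q (a : V -> C) : is_atom q a -> cmeasurable a.
Proof. by case=> -[]. Qed.

Lemma atom_L1 (q : \bar R) (a : V -> C) : (1 < q)%E -> is_atom q a -> (L1norm a <= 2%:E)%E.
Proof. by move=> /(@atom_exponent _ n)[p p1 pa] /pa; exact: atom_int_le2. Qed.

Lemma atom0 (q : \bar R) : (1 < q)%E -> is_atom q (fun _ : V => 0).
Proof.
move=> q1; apply: atom_oo_any => //; apply/is_atom_ooP; split.
- exact: cmeasurable0.
- rewrite (_ : (fun _ => 0) = fun x : V => ((fun _ => 0) x : R)%:C%C)//.
  by rewrite cintegral_real /Rintegral integral0.
exists 0, 1; split; [exact: ltr01|exact: aeW|apply: aeW => x].
by rewrite normc0 invr_ge0 ltW// vol_gt0.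
Qed.

End H1_norm_theory.

(** * Series of atoms *)

Section ge0_limits.
Context {R : realType}.

Lemma ge0_cvg0P (u : nat -> \bar R) : (forall N, (0 <= u N)%E) ->
  (u N @[N --> \oo] --> 0%E) <->
  (forall e : R, 0 < e -> exists N0, forall N, (N0 <= N)%N -> (u N <= e%:E)%E).
Proof.
move=> u0; split=> [/fine_cvgP[[M _ uM] /cvgrPdist_le uc] e e0|ue].
  have [N0 _ uN] := uc _ e0; exists (maxn M N0) => N; rewrite geq_max => /andP[MN NN].
  rewrite -(fineK (uM _ MN)) lee_fin; have := uN _ NN; rewrite /= sub0r normrN.
  exact: le_trans (ler_norm _).
apply/fine_cvgP; split.
  have [N0 uN] := ue 1 ltr01; exists N0 => // N /= NN.
  by rewrite ge0_fin_numE// (le_lt_trans (uN _ NN))// ltry.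
apply/cvgrPdist_le => e e0; have [N0 uN] := ue e e0; exists N0 => // N /= NN.
have uf : u N \is a fin_num by rewrite ge0_fin_numE// (le_lt_trans (uN _ NN))// ltry.
by rewrite sub0r normrN ger0_norm ?fine_ge0// -lee_fin fineK// uN.
Qed.

End ge0_limits.

(** The reverse inequality is the hypothesis for the scalar [k^-1] and the function [k * f]. *)
Lemma homogeneous_eq (R : realType) (T : Type) (N : (T -> R[i]) -> \bar R) (k : R[i]) f :
  (forall (j : R[i]) g, j != 0 ->
     (N (fun x => j * g x)%R <= (ComplexField.Normc.normc j)%:E * N g)%E) ->
  k != 0 -> N (fun x => k * f x) = ((ComplexField.Normc.normc k)%:E * N f)%E.
Proof.
move=> Nle k0; have nk0 := normc_gt0 k0; apply/eqP; rewrite eq_le Nle//=.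
have := Nle k^-1 (fun x => k * f x); rewrite invr_eq0 => /(_ k0).
under eq_fun do rewrite mulrA mulVf// mul1r.
by rewrite ComplexField.Normc.normcV -lee_pdivlMl ?invr_gt0// invrK.
Qed.

Section atomic_series.
Context {R : realType} {n : nat}.
Local Notation V := 'rV[R]_n.
Local Notation C := R[i].
Local Notation mu := (@lebesgue_rV R n).
Local Notation normc := (@ComplexField.Normc.normc R).
Variable q : \bar R.
Hypothesis q1 : (1 < q)%E.

Lemma In_nth_seq (T : Type) (d : T) (l : seq T) k : (k < size l)%N -> List.In (nth d l k) l.
Proof. by elim: l k => // x l ih [|k] /= kl; [left|right; exact: ih]. Qed.

Lemma big_seq_le (T : Type) (l m : seq T) (F : T -> R) : (forall p, 0 <= F p) ->
  \sum_(p <- l) F p <= \sum_(p <- l ++ m) F p.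
Proof. by move=> F0; rewrite big_cat lerDl sumr_ge0. Qed.

Lemma list_L1norm (l : seq (C * (V -> C))) : (forall p, List.In p l -> is_atom q p.2) ->
  cmeasurable (fun x => \sum_(p <- l) p.1 * p.2 x) /\
  (L1norm (fun x => (\sum_(p <- l) p.1 * p.2 x)%R) <= (2 * \sum_(p <- l) normc p.1)%:E)%E.
Proof.
elim: l => [_|p l ih la].
  split; first by under eq_fun do rewrite big_nil; exact: cmeasurable0.
  rewrite /L1norm; under eq_integral do rewrite big_nil normc0.
  by rewrite integral0 big_nil mulr0.
have [ml nl] : cmeasurable (fun x => \sum_(p <- l) p.1 * p.2 x) /\
  (L1norm (fun x => (\sum_(p <- l) p.1 * p.2 x)%R) <= (2 * \sum_(p <- l) normc p.1)%:E)%E.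
  by apply: ih => r rl; apply: la; right.
have pa : is_atom q p.2 by apply: la; left.
have mp := cmeasurableZ p.1 (atom_cmeasurable pa).
under eq_fun do rewrite big_cons; split; first exact: cmeasurableD.
rewrite big_cons mulrDr EFinD; apply: (le_trans (L1normD mp ml)); apply: leeD => //.
rewrite L1normZ; last exact: atom_cmeasurable pa.
apply: (@le_trans _ _ ((normc p.1)%:E * 2%:E)%E); last by rewrite -EFinM lee_fin mulrC.
apply: lee_wpmul2l; first by rewrite lee_fin normc_ge0.
exact: atom_L1 pa.
Qed.

(* The atoms of [G 0], [G 1], ... are listed one after the other; inside the block [K] the
   partial sums differ from those at its beginning by at most [2 * c K] in L^1. *)
Lemma H1_norm_blocks (g : V -> C) (G : nat -> V -> C) (c : nat -> R) (S : R) :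
  cLp 1%E g -> (forall k, cmeasurable (G k)) -> (forall k, findec q (G k) (c k)) ->
  (forall N, \sum_(k < N) c k <= S) ->
  (L1norm (fun x => (g x - \sum_(k < K) G k x)%R) @[K --> \oo] --> 0%E) ->
  (H1_norm q g <= S%:E)%E.
Proof.
move=> g1 mG fG cS gG; have /cL1P[mg _] := g1.
pose d : C * (V -> C) := (0, fun=> 0).
have /choice[l lP] k : exists l : seq (C * (V -> C)),
    [/\ (0 < size l)%N, forall p, List.In p l -> is_atom q p.2,
      {ae mu, forall x, G k x = \sum_(p <- l) p.1 * p.2 x} & \sum_(p <- l) normc p.1 <= c k].
  (* The zero atom in front makes every list nonempty at no cost. Hence [P K] has at least [K]
     entries, and the concatenation reaches every index. *)
  have [l [la lf ls]] := fG k; exists (d :: l); split => //.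
  - by move=> p [<-|/la//]; exact: atom0.
  - by move: lf; apply: filterS => x ->; rewrite big_cons mul0r add0r.
  - by rewrite big_cons normc0 add0r.
have l0 k : (0 < size (l k))%N by case: (lP k).
have la k p : List.In p (l k) -> is_atom q p.2 by case: (lP k) => _ + _ _; apply.
have lf k : {ae mu, forall x, G k x = \sum_(p <- l k) p.1 * p.2 x} by case: (lP k).
have lc k : \sum_(p <- l k) normc p.1 <= c k by case: (lP k).
have c0 k : 0 <= c k by apply: le_trans (lc k); apply: sumr_ge0 => p _; exact: normc_ge0.
pose P K := \big[cat/[::]]_(k < K) l k.
have PS K : P K.+1 = P K ++ l K by rewrite /P big_ord_recr.
have Pa K p : List.In p (P K) -> is_atom q p.2.
  elim: K => [|K ih]; first by rewrite /P big_ord0.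
  by rewrite PS => pP; have [/ih|/la] := List.in_app_or _ _ _ pP.
have Psz K : (K <= size (P K))%N.
  by elim: K => // K ih; rewrite PS size_cat -addn1 leq_add.
have Pmono K K' : (K <= K')%N -> (size (P K) <= size (P K'))%N.
  by move=> /subnKC <-; elim: (K' - K)%N => [|j ih]; rewrite ?addn0// addnS PS size_cat (leq_trans ih)// leq_addr.
have Pnth K K' i : (K <= K')%N -> (i < size (P K))%N -> nth d (P K') i = nth d (P K) i.
  move=> /subnKC <-; elim: (K' - K)%N => [|j ih] iK; first by rewrite addn0.
  by rewrite addnS PS nth_cat (leq_trans iK) ?ih// Pmono// leq_addr.
pose term i := nth d (P i.+1) i.
have termE K i : (i < size (P K))%N -> term i = nth d (P K) i.
  move=> iK; have [Ki|iK'] := leqP K i.+1; first exact: Pnth.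
  by rewrite /term (Pnth _ _ _ (ltnW iK'))// Psz.
have sumE (A : nmodType) (F : C * (V -> C) -> A) K N : (N <= size (P K))%N ->
    \sum_(i < N) F (term i) = \sum_(p <- take N (P K)) F p.
  move=> NK; rewrite (big_nth d) size_takel// big_mkord; apply: eq_bigr => i _.
  by rewrite nth_take// (termE K)// (leq_trans (ltn_ord i)).
have Pcost K : \sum_(p <- P K) normc p.1 <= \sum_(k < K) c k.
  elim: K => [|K ih]; first by rewrite /P !big_ord0 big_nil.
  by rewrite PS big_cat big_ord_recr lerD.
have Pf K : {ae mu, forall x, \sum_(k < K) G k x = \sum_(p <- P K) p.1 * p.2 x}.
  elim: K => [|K ih]; first by apply: aeW => x; rewrite /P !big_ord0 big_nil.
  move: ih (lf K); apply: filterS2 => x ih lK.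
  by rewrite PS big_cat big_ord_recr /= ih lK.
have costN N : \sum_(i < N) normc (term i).1 <= S.
  rewrite (sumE _ (fun p => normc p.1) N N (Psz N)); apply: le_trans (cS N); apply: le_trans (Pcost N).
  rewrite -[in leRHS](cat_take_drop N (P N)); apply: big_seq_le => p; exact: normc_ge0.
have costS : ((\sum_(0 <= j <oo) (normc (term j).1)%:E) <= S%:E)%E.
  apply: lime_le; first by apply: is_cvg_nneseries => j _ _; rewrite lee_fin normc_ge0.
  by apply: nearW => N; rewrite big_mkord sumEFin lee_fin.
apply: (le_trans _ costS); apply: ereal_inf_lbound.
exists (fun j => (term j).1), (fun j => (term j).2); split => //; split => //.
- by move=> j; apply: (Pa j.+1); apply: In_nth_seq; exact: Psz.
- by apply: le_lt_trans costS _; rewrite ltry.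
have cc : c k @[k --> \oo] --> 0.
  apply: cvg_series_cvg_0; apply: nondecreasing_is_cvgn.
    apply/nondecreasing_seqP => N; rewrite /series /= big_nat_recr//= lerDl//.
  by exists S => _ [N _ <-]; rewrite /series /= big_mkord.
apply/ge0_cvg0P => [N|e e0]; first by apply: integral_ge0 => x _; rewrite lee_fin normc_ge0.
have e20 : 0 < e / 2 by rewrite divr_gt0.
(* A quarter, because an incomplete block [K] contributes up to [2 * c K] to the L^1 norm. *)
have e40 : 0 < e / 4 by rewrite divr_gt0.
have [K1 gK] := (ge0_cvg0P (fun N => L1norm_ge0 _)).1 gG _ e20.
have /cvgrPdist_le/(_ _ e40) [K2 _ cK] := cc.
pose K0 := maxn K1 K2.
exists (size (P K0)) => N NK0.
have exK : exists K, (N < size (P K.+1))%N by exists N; exact: Psz.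
case: (ex_minnP exK) => K NK Kmin.
have PKN : (size (P K) <= N)%N.
  case: K NK Kmin => [|K] NK Kmin; first by rewrite /P big_ord0.
  by rewrite leqNgt; apply/negP => /Kmin; rewrite ltnn.
have K0K : (K0 <= K)%N.
  rewrite leqNgt; apply/negP => /Pmono PK; have := leq_trans NK PK.
  by rewrite ltnNge NK0.
pose t := take (N - size (P K)) (l K).
have ta p : List.In p t -> is_atom q p.2.
  move=> pt; apply: (la K); rewrite -(cat_take_drop (N - size (P K)) (l K)).
  by apply: List.in_or_app; left.
have [mt nt] := list_L1norm ta.
have mS : cmeasurable (fun x => \sum_(k < K) G k x).
  by under eq_fun do rewrite -big_enum /=; exact: cmeasurable_sum.
have mgS : cmeasurable (fun x => g x - \sum_(k < K) G k x).
  have -> : (fun x => g x - \sum_(k < K) G k x) = (fun x => g x + (-1) * \sum_(k < K) G k x).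
    by apply/funext => x; rewrite mulN1r.
  by apply: cmeasurableD => //; exact: cmeasurableZ.
have mt' : cmeasurable (fun x => (-1) * \sum_(p <- t) p.1 * p.2 x) by exact: cmeasurableZ.
have [mPK _] := list_L1norm (Pa K).
have NE x : \sum_(j < N) (term j).1 * (term j).2 x =
    \sum_(p <- P K) p.1 * p.2 x + \sum_(p <- t) p.1 * p.2 x.
  rewrite (sumE _ (fun p => p.1 * p.2 x) K.+1 N (ltnW NK)) PS take_cat ltnNge PKN /=.
  by rewrite big_cat.
pose r x := (g x - \sum_(k < K) G k x) + (-1) * (\sum_(p <- t) p.1 * p.2 x).
have mr : cmeasurable r by exact: cmeasurableD.
have -> : (\int[mu]_x (normc (g x - \sum_(j < N) (term j).1 * (term j).2 x))%:E = L1norm r)%E.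
  rewrite -/(L1norm (fun x => (g x - \sum_(j < N) (term j).1 * (term j).2 x)%R)).
  apply: L1norm_ae => //.
    have -> : (fun x => g x - \sum_(j < N) (term j).1 * (term j).2 x) = (fun x => g x +
      (-1) * (\sum_(p <- P K) p.1 * p.2 x + \sum_(p <- t) p.1 * p.2 x)).
      by apply/funext => x; rewrite NE mulN1r.
    by apply: cmeasurableD => //; apply: cmeasurableZ; exact: cmeasurableD.
  move: (Pf K); apply: filterS => x Px.
  by rewrite /r NE Px mulN1r opprD addrA.
apply: (le_trans (L1normD mgS mt')).
rewrite (splitr e) EFinD; apply: leeD.
  by apply: gK; rewrite (leq_trans _ K0K)// leq_maxl.
rewrite L1normZ// normcB ComplexField.Normc.normc1 mul1e; apply: (le_trans nt).
rewrite lee_fin.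
have cKe : c K <= e / 4.
  have := cK K; rewrite sub0r normrN => /(_ _)/(le_trans (ler_norm _)); apply.
  by rewrite /= (leq_trans _ K0K)// leq_maxr.
have tc : \sum_(p <- t) normc p.1 <= c K.
  apply: le_trans (lc K); rewrite -[in leRHS](cat_take_drop (N - size (P K)) (l K)).
  by apply: big_seq_le => p; exact: normc_ge0.
have := le_trans tc cKe; move: (\sum_(p <- t) _) => z; lra.
Qed.

Lemma series_partial_le (u : nat -> R) N : (forall j, 0 <= u j) ->
  ((\sum_(j < N) u j)%:E <= \sum_(0 <= j <oo) (u j)%:E)%E.
Proof.
move=> u0; rewrite -sumEFin -(big_mkord xpredT (fun j => (u j)%:E)).
by apply: nneseries_lim_ge => j _ _; rewrite lee_fin.
Qed.

Lemma partial_sum_L1norm (lam : nat -> C) (a : nat -> V -> C) N : (forall j, is_atom q (a j)) ->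
  cmeasurable (fun x => \sum_(j < N) lam j * a j x) /\
  (L1norm (fun x => (\sum_(j < N) lam j * a j x)%R) <= (2 * \sum_(j < N) normc (lam j))%:E)%E.
Proof.
move=> aa; have la p : List.In p [seq (lam (j : 'I_N), a j) | j <- index_enum 'I_N] -> is_atom q p.2.
  by move=> /List.in_map_iff [j [<- _]]; exact: aa.
have [m1 m2] := list_L1norm la; rewrite big_map in m2.
have E : (fun x => \sum_(p <- [seq (lam (j : 'I_N), a j) | j <- index_enum 'I_N]) p.1 * p.2 x) =
    (fun x => \sum_(j < N) lam j * a j x) by apply/funext => x; rewrite big_map.
by rewrite E in m1 m2.
Qed.

Lemma atomic_decomposition_L1norm (g : V -> C) (lam : nat -> C) a : atomic_decomposition q g lam a ->
  (L1norm g <= 2%:E * \sum_(0 <= j <oo) (normc (lam j))%:E)%E.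
Proof.
move=> [/cL1P[mg _] aa _ ga].
apply/lee_addgt0Pr => e e0.
have [|N0 /(_ N0 (leqnn N0)) gN] := (ge0_cvg0P _).1 ga e e0.
  by move=> N; apply: integral_ge0 => x _; rewrite lee_fin normc_ge0.
have [mS nS] := partial_sum_L1norm lam N0 aa.
pose r x := g x + (-1) * \sum_(j < N0) lam j * a j x.
have mr : cmeasurable r by apply: cmeasurableD => //; exact: cmeasurableZ.
have gE : g = fun x => r x + \sum_(j < N0) lam j * a j x.
  by apply/funext => x; rewrite /r mulN1r subrK.
rewrite [in leLHS]gE; apply: (le_trans (L1normD mr mS)); rewrite addeC; apply: leeD.
  apply: (le_trans nS); rewrite EFinM; apply: lee_wpmul2l; first by rewrite lee_fin.
  by apply: series_partial_le => j; exact: normc_ge0.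
apply: le_trans gN; rewrite /L1norm le_eqVlt; apply/orP; left; apply/eqP.
by apply: eq_integral => x _; rewrite /r mulN1r.
Qed.

Lemma H1_norm_ge0 (g : V -> C) : (0 <= H1_norm q g)%E.
Proof.
apply/ereal_infP => _ [lam [a [_ ->]]]; apply: nneseries_ge0 => j _ _.
by rewrite lee_fin normc_ge0.
Qed.

Lemma H1_norm_L1norm (g : V -> C) : (L1norm g <= 2%:E * H1_norm q g)%E.
Proof.
rewrite muleC -lee_pdivrMr//; apply/ereal_infP => _ [lam [a [gla ->]]].
rewrite lee_pdivrMr// muleC; exact: atomic_decomposition_L1norm gla.
Qed.

Lemma H1_norm_lt (g : V -> C) (s : R) : (H1_norm q g < s%:E)%E ->
  exists lam a, [/\ atomic_decomposition q g lam a &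
    forall N, \sum_(j < N) normc (lam j) <= s].
Proof.
move=> /ereal_inf_lt[_ [lam [a [gla ->]]]] ls; exists lam, a; split => // N.
rewrite -lee_fin; apply: (le_trans _ (ltW ls)).
by apply: (@series_partial_le (fun j => normc (lam j))) => j; exact: normc_ge0.
Qed.

Lemma findec_H1_norm (f : V -> C) (s : R) : cLp 1%E f -> findec q f s -> (H1_norm q f <= s%:E)%E.
Proof.
move=> f1 fs; have /cL1P[mf _] := f1; have s0 := findec_ge0 fs.
apply: (@H1_norm_blocks f (fun k => if k is 0 then f else fun=> 0) (fun k => if k is 0 then s else 0)) => //.
- by case=> [|k]; [exact: mf|exact: cmeasurable0].
- by case=> [|k] //; apply: findec0 => //; exact: aeW.
- case=> [|N]; first by rewrite big_ord0.
  by rewrite big_ord_recl /= big1 ?addr0.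
- apply/ge0_cvg0P => [N|e e0]; first exact: L1norm_ge0.
  exists 1%N => -[//|N] _; rewrite /L1norm.
  under eq_integral do rewrite big_ord_recl /= big1 ?addr0// subrr normc0.
  by rewrite integral0 lee_fin ltW.
Qed.

Lemma atomic_decomposition_partial (g : V -> C) lam a N : atomic_decomposition q g lam a ->
  cmeasurable (fun x => g x - \sum_(j < N) lam j * a j x).
Proof.
move=> [/cL1P[mg _] aa _ _]; have [mS _] := partial_sum_L1norm lam N aa.
have -> : (fun x => g x - \sum_(j < N) lam j * a j x) =
    (fun x => g x + (-1) * \sum_(j < N) lam j * a j x) by apply/funext => x; rewrite mulN1r.
by apply: cmeasurableD => //; exact: cmeasurableZ.
Qed.

(** The two series are interleaved: the [k]-th terms of both form the [k]-th block of
    [H1_norm_blocks]. *)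
Lemma H1_normD (f g : V -> C) : (H1_norm q (fun x => (f x + g x)%R) <= H1_norm q f + H1_norm q g)%E.
Proof.
have [->|foo] := eqVneq (H1_norm q f) +oo%E.
  by rewrite addye ?leey// gt_eqF// (lt_le_trans _ (H1_norm_ge0 g)).
have [->|goo] := eqVneq (H1_norm q g) +oo%E.
  by rewrite addey ?leey// gt_eqF// (lt_le_trans _ (H1_norm_ge0 f)).
have ff : H1_norm q f \is a fin_num by rewrite ge0_fin_numE; [rewrite ltey; exact: foo|exact: H1_norm_ge0].
have gf : H1_norm q g \is a fin_num by rewrite ge0_fin_numE; [rewrite ltey; exact: goo|exact: H1_norm_ge0].
apply/lee_addgt0Pr => e e0; have e20 : 0 < e / 2 by rewrite divr_gt0.
pose sf := fine (H1_norm q f) + e / 2; pose sg := fine (H1_norm q g) + e / 2.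
have [|lf [af [fl fs]]] := @H1_norm_lt f sf.
  by rewrite -[ltLHS](fineK ff) lte_fin ltrDl.
have [|lg [ag [gl gs]]] := @H1_norm_lt g sg.
  by rewrite -[ltLHS](fineK gf) lte_fin ltrDl.
have -> : (H1_norm q f + H1_norm q g + e%:E = (sf + sg)%:E)%E.
  rewrite -[in LHS](fineK ff) -[in LHS](fineK gf) -!EFinD /sf /sg; congr (_%:E).
  by rewrite addrACA -splitr.
have [/cL1P[mf f1] afa _ fc] := fl; have [/cL1P[mg g1] aga _ gc] := gl.
apply: (@H1_norm_blocks _ (fun k x => lf k * af k x + lg k * ag k x)
  (fun k => normc (lf k) + normc (lg k))).
- apply/cL1P; split; first exact: cmeasurableD.
  by apply: (le_lt_trans (L1normD mf mg)); rewrite lte_add_pinfty.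
- by move=> k; apply: cmeasurableD; apply: cmeasurableZ; apply: atom_cmeasurable; [exact: afa|exact: aga].
- by move=> k; apply: findecD; apply: findec_atom.
- by move=> N; rewrite big_split /=; exact: lerD (fs N) (gs N).
apply/ge0_cvg0P => [N|d d0]; first exact: L1norm_ge0.
have d20 : 0 < d / 2 by rewrite divr_gt0.
have [|N1 fN] := (ge0_cvg0P _).1 fc _ d20.
  by move=> N; apply: integral_ge0 => x _; rewrite lee_fin normc_ge0.
have [|N2 gN] := (ge0_cvg0P _).1 gc _ d20.
  by move=> N; apply: integral_ge0 => x _; rewrite lee_fin normc_ge0.
exists (maxn N1 N2) => N; rewrite geq_max => /andP[/fN fNd /gN gNd].
have -> : (fun x => f x + g x - \sum_(k < N) (lf k * af k x + lg k * ag k x)) =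
    (fun x => (f x - \sum_(k < N) lf k * af k x) + (g x - \sum_(k < N) lg k * ag k x)).
  by apply/funext => x; rewrite big_split /= opprD addrACA.
apply: (le_trans (L1normD (atomic_decomposition_partial N fl) (atomic_decomposition_partial N gl))).
by rewrite (splitr d) EFinD; exact: leeD fNd gNd.
Qed.

Lemma H1_norm_ae0 (f : V -> C) : cmeasurable f -> {ae mu, forall x, f x = 0} -> H1_norm q f = 0%E.
Proof.
move=> mf f0; apply/eqP; rewrite eq_le H1_norm_ge0 andbT.
apply: findec_H1_norm; last exact: findec0.
apply/cL1P; split => //; rewrite (L1norm_ae mf cmeasurable0 f0) /L1norm.
by under eq_integral do rewrite normc0; rewrite integral0.
Qed.

Lemma H1_normZ_le (k : C) (f : V -> C) : k != 0 ->
  (H1_norm q (fun x => (k * f x)%R) <= (normc k)%:E * H1_norm q f)%E.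
Proof.
move=> k0; have nk0 := normc_gt0 k0.
rewrite muleC -lee_pdivrMr//; apply/ereal_infP => _ [lam [a [fl ->]]].
rewrite lee_pdivrMr// muleC -nneseriesZl; last by move=> j _; rewrite lee_fin normc_ge0.
have [/cL1P[mf f1] aa ls fc] := fl.
apply: ereal_inf_lbound; exists (fun j => k * lam j), a; split; last first.
  by apply: eq_eseriesr => j _; rewrite normcM EFinM.
split => //.
- by apply/cL1P; split; [exact: cmeasurableZ|rewrite L1normZ// lte_mul_pinfty// lee_fin ltW].
- under eq_eseriesr do rewrite normcM EFinM.
  rewrite nneseriesZl; last by move=> j _; rewrite lee_fin normc_ge0.
  by rewrite lte_mul_pinfty// lee_fin ltW.
- have -> : (fun N => \int[mu]_x (normc (k * f x - \sum_(j < N) k * lam j * a j x))%:E)%E =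
    (fun N => (normc k)%:E * \int[mu]_x (normc (f x - \sum_(j < N) lam j * a j x))%:E)%E.
    apply/funext => N; rewrite -[in RHS]/(L1norm (fun x => (f x - \sum_(j < N) lam j * a j x)%R)).
    rewrite -L1normZ; last exact: atomic_decomposition_partial fl.
    apply: eq_integral => x _; rewrite mulrBr mulr_sumr; congr ((normc (_ - _))%:E).
    by apply: eq_bigr => j _; rewrite mulrA.
  by rewrite -[X in _ --> X](mule0 (normc k)%:E); apply: cvgeZl.
Qed.

Lemma H1_normZ (k : C) (f : V -> C) : cmeasurable f ->
  H1_norm q (fun x => (k * f x)%R) = ((normc k)%:E * H1_norm q f)%E.
Proof.
move=> mf; have [->|k0] := eqVneq k 0.
  rewrite normc0 mul0e; apply: H1_norm_ae0; first exact: cmeasurableZ.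
  by apply: aeW => x; rewrite mul0r.
by apply: homogeneous_eq k0 => j g; exact: H1_normZ_le.
Qed.

End atomic_series.

(** * Comparison of the two norms *)

Section real_parts.
Context {R : realType} {n : nat}.
Local Notation V := 'rV[R]_n.
Local Notation C := R[i].
Local Notation mu := (@lebesgue_rV R n).
Local Notation normc := (@ComplexField.Normc.normc R).
Local Notation Re := (@complex.Re R).
Local Notation Im := (@complex.Im R).

Lemma cube_mono (L L' : R) : L <= L' -> cube (n := n) L `<=` cube L'.
Proof. by move=> LL x xc i; have /andP[? ?] := xc i; apply/andP; split; lra. Qed.

Lemma eball_sub_cube (c : V) (r : R) : 0 < r -> exists2 L, 0 < L & eball c r `<=` cube L.
Proof.
move=> r0; pose L := \sum_i `|c ord0 i| + r + 1.
have S0 : 0 <= \sum_i `|c ord0 i| by apply: sumr_ge0.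
exists L; first by rewrite /L; lra.
move=> x /(eball_sub_box (ltW r0)) xb i; have := xb i.
have ci : `|c ord0 i| <= \sum_i `|c ord0 i| by rewrite (bigD1 i)//= lerDl sumr_ge0.
have : `|x ord0 i| <= `|x ord0 i - c ord0 i| + `|c ord0 i|.
  by rewrite -[X in `|X| <= _](subrK (c ord0 i)) ler_normD.
move=> h1 h2; have : `|x ord0 i| < L by rewrite /L; lra.
by rewrite ltr_norml => /andP[/ltW -> ->].
Qed.

Definition Lq0 (q L : R) (F : V -> R) : Prop :=
  [/\ measurable_fun setT F, {ae mu, forall x, ~ cube L x -> F x = 0},
      \int[mu]_x F x = 0 & (\int[mu]_x (`|F x| `^ q)%:E < +oo)%E].

Lemma Lq0_integrable q L F : 0 < L -> 1 < q -> Lq0 q L F -> mu.-integrable setT (EFin \o F).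
Proof.
move=> L0 q1 [mF F0 _ Fq].
exact: integrable_pow (@measurable_cube R n L) (mu_cube_fin L0) mF q1 F0 Fq.
Qed.

Lemma Lq0_mono q L L' F : L <= L' -> Lq0 q L F -> Lq0 q L' F.
Proof.
move=> LL [mF F0 iF Fq]; split=> //.
by move: F0; apply: filterS => x Fx xc; apply: Fx => /(cube_mono LL).
Qed.

Lemma Lq0D q L F G : 0 < L -> 1 < q -> Lq0 q L F -> Lq0 q L G -> Lq0 q L (fun x => F x + G x).
Proof.
move=> L0 q1 lF lG; have iF := Lq0_integrable L0 q1 lF; have iG := Lq0_integrable L0 q1 lG.
move: lF lG => [mF F0 FI Fq] [mG G0 GI Gq]; split.
- exact: measurable_funD.
- by move: F0 G0; apply: filterS2 => x Fx Gx xc; rewrite Fx// Gx// addr0.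
- by rewrite RintegralD// FI GI addr0.
- apply: (le_lt_trans (int_normpD_le q1 mF mG)).
  by rewrite lte_mul_pinfty ?lee_fin ?powR_ge0// lte_add_pinfty.
Qed.

Lemma Lq0Z q L k F : 0 < L -> 1 < q -> Lq0 q L F -> Lq0 q L (fun x => k * F x).
Proof.
move=> L0 q1 lF; have iF := Lq0_integrable L0 q1 lF.
move: lF => [mF F0 FI Fq]; split.
- exact: measurable_funM.
- by move: F0; apply: filterS => x Fx xc; rewrite Fx// mulr0.
- by rewrite RintegralZl// FI mulr0.
- by rewrite int_normpZ// lte_mul_pinfty ?lee_fin ?powR_ge0.
Qed.

Lemma Lq0_0 q L : 1 < q -> Lq0 q L (fun=> 0).
Proof.
move=> q1; split; [exact: measurable_cst|exact: aeW| |].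
  by rewrite /Rintegral integral0.
have q0 : q != 0 by rewrite gt_eqF// (lt_trans _ q1).
by under eq_integral do rewrite normr0 powR0//; rewrite integral0.
Qed.

Lemma Lq0_ae q L F G : measurable_fun setT G -> {ae mu, forall x, F x = G x} ->
  Lq0 q L F -> Lq0 q L G.
Proof.
move=> mG FG [mF F0 FI Fq]; split; first exact: mG.
- by move: FG F0; apply: filterS2 => x <-.
- rewrite -FI /Rintegral; congr fine; apply: ae_eq_integral => //; try exact/measurable_EFinP.
  by move: FG; apply: filterS => x -> _.
- apply: le_lt_trans Fq; apply: ae_ge0_le_integral => //; try exact: measurable_normp.
  by move: FG; apply: filterS => x -> _.
Qed.

Lemma Lq0_ratom q F : 1 < q -> ratom q F -> exists2 L, 0 < L & Lq0 q L F.
Proof.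
move=> q1 [mF FI [c [r [r0 F0 Fq]]]]; have [L L0 rL] := eball_sub_cube c r0.
exists L => //; split => //.
  by move: F0; apply: filterS => x Fx xc; apply: Fx => /rL.
by apply: le_lt_trans Fq _; rewrite ltry.
Qed.

Lemma Re_phase (z : C) (y : C) : exists2 w, normc w <= 1 & forall u : C,
  Re (y * (z * u)) = normc z * Re ((y * w) * u).
Proof.
have [w w1 zw] := normc_phase z; exists w => // u.
rewrite [in LHS]zw; have -> : y * ((normc z)%:C%C * w * u) = (normc z)%:C%C * (y * w * u) by ring.
by move: (normc z) => r; case: (y * w * u) => a b /=; ring.
Qed.

Lemma real_stepZ (L c : R) M (u : {ffun 'I_n -> 'I_(2 ^ M)} -> R) (x : V) :
  c%:C%C * (step L u x)%:C%C = (step L (fun k => c * u k) x)%:C%C :> C.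
Proof. by rewrite /step -mulrA [RHS]rmorphM. Qed.

(** Each term becomes the modulus of its coefficient times a real atom. The cost bound is stated for
    every [L'], because the cube that contains the supports grows along the induction. *)
Lemma list_Lq0 (q : R) (y : C) (l : seq (C * (V -> C))) : 1 < q -> normc y <= 1 ->
  (forall p, List.In p l -> is_atom q%:E p.2) -> exists2 L, 0 < L &
  Lq0 q L (fun x => \sum_(p <- l) Re (y * (p.1 * p.2 x))) /\
  forall L' M, 0 < L' -> findec +oo
    (fun x => (step L' (grid_avg (M := M) L' (fun x => \sum_(p <- l) Re (y * (p.1 * p.2 x)))) x)%:C%C)
    (grid_cst (n := n) q * \sum_(p <- l) normc p.1).
Proof.
move=> q1 y1; elim: l => [_|p l ih la].
  exists 1; first exact: ltr01.
  under eq_fun do rewrite big_nil; split; first exact: Lq0_0.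
  move=> L' M L0; rewrite big_nil mulr0; apply: findec0 => //; apply: aeW => x.
  by rewrite /step /grid_avg /Rintegral integral0 mulr0 mul0r.
have [|L L0 [lL fL]] := ih; first by move=> r rl; apply: la; right.
have pa : is_atom q%:E p.2 by apply: la; left.
have [w w1 pw] := Re_phase p.1 y.
have yw : normc (y * w) <= 1 by rewrite normcM mulr_ile1 ?normc_ge0.
have ra := atom_Re q1 pa yw.
have [Lp Lp0 lp] := Lq0_ratom q1 ra.
have Lm0 : 0 < Num.max L Lp by rewrite lt_max L0.
exists (Num.max L Lp); first exact: Lm0.
under eq_fun do rewrite big_cons pw; split.
  have lm : Lq0 q (Num.max L Lp) (fun x => Re (y * w * p.2 x)).
    by apply: Lq0_mono lp; rewrite le_max lexx orbT.
  have lM : Lq0 q (Num.max L Lp) (fun x => \sum_(p <- l) Re (y * (p.1 * p.2 x))).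
    by apply: Lq0_mono lL; rewrite le_max lexx.
  exact: Lq0D Lm0 q1 (Lq0Z (normc p.1) Lm0 q1 lm) lM.
move=> L' M L'0; rewrite big_cons mulrDr.
have i1 := Lq0_integrable Lp0 q1 lp; have i2 := Lq0_integrable L0 q1 lL.
have := findecD (findecZ (normc p.1)%:C%C (findec_grid_avg M q1 L'0 ra)) (fL L' M L'0).
rewrite normc_real ger0_norm ?normc_ge0// [normc _ * grid_cst _]mulrC; apply: findec_ae; apply: aeW => x.
have -> : grid_avg (M := M) L' (fun x => normc p.1 * Re (y * w * p.2 x) + \sum_(p <- l) Re (y * (p.1 * p.2 x)))
   = (fun k => normc p.1 * grid_avg L' (fun x => Re (y * w * p.2 x)) k +
       grid_avg L' (fun x => \sum_(p <- l) Re (y * (p.1 * p.2 x))) k).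
  apply/funext => k; rewrite grid_avgD ?grid_avgZ//.
  by have := Lq0_integrable Lp0 q1 (Lq0Z (normc p.1) Lp0 q1 lp).
by rewrite -stepD real_stepZ -rmorphD.
Qed.

Lemma grid_avg_ae (L : R) M (F G : V -> R) : 0 < L -> measurable_fun setT F -> measurable_fun setT G ->
  {ae mu, forall x, F x = G x} -> grid_avg (M := M) L F = grid_avg L G.
Proof.
move=> L0 mF mG FG; apply/funext => k; rewrite /grid_avg /Rintegral; congr (_ * fine _).
apply: ae_eq_integral.
- exact: (@measurable_fibre R n L M L0 k).
- by apply: measurable_funTS; exact/measurable_EFinP.
- by apply: measurable_funTS; exact/measurable_EFinP.
- by move: FG; apply: filterS => x -> _.
Qed.

Lemma measurable_Re_mul (y : C) (f : V -> C) : cmeasurable f ->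
  measurable_fun setT (fun x => Re (y * f x)).
Proof. by move=> mf; case: (cmeasurableZ y mf). Qed.

Lemma findec_Lq0 (q : R) (y : C) f s : 1 < q -> normc y <= 1 -> cmeasurable f ->
  findec q%:E f s -> exists2 L, 0 < L & Lq0 q L (fun x => Re (y * f x)) /\
  forall M, findec +oo (fun x => (step L (grid_avg (M := M) L (fun x => Re (y * f x))) x)%:C%C)
    (grid_cst (n := n) q * s).
Proof.
move=> q1 y1 mf [l [la lf ls]]; have [L L0 [lL fL]] := list_Lq0 q1 y1 la.
have lE : {ae mu, forall x, \sum_(p <- l) Re (y * (p.1 * p.2 x)) = Re (y * f x)}.
  by move: lf; apply: filterS => x ->; rewrite mulr_sumr Re_sum.
exists L; first exact: L0.
split; first by apply: Lq0_ae lE lL; exact: measurable_Re_mul.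
move=> M; have mlL : measurable_fun setT (fun x => \sum_(p <- l) Re (y * (p.1 * p.2 x))) by case: lL.
rewrite -(grid_avg_ae M L0 mlL (measurable_Re_mul y mf) lE).
by apply: findec_le (fL L M L0); rewrite ler_wpM2l// grid_cst_ge0.
Qed.

End real_parts.

(** * From a series of atoms to a finite decomposition *)

Section finite_from_series.
Context {R : realType} {n : nat}.
Local Notation V := 'rV[R]_n.
Local Notation C := R[i].
Local Notation mu := (@lebesgue_rV R n).
Local Notation normc := (@ComplexField.Normc.normc R).
Local Notation Re := (@complex.Re R).
Local Notation Im := (@complex.Im R).

(** Keeps residuals in the class [Lq0], so that averaging can be iterated on them. *)
Lemma Rintegral_residual (q L : R) M F : 0 < L -> 1 < q -> Lq0 (n := n) q L F ->
  Lq0 q L (fun x => F x - step L (grid_avg (M := M) L F) x).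
Proof.
move=> L0 q1 lF; have iF := Lq0_integrable L0 q1 lF.
have [mF F0 FI Fq] := lF.
have lS : Lq0 q L (step L (grid_avg (M := M) L F)).
  split.
  - exact: measurable_step.
  - by apply: aeW => x; exact: step_out.
  - by rewrite Rintegral_step// sum_grid_avg.
  - by apply: (le_lt_trans (grid_avg_contract L0 q1 M mF F0 Fq)); rewrite lte_mul_pinfty ?lee_fin ?powR_ge0.
have := Lq0D L0 q1 lF (Lq0Z (-1) L0 q1 lS).
by under eq_fun do rewrite mulN1r.
Qed.

Lemma findec_residual (q L e : R) (F : V -> R) : 0 < L -> 1 < q -> 0 < e -> Lq0 q L F ->
  exists M, ratom q (fun x => e^-1 * (F x - step L (grid_avg (M := M) L F) x)).
Proof.
move=> L0 q1 e0 lF; have [mF F0 FI Fq] := lF.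
have b0 : 0 < ball_cst (R:=R) (n:=n) * L ^+ n by rewrite mulr_gt0 ?ball_cst_gt0// exprn_gt0.
have B0 : 0 < e `^ q * (ball_cst (R:=R) (n:=n) * L ^+ n) `^ (1 - q) by rewrite mulr_gt0// powR_gt0.
have [M FM] := grid_avg_density L0 q1 mF F0 Fq B0; exists M.
have [mG G0 GI _] := Rintegral_residual M L0 q1 lF.
apply: (@ratom_scale _ _ _ _ 0 L) => //.
by move: G0; apply: filterS => x Gx xb; apply: Gx => /cube_sub_box.
Qed.

(** A single atom carried by the cube: on a fixed grid the supremum of a step function is at most
    its L^1 norm divided by the volume of a cell. The constant blows up with [M], so [M] must be
    fixed before the series is cut. *)
Lemma findec_small_step (L : R) M (F : V -> R) (d : R) : 0 < L -> mu.-integrable setT (EFin \o F) ->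
  \int[mu]_x F x = 0 -> (\int[mu]_x `|F x|%:E <= d%:E)%E ->
  findec +oo (fun x => (step L (grid_avg (M := M) L F) x)%:C%C)
    (d / mesh L M ^+ n * (ball_cst (R:=R) (n:=n) * L ^+ n)).
Proof.
move=> L0 iF F0 Fd; have hn0 := @meshn_gt0 R n L M L0.
have d0 : 0 <= d by rewrite -lee_fin; apply: le_trans Fd; apply: integral_ge0 => x _; rewrite lee_fin.
apply: (@findec_step _ _ L M L0 _ 0) => //.
- by rewrite divr_ge0// ltW.
- move=> k; rewrite ler_pdivlMr// mulrC -lee_fin.
  apply: le_trans (le_trans (sum_grid_avg_norm M L0 iF) Fd).
  by rewrite lee_fin ler_pM2l// (bigD1 k)//= lerDl sumr_ge0.
- by move=> x xc _; exact: cube_sub_box.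
- by apply/eqP; rewrite -(mulrI_eq0 _ (mulfI (lt0r_neq0 hn0))) sum_grid_avg// F0.
Qed.

(* F = (F - E F) + sum_(j < N) t j * E (b j) + E r with r the remainder of the series. For a
   fixed grid, E r is a step function with a norm of order |r|_1, hence small for large N. *)
Lemma findec_real_series (q : \bar R) (p L S e : R) (F : V -> R) (b : nat -> V -> R) (t : nat -> R) :
  (1 < q)%E -> 1 < p -> 0 < L -> 0 < e -> mu.-integrable setT (EFin \o F) -> \int[mu]_x F x = 0 ->
  (forall d : R, 0 < d -> exists M, findec q
     (fun x => (F x - step L (grid_avg (M := M) L F) x)%:C%C) d) ->
  (forall j, ratom p (b j)) -> (forall j, 0 <= t j) -> (forall N, \sum_(j < N) t j <= S) ->
  (forall d : R, 0 < d -> exists N, (\int[mu]_x `|F x - \sum_(j < N) t j * b j x|%:E <= d%:E)%E) ->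
  findec q (fun x => (F x)%:C%C) (grid_cst (n := n) p * S + e).
Proof.
move=> q1 p1 L0 e0 iF F0 dens rb t0 tS conv.
have e20 : 0 < e / 2 by rewrite divr_gt0.
have [M FM] := dens _ e20.
have hn0 := @meshn_gt0 R n L M L0.
have b0 : 0 < ball_cst (R:=R) (n:=n) * L ^+ n by rewrite mulr_gt0 ?ball_cst_gt0// exprn_gt0.
(* Solves [d / mesh L M ^+ n * (ball_cst * L ^+ n) = e / 2], the cost of the averaged remainder. *)
pose d := e / 2 * mesh L M ^+ n / (ball_cst (R:=R) (n:=n) * L ^+ n).
have d0 : 0 < d by rewrite divr_gt0// mulr_gt0.
have [N FN] := conv _ d0.
have ib j : mu.-integrable setT (EFin \o b j) by exact: ratom_integrable p1 (rb j).
have itb j : mu.-integrable setT (EFin \o (fun x => t j * b j x)).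
  by have := integrableZl measurableT (t j) (ib j).
pose P N x := \sum_(j < N) t j * b j x.
have PS K x : P K.+1 x = P K x + t K * b K x by rewrite /P big_ord_recr.
have iP K : mu.-integrable setT (EFin \o P K) /\ \int[mu]_x P K x = 0.
  elim: K => [|K [ihi ih0]].
    rewrite (_ : P 0%N = fun=> 0); last by apply/funext => x; rewrite /P big_ord0.
    by split; [exact: integrable0|rewrite /Rintegral integral0].
  rewrite (_ : P K.+1 = fun x => P K x + t K * b K x); last exact/funext.
  split; first by have := integrableD measurableT ihi (itb K).
  by rewrite RintegralD// ih0 add0r RintegralZ0//; case: (rb K).
have Pavg K k : grid_avg (M := M) L (P K) k = \sum_(j < K) t j * grid_avg L (b j) k.
  elim: K => [|K ih].
    rewrite (_ : P 0%N = fun=> 0); last by apply/funext => x; rewrite /P big_ord0.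
    by rewrite big_ord0 /grid_avg /Rintegral integral0 mulr0.
  rewrite (_ : P K.+1 = fun x => P K x + t K * b K x); last exact/funext.
  by rewrite grid_avgD ?grid_avgZ ?ih ?big_ord_recr//; case: (iP K).
pose r x := F x + (-1) * P N x.
have iNP : mu.-integrable setT (EFin \o (fun x => (-1) * P N x)).
  by have := integrableZl measurableT (-1) (iP N).1.
have ir : mu.-integrable setT (EFin \o r) by have := integrableD measurableT iF iNP.
have r0 : \int[mu]_x r x = 0.
  by rewrite RintegralD// F0 add0r RintegralZ0//; [exact: (iP N).1|exact: (iP N).2].
have rd : (\int[mu]_x `|r x|%:E <= d%:E)%E.
  apply: le_trans FN; rewrite le_eqVlt; apply/orP; left; apply/eqP.
  by apply: eq_integral => x _; rewrite /r mulN1r.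
have fr := findec_small_step M L0 ir r0 rd.
have fP : findec +oo (fun x => (step L (grid_avg (M := M) L (P N)) x)%:C%C) (grid_cst (n := n) p * S).
  have := findec_sum (index_enum 'I_N) (fun (j : 'I_N) (_ : true) =>
    findecZ (t j)%:C%C (findec_grid_avg M p1 L0 (rb j))).
  move=> fs; apply: findec_ae; last apply: findec_le fs.
    apply: aeW => x; rewrite (_ : grid_avg L (P N) = fun k => \sum_(j < N) t j * grid_avg L (b j) k); last exact/funext.
    by rewrite (eq_bigr _ (fun j _ => real_stepZ L _ _ x)) -rmorph_sum /= /step mulr_suml.
  under eq_bigr do rewrite normc_real ger0_norm//.
  by rewrite -mulr_suml mulrC; apply: ler_wpM2l (tS N); exact: grid_cst_ge0.
have tot := findecD FM (findec_oo q1 (findecD fP fr)).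
apply: findec_ae; last apply: findec_le tot.
  apply: aeW => x; have rE : F = fun x => P N x + r x.
    by apply/funext => y; rewrite /r; ring.
  have -> : step L (grid_avg (M := M) L F) x =
      step L (grid_avg (M := M) L (P N)) x + step L (grid_avg (M := M) L r) x.
    rewrite stepD; congr step; apply/funext => k; rewrite -grid_avgD//; last exact: (iP N).1.
    by rewrite -rE.
  by rewrite -!rmorphD /=; congr (_%:C%C); ring.
rewrite (_ : d / _ * _ = e / 2); last first.
  by rewrite /d; field; rewrite !gt_eqF// ?ball_cst_gt0// exprn_gt0.
by move: (grid_cst (n := n) p * S) => z; lra.
Qed.

(** [q] belongs to the finite decomposition and [r] to the series; the constant only sees the real
    exponent [p]. The factor 2 adds the cases [y = 1] and [y = - 'i], as the real part of [- 'i * f]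
    is the imaginary part of [f]. *)
Lemma findec_series (q r : \bar R) (p : R) (f : V -> C) (lam : nat -> C) (a : nat -> V -> C) (S e : R) :
  (1 < q)%E -> (1 < r)%E -> 1 < p -> 0 < e -> (forall a : V -> C, is_atom r a -> is_atom p%:E a) ->
  atomic_decomposition r f lam a -> (forall N, \sum_(j < N) normc (lam j) <= S) ->
  (forall y, normc y <= 1 -> exists2 L, 0 < L & \int[mu]_x Re (y * f x) = 0 /\
    forall d : R, 0 < d -> exists M, findec q
     (fun x => (Re (y * f x) - step L (grid_avg (M := M) L (fun x => Re (y * f x))) x)%:C%C) d) ->
  findec q f (2 * grid_cst (n := n) p * S + e).
Proof.
move=> q1 r1 p1 e0 ra fla lS dens; have [/cL1P[mf f1] aa _ fc] := fla.
have e20 : 0 < e / 2 by rewrite divr_gt0.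
have part y : normc y <= 1 -> findec q (fun x => (Re (y * f x))%:C%C) (grid_cst (n := n) p * S + e / 2).
  move=> y1; have [L L0 [yf0 dy]] := dens y y1.
  have /choice[w wP] j : exists w, normc w <= 1 /\ forall u : C,
      Re (y * (lam j * u)) = normc (lam j) * Re ((y * w) * u).
    by have [w w1 wE] := Re_phase (lam j) y; exists w; split; [exact: w1|exact: wE].
  apply: (@findec_real_series q p L S (e / 2) _ (fun j x => Re (y * w j * a j x))
    (fun j => normc (lam j))) => //.
  - apply/integrable_normP; first exact: measurable_Re_mul.
    apply: le_lt_trans f1; apply: ge0_le_integral => //.
    + by apply: measurable_norm; exact: measurable_Re_mul.
    + exact: measurable_normcE.
    + move=> x _; rewrite lee_fin (le_trans (normr_Re_le _))// normcM.
      by rewrite ler_piMl// normc_ge0.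
  - move=> j; apply: atom_Re => //; first exact: ra.
    by rewrite normcM mulr_ile1 ?normc_ge0//; case: (wP j).
  - by move=> j; exact: normc_ge0.
  - move=> d d0; have [|N fN] := (ge0_cvg0P _).1 fc d d0.
      by move=> N; apply: integral_ge0 => x _; rewrite lee_fin normc_ge0.
    exists N; apply: le_trans (fN N (leqnn N)).
    have mp := atomic_decomposition_partial r1 N fla.
    have E x : Re (y * f x) - \sum_(j < N) normc (lam j) * Re (y * w j * a j x) =
        Re (y * (f x - \sum_(j < N) lam j * a j x)).
      rewrite mulrBr raddfB /= mulr_sumr Re_sum; congr (_ - _).
      by apply: eq_bigr => j _; have [_ ->] := wP j.
    apply: ge0_le_integral => //.
    + by apply: measurable_norm; under eq_fun do rewrite E; exact: measurable_Re_mul.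
    + exact: measurable_normcE.
    + move=> x _; rewrite E lee_fin (le_trans (normr_Re_le _))// normcM.
      by rewrite ler_piMl// normc_ge0.
have f1' := part 1; rewrite ComplexField.Normc.normc1 in f1'.
have f2' := part (- 'i)%C; rewrite normcB normc_i in f2'.
have tot := findecD (f1' (lexx _)) (findecZ 'i%C (f2' (lexx _))).
apply: findec_ae; last apply: findec_le tot.
  apply: aeW => x; rewrite mul1r [RHS]complexE; congr (_ + _ * _%:C%C).
  by case: (f x) => u v /=; ring.
by rewrite normc_i mul1r; move: (grid_cst (n := n) p) => g; lra.
Qed.

End finite_from_series.

(** * The two inequalities between the norms *)

Section norm_comparison.
Context {R : realType} {n : nat}.
Local Notation V := 'rV[R]_n.
Local Notation C := R[i].
Local Notation mu := (@lebesgue_rV R n).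
Local Notation normc := (@ComplexField.Normc.normc R).
Local Notation Re := (@complex.Re R).
Local Notation Im := (@complex.Im R).

(** Isolates the property of [f] on which the two statements of the theorem differ. The cube may
    depend on [y], which is only ever taken to be [1] or [- 'i]. *)
Definition grid_dense (q : \bar R) (f : V -> C) : Prop := forall y : C, normc y <= 1 ->
  exists2 L : R, 0 < L & \int[mu]_x Re (y * f x) = 0 /\
    forall d : R, 0 < d -> exists M, findec q
     (fun x => (Re (y * f x) - step L (grid_avg (M := M) L (fun x => Re (y * f x))) x)%:C%C) d.

Lemma grid_dense_fin (q s : R) (f : V -> C) : 1 < q -> cmeasurable f -> findec q%:E f s ->
  grid_dense q%:E f.
Proof.
move=> q1 mf fs y y1; have [L L0 [lF _]] := findec_Lq0 q1 y1 mf fs.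
exists L; first exact: L0.
split; first by case: lF.
move=> d d0; have [M rM] := findec_residual L0 q1 d0 lF; exists M.
exact: findec_ratom rM.
Qed.

Lemma continuous_Re_mul (y : C) (f : V -> C) : normc y <= 1 -> Ccont f ->
  continuous (fun x => Re (y * f x)).
Proof.
move=> y1 cf x; apply/(@cvgrPdist_lt _ _ _ (nbhs x) (nbhs_filter x)) => e e0.
have eC : 0 < (e%:C)%C :> C by rewrite ltcR.
move/(@cvgrPdist_lt _ _ _ (nbhs x) (nbhs_filter x)): (cf x) => /(_ _ eC); apply: filterS => t.
have nE (z : C) : `|z| = (normc z)%:C%C by rewrite normc_def; case: z.
rewrite nE ltcR => xt.
rewrite -raddfB -mulrBr; apply: le_lt_trans (normr_Re_le _) _.
by rewrite normcM (le_lt_trans _ xt)// ler_piMl// normc_ge0.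
Qed.

Lemma grid_dense_oo (s : R) (f : V -> C) : cmeasurable f -> Ccont f -> findec +oo f s ->
  grid_dense +oo f.
Proof.
(* The exponent 2 only yields a cube, the zero mean and integrability; the residual itself is
   measured in the supremum norm. *)
move=> mf cf fs y y1; have q1 : 1 < 2 :> R by lra.
have [|L L0 [lF _]] := @findec_Lq0 _ _ 2 y f s q1 y1 mf.
  by apply: findec_oo fs; rewrite lte_fin.
exists L; first exact: L0.
split; first by case: lF.
move=> d d0; have b0 : 0 < ball_cst (R:=R) (n:=n) * L ^+ n by rewrite mulr_gt0 ?ball_cst_gt0// exprn_gt0.
have [mF F0 _ _] := lF; have iF := Lq0_integrable L0 q1 lF.
have [M FM] := grid_avg_unif L0 (divr_gt0 d0 b0) (continuous_Re_mul y1 cf) iF F0.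
have [mG G0 GI _] := Rintegral_residual M L0 q1 lF; exists M.
have := @findec_bounded R n _ 0 L _ L0 (ltW (divr_gt0 d0 b0)) mG FM.
rewrite divfK ?gt_eqF//; apply; last exact: GI.
by move: G0; apply: filterS => x Gx xb; apply: Gx => /cube_sub_box.
Qed.

Lemma H1fin_norm_le (q r : \bar R) : (1 < q)%E -> (1 < r)%E -> exists2 c : R, 0 < c &
  forall f : V -> C, grid_dense q f -> (H1fin_norm q f <= c%:E * H1_norm r f)%E.
Proof.
move=> q1 r1; have [p p1 rp] := @atom_exponent R n r r1.
(* The added 1 makes [c] positive and pays for the error: with [u = e / c], [2 * grid_cst p * (h +
   u) + u <= c * h + c * u]. *)
have g0 := @grid_cst_ge0 R n p p1; pose c : R := 2 * grid_cst (n := n) p + 1.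
have c0 : 0 < c by rewrite /c; lra.
exists c => [//|f fd]; have := H1_norm_ge0 r f.
case hE : (H1_norm r f) => [h| |//] h0; last by rewrite gt0_muley// leey.
apply/lee_addgt0Pr => e e0; have ec0 : 0 < e / c by exact: divr_gt0.
have [|lam [a [la lS]]] := @H1_norm_lt _ _ r f (h + e / c).
  by rewrite hE lte_fin ltrDl.
have := findec_H1fin_norm (findec_series q1 r1 p1 ec0 rp la lS fd).
move/le_trans; apply; rewrite -EFinM -EFinD lee_fin.
move: h0; rewrite lee_fin => h0.
have ecE : e = c * (e / c) by rewrite mulrC divfK// gt_eqF.
by move: ec0 ecE; move: (e / c) => u u0 ->; rewrite /c; nra.
Qed.

Lemma sum_half_pow N : \sum_(k < N) (2 ^+ k.+1)^-1 <= 1 :> R.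
Proof.
suff -> : \sum_(k < N) (2 ^+ k.+1)^-1 = 1 - (2 ^+ N)^-1 :> R.
  by rewrite gerBl invr_ge0 exprn_ge0.
elim: N => [|N ih]; first by rewrite big_ord0 expr0 invr1 subrr.
by rewrite big_ord_recr ih /= exprS; field; rewrite expf_neq0.
Qed.

Lemma half_pow_lt (a e : R) : 0 < e -> exists N, forall K, (N <= K)%N -> a * (2 ^+ K)^-1 <= e.
Proof.
move=> e0; exists (Num.truncn (`|a| / e)).+1 => K NK; apply: le_trans (ler_norm _) _.
rewrite normrM [`|_^-1|]ger0_norm ?invr_ge0 ?exprn_ge0// ler_pdivrMr ?exprn_gt0//.
rewrite mulrC -ler_pdivrMr//; apply: le_trans (ltW (truncnS_gt _)) _.
rewrite (@le_trans _ _ (K%:R : R)) ?ler_nat// -natrX ler_nat.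
exact/ltnW/ltn_expl.
Qed.

Lemma L1norm_real (F : V -> R) : L1norm (fun x => (F x)%:C%C) = (\int[mu]_x `|F x|%:E)%E.
Proof. by apply: eq_integral => x _; rewrite normc_real. Qed.

(* Peel off F = E F + F_1, F_1 = E' F_1 + F_2, ... with finer and finer averaging operators;
   the successive residuals F_k tend to 0 geometrically in L^q. *)
Lemma H1_norm_real (q L s e : R) (r : \bar R) (F : V -> R) : 0 < L -> 1 < q -> (1 < r)%E ->
  0 < e -> Lq0 q L F ->
  (forall M, findec +oo (fun x => (step L (grid_avg (M := M) L F) x)%:C%C) s) ->
  (H1_norm r (fun x => (F x)%:C%C) <= (s + e)%:E)%E.
Proof.
move=> L0 q1 r1 e0 lF fF; have g0 := @grid_cst_ge0 R n q q1.
have g10 : 0 < grid_cst (n := n) q + 1 by lra.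
(* Residual number [k + 1] is [eta k] times a real atom, so averaging it costs [eta k * grid_cst q].
   These costs add up to at most [e], thanks to the denominator. *)
pose eta k : R := e / (grid_cst (n := n) q + 1) * (2 ^+ k.+1)^-1.
have eta0 k : 0 < eta k by rewrite mulr_gt0 ?divr_gt0// invr_gt0 exprn_gt0.
pose res M (G : V -> R) x := G x - step L (grid_avg (M := M) L G) x.
(* The grid depends on the function to be resolved; [xget] makes the choice total, with junk value 0
   when no grid works, so that the residuals are defined by plain recursion. *)
pose m k G : nat := xget 0%N [set M | ratom q (fun x => (eta k)^-1 * res M G x)].
have mP k G : Lq0 q L G -> ratom q (fun x => (eta k)^-1 * res (m k G) G x).
  move=> lG; rewrite /m; case: xgetP => [M _ //|].
  by have [M rM] := findec_residual L0 q1 (eta0 k) lG => /(_ M) []; exact: rM.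
pose Fs k := nat_rect (fun=> V -> R) F (fun k G => res (m k G) G) k.
have lFs k : Lq0 q L (Fs k).
  elim: k => [|k ih]; first exact: lF.
  exact: Rintegral_residual.
have rFs k : ratom q (fun x => (eta k)^-1 * Fs k.+1 x) by exact: (mP k (Fs k) (lFs k)).
pose G k x : C := (step L (grid_avg (M := m k (Fs k)) L (Fs k)) x)%:C%C.
pose c k : R := if k is k'.+1 then eta k' * grid_cst (n := n) q else s.
have mG k : cmeasurable (G k) by apply: cmeasurable_real; exact: measurable_step.
have fG k : findec r (G k) (c k).
  apply: findec_oo => //; case: k => [|k]; first exact: fF.
  have := findecZ (eta k)%:C%C (findec_grid_avg (m k.+1 (Fs k.+1)) q1 L0 (rFs k)).
  rewrite normc_real ger0_norm ?(ltW (eta0 k))//; apply: findec_ae; apply: aeW => x.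
  rewrite real_stepZ /G; congr (step L _ x)%:C%C; apply/funext => j.
  rewrite grid_avgZ; first by rewrite mulrA mulfV ?gt_eqF// mul1r.
    exact: L0.
  by have := Lq0_integrable L0 q1 (lFs k.+1).
have sG K x : \sum_(k < K) G k x = (F x - Fs K x)%:C%C.
  elim: K => [|K ih]; first by rewrite big_ord0 subrr.
  rewrite big_ord_recr ih /= -rmorphD; congr (_%:C%C).
  by rewrite /res; ring.
have mF k : measurable_fun setT (Fs k) by case: (lFs k).
have iF := Lq0_integrable L0 q1 lF.
apply: (H1_norm_blocks r1 (G := G) (c := c)).
- apply/cL1P; split; first exact: cmeasurable_real (mF 0%N).
  by rewrite L1norm_real; apply/integrable_normP; [exact: (mF 0%N)|].
- exact: mG.
- exact: fG.
- case=> [|N]; first by rewrite big_ord0; have := findec_ge0 (fF 0%N); lra.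
  rewrite big_ord_recl /= lerD2l.
  rewrite (eq_bigr (fun k : 'I_N => e / (grid_cst (n := n) q + 1) * grid_cst (n := n) q * (2 ^+ k.+1)^-1)); last first.
    by move=> k _; rewrite /c /= /eta mulrAC.
  rewrite -mulr_sumr; apply: (@le_trans _ _ (e / (grid_cst (n := n) q + 1) * grid_cst (n := n) q * 1)).
    by apply: ler_wpM2l (sum_half_pow N); rewrite mulr_ge0// divr_ge0// ltW.
  by rewrite mulr1 -mulrA ler_piMr ?(ltW e0)// mulrC ler_pdivrMr// mul1r; lra.
- apply/ge0_cvg0P => [K|d d0]; first exact: L1norm_ge0.
  have [N NP] := half_pow_lt (2 * (e / (grid_cst (n := n) q + 1))) d0.
  exists N.+1 => -[//|K] NK.
  rewrite (_ : (fun x => _) = fun x => (eta K)%:C%C * ((eta K)^-1 * Fs K.+1 x)%:C%C); last first.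
    apply/funext => x; rewrite sG -rmorphB -rmorphM; congr (_%:C%C).
    by rewrite mulrA mulfV ?gt_eqF// mul1r; ring.
  rewrite L1normZ; last by apply: cmeasurable_real; case: (rFs K).
  rewrite normc_real L1norm_real ger0_norm ?(ltW (eta0 K))//.
  apply: (@le_trans _ _ ((eta K)%:E * 2%:E)%E).
    by apply: lee_wpmul2l; [rewrite lee_fin ltW|exact: ratom_le2 (rFs K)].
  by rewrite -EFinM lee_fin mulrC /eta mulrA; apply: NP; exact: ltnW.
Qed.

(** Immediate for [r <= q], when (1,q)-atoms are (1,r)-atoms; for larger [r] the atoms have to be
    resolved into better ones, which is the substance of the coincidence of the spaces H^{1,q}. *)
Lemma H1_norm_findec (q s : R) (r : \bar R) (f : V -> C) : 1 < q -> (1 < r)%E ->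
  cmeasurable f -> findec q%:E f s -> (H1_norm r f <= (2 * grid_cst (n := n) q * s)%:E)%E.
Proof.
move=> q1 r1 mf fs; apply/lee_addgt0Pr => e e0; have e20 : 0 < e / 2 by rewrite divr_gt0.
have part (y : C) : normc y <= 1 ->
    (H1_norm r (fun x : V => (Re (y * f x)%R)%:C%C) <= (grid_cst (n := n) q * s + e / 2)%:E)%E.
  move=> y1; have [L L0 [lF fF]] := findec_Lq0 q1 y1 mf fs.
  exact: (H1_norm_real L0 q1 r1 e20 lF fF).
have f1 := part 1; rewrite ComplexField.Normc.normc1 in f1.
have f2 := part (- 'i)%C; rewrite normcB normc_i in f2.
rewrite (_ : f = fun x => (Re (1 * f x))%:C%C + 'i%C * (Re ((- 'i)%C * f x))%:C%C); last first.
  apply/funext => x; rewrite mul1r [LHS]complexE; congr (_ + _ * _%:C%C).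
  by case: (f x) => u v /=; ring.
apply: le_trans (H1_normD r1 _ _) _.
rewrite (H1_normZ r1 'i%C (cmeasurable_real (measurable_Re_mul (- 'i)%C mf))).
rewrite normc_i mul1e.
apply: le_trans (leeD (f1 (lexx _)) (f2 (lexx _))) _.
rewrite -!EFinD lee_fin; move: (grid_cst q) => g; lra.
Qed.

Lemma H1_norm_le (q r : \bar R) : (1 < q)%E -> (1 < r)%E -> exists2 c : R, 0 < c &
  forall (f : V -> C) s, cmeasurable f -> findec q f s -> (H1_norm r f <= (c * s)%:E)%E.
Proof.
move=> q1 r1; have [p p1 qp] := @atom_exponent R n q q1.
have g0 := @grid_cst_ge0 R n p p1; exists (2 * grid_cst (n := n) p + 1); first lra.
move=> f s mf fs; have s0 := findec_ge0 fs.
have fp : findec p%:E f s.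
  by case: fs => l [la lf ls]; exists l; split=> // j /la /qp.
apply: le_trans (H1_norm_findec p1 r1 mf fp) _.
by rewrite lee_fin; nra.
Qed.

End norm_comparison.

(** * Norm axioms and equivalence *)

Section norm_axioms.
Context {R : realType} {n : nat}.
Local Notation V := 'rV[R]_n.
Local Notation C := R[i].
Local Notation mu := (@lebesgue_rV R n).
Local Notation normc := (@ComplexField.Normc.normc R).

Lemma H1fin_findec (q : \bar R) (f : V -> C) : H1fin q f -> cmeasurable f /\ exists s, findec q f s.
Proof.
move=> [mf [N [lam [a fla]]]]; split; first exact: mf.
by exists (\sum_(j < N) normc (lam j)); exact: (finite_findec fla).
Qed.

Lemma H1fin_norm_approx (q : \bar R) (f : V -> C) (h e : R) : H1fin_norm q f = h%:E -> 0 < e ->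
  findec q f (h + e).
Proof. by move=> fh e0; apply: H1fin_norm_findec; rewrite fh lte_fin ltrDl. Qed.

Lemma H1fin_norm_ae0 (q : \bar R) (f : V -> C) : {ae mu, forall x, f x = 0} ->
  H1fin_norm q f = 0%E.
Proof.
move=> f0; apply/eqP; rewrite eq_le H1fin_norm_ge0 andbT.
by apply: findec_H1fin_norm; apply: findec0.
Qed.

Lemma H1fin_norm_eq0 (q : \bar R) (f : V -> C) : (1 < q)%E -> cmeasurable f ->
  H1fin_norm q f = 0%E -> {ae mu, forall x, f x = 0}.
Proof.
move=> q1 mf f0; apply: L1norm_eq0 => //; apply/eqP; rewrite eq_le L1norm_ge0 andbT.
apply/lee_addgt0Pr => e e0; rewrite add0e.
have [l [la lf ls]] : findec q f (e / 2).
  by rewrite -[e / 2]add0r; apply: H1fin_norm_approx f0 _; rewrite divr_gt0.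
have [ml ll] := list_L1norm q1 la.
rewrite (L1norm_ae mf ml lf); apply: le_trans ll _.
by rewrite lee_fin; lra.
Qed.

Lemma H1fin_normD (q : \bar R) (f g : V -> C) :
  (H1fin_norm q (fun x => (f x + g x)%R) <= H1fin_norm q f + H1fin_norm q g)%E.
Proof.
have := H1fin_norm_ge0 q g; have := H1fin_norm_ge0 q f.
case Ef : (H1fin_norm q f) => [a| |//] a0; case Eg : (H1fin_norm q g) => [b| |//] b0;
  rewrite ?addey ?addye ?leey//.
apply/lee_addgt0Pr => e e0; have e20 : 0 < e / 2 by rewrite divr_gt0.
have := findec_H1fin_norm (findecD (H1fin_norm_approx Ef e20) (H1fin_norm_approx Eg e20)).
by rewrite -!EFinD addrACA -splitr.
Qed.

Lemma H1fin_normZ_le (q : \bar R) (k : C) (f : V -> C) : k != 0 ->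
  (H1fin_norm q (fun x => (k * f x)%R) <= (normc k)%:E * H1fin_norm q f)%E.
Proof.
move=> k0; have nk := normc_gt0 k0.
have := H1fin_norm_ge0 q f; case Ef : (H1fin_norm q f) => [a| |//] a0; last by rewrite gt0_muley ?leey.
apply/lee_addgt0Pr => e e0; have ek : 0 < e / normc k by rewrite divr_gt0.
have := findec_H1fin_norm (findecZ k (H1fin_norm_approx Ef ek)).
by rewrite mulrDr [normc k * (e / _)]mulrC divfK// gt_eqF.
Qed.

Lemma H1fin_normZ (q : \bar R) (k : C) (f : V -> C) :
  H1fin_norm q (fun x => (k * f x)%R) = ((normc k)%:E * H1fin_norm q f)%E.
Proof.
have [->|k0] := eqVneq k 0.
  rewrite normc0 mul0e; apply: H1fin_norm_ae0; apply: aeW => x; exact: mul0r.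
by apply: homogeneous_eq k0 => j g; exact: H1fin_normZ_le.
Qed.

Lemma is_norm_H1fin_norm (q : \bar R) (E : set (V -> C)) : (1 < q)%E -> E `<=` H1fin q ->
  is_norm E (H1fin_norm q).
Proof.
move=> q1 EH; split=> [f /EH/H1fin_findec[_ [s fs]]|f /EH/H1fin_findec[mf _]|k f _|f g _ _].
- by rewrite H1fin_norm_ge0 (le_lt_trans (findec_H1fin_norm fs))// ltry.
- by split; [exact: H1fin_norm_eq0|exact: H1fin_norm_ae0].
- exact: H1fin_normZ.
- exact: H1fin_normD.
Qed.

(** Finiteness on [E] comes from the comparison [H1_norm_le], and definiteness from the control of
    the L^1 norm by [H1_norm_L1norm]. *)
Lemma is_norm_H1_norm (q r : \bar R) (E : set (V -> C)) : (1 < q)%E -> (1 < r)%E ->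
  E `<=` H1fin q -> is_norm E (H1_norm r).
Proof.
move=> q1 r1 EH; have [c c0 cP] := @H1_norm_le R n q r q1 r1.
split=> [f /EH/H1fin_findec[mf [s fs]]|f /EH/H1fin_findec[mf _]|k f /EH/H1fin_findec[mf _]|f g _ _].
- by rewrite H1_norm_ge0 (le_lt_trans (cP f s mf fs))// ltry.
- split=> [f0|]; last exact: H1_norm_ae0.
  apply: L1norm_eq0 => //; apply/eqP; rewrite eq_le L1norm_ge0 andbT.
  by apply: le_trans (H1_norm_L1norm r1 f) _; rewrite f0 mule0.
- exact: H1_normZ.
- exact: H1_normD.
Qed.

Lemma H1_norm_le_H1fin_norm (q r : \bar R) : (1 < q)%E -> (1 < r)%E -> exists2 c : R, 0 < c &
  forall f : V -> C, cmeasurable f -> (H1_norm r f <= c%:E * H1fin_norm q f)%E.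
Proof.
move=> q1 r1; have [c c0 cP] := @H1_norm_le R n q r q1 r1; exists c => [//|f mf].
have := H1fin_norm_ge0 q f; case Ef : (H1fin_norm q f) => [a| |//] _; last by rewrite gt0_muley ?leey.
apply/lee_addgt0Pr => e e0; have ec : 0 < e / c by rewrite divr_gt0.
apply: le_trans (cP _ _ mf (H1fin_norm_approx Ef ec)) _.
by rewrite mulrDr [c * (e / _)]mulrC divfK ?gt_eqF.
Qed.

Lemma equivalent_H1_norms (q r : \bar R) (E : set (V -> C)) : (1 < q)%E -> (1 < r)%E ->
  E `<=` H1fin q -> E `<=` grid_dense q -> equivalent_norms E (H1fin_norm q) (H1_norm r).
Proof.
move=> q1 r1 EH Ed; split; [exact: is_norm_H1fin_norm|exact: is_norm_H1_norm EH|].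
have [c1 c10 c1P] := @H1_norm_le_H1fin_norm q r q1 r1.
have [c2 c20 c2P] := @H1fin_norm_le R n q r q1 r1.
exists c1^-1, c2; split; [by rewrite invr_gt0|exact: c20|] => f Ef.
split; last exact/c2P/Ed.
by rewrite lee_pdivrMl//; apply: c1P; case: (EH _ Ef).
Qed.

End norm_axioms.

Theorem theorem3p1 (R : realType) (n : nat) (n_ge1 : (1 <= n)%N) :
  (forall (q : R) (r : \bar R), 1 < q -> (1 < r)%E ->
     equivalent_norms (@H1fin R n q%:E) (H1fin_norm q%:E) (H1_norm r)) /\
  (forall r : \bar R, (1 < r)%E ->
     equivalent_norms (@H1fin R n +oo `&` Ccont) (H1fin_norm +oo) (H1_norm r)).
Proof.
split=> [q r q1 r1|r r1].
  apply: equivalent_H1_norms; [by rewrite lte_fin|exact: r1|by []|].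
  by move=> f /H1fin_findec[mf [s fs]]; exact: grid_dense_fin fs.
apply: equivalent_H1_norms; [by rewrite ltey|exact: r1|by move=> f []|].
by move=> f [/H1fin_findec[mf [s fs]] cf]; exact: grid_dense_oo fs.
Qed.
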